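(* Let $n>3$ be an odd prime and assume that, as $T\to\infty$, $$\sum_{\substack{1\le B\le T\\ B\text{ squarefree}}}\#\operatorname{Cl}(\mathbb{Q}(\sqrt{-B}))[n]\sim\frac{2T}{\zeta(2)},\qquad\sum_{\substack{1\le B\le T\\ B\text{ squarefree}}}\#\operatorname{Cl}(\mathbb{Q}(\sqrt{B}))[n]\sim\frac{n+1}{n}\cdot\frac{T}{\zeta(2)}.$$ Then $$\liminf_{T\to\infty}\frac{N_n(T)}{N_n^{\mathrm{loc}}(T)}>0.$$
   Context: $\operatorname{Cl}(\mathbb{Q}(\sqrt{\pm B}))[n]$ denotes the $n$-torsion of the ideal class group of the ring of integers. For nonzero integers $B,C$, $\mathcal{Y}_{B,C}$ is the stacky curve $[S/\mathbb{G}_m]$, $S:x^2+By^2=Cz^n$ minus the origin, weights $(n,n,2)$. $N_n(T)$ counts pairs of nonzero integers $(B,C)$ with $|B|,|C|<T$ such that $x^2+By^2=Cz^n$ has a primitive integer solution ($\gcd(x,y,z)=1$); $N_n^{\mathrm{loc}}(T)$ counts pairs with $|B|,|C|<T$ such that for every prime $p$ there is a primitive solution in $\mathbb{Z}_p^3$. *)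

(* Defs.v *)
From HB Require Import structures.
From mathcomp Require Import all_boot all_order all_algebra all_field.
From mathcomp Require Import finmap.
From mathcomp Require Import all_classical all_reals all_analysis.

Set Implicit Arguments.
Unset Strict Implicit.
Unset Printing Implicit Defensive.

Import Order.TTheory GRing.Theory Num.Theory.
Import numFieldNormedType.Exports.

Local Open Scope classical_set_scope.
Local Open Scope ring_scope.

(* The p-adic integers, as the inverse limit of the rings Z/p^k. A residue
   class mod p^k is represented by its canonical integer representative, so
   that the compatibility condition also says that f k is reduced mod p^k. *)
Definition padic_coherent (p : nat) (f : nat -> int) : Prop :=
  forall k, f k = (f k.+1 %% p%:Z ^+ k)%Z.

Record padic_int (p : nat) := PadicInt {
  padic_res :> nat -> int;
  padic_resP : padic_coherent p padic_res }.

Section PadicIntRing.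
Variable p : nat.
Implicit Types (f : nat -> int) (x y z : padic_int p).

HB.instance Definition _ := gen_eqMixin (padic_int p).
HB.instance Definition _ := gen_choiceMixin (padic_int p).

Lemma padic_eq x y : (forall k, x k = y k) -> x = y.
Proof.
case: x y => f hf [g hg] /= /funext fg; move: hf; rewrite fg => hf.
by rewrite (Prop_irrelevance hf hg).
Qed.

Lemma modz_mod_expS (m : int) k :
  ((m %% p%:Z ^+ k.+1)%Z %% p%:Z ^+ k)%Z = (m %% p%:Z ^+ k)%Z.
Proof.
by rewrite [in RHS](divz_eq m (p%:Z ^+ k.+1)) [X in _ * X]exprS mulrA modzMDl.
Qed.

Lemma padic_red_subproof f :
    (forall k, (f k.+1 %% p%:Z ^+ k)%Z = (f k %% p%:Z ^+ k)%Z) ->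
  padic_coherent p (fun k => (f k %% p%:Z ^+ k)%Z).
Proof. by move=> hf k; rewrite modz_mod_expS hf. Qed.

Lemma padic_mod x k : (x k.+1 %% p%:Z ^+ k)%Z = (x k %% p%:Z ^+ k)%Z.
Proof. by rewrite [x k]padic_resP modz_mod. Qed.

Lemma padic_modE x k : (x k %% p%:Z ^+ k)%Z = x k.
Proof. by rewrite -padic_mod -padic_resP. Qed.

Definition padic_of_int (m : int) : padic_int p :=
  PadicInt (@padic_red_subproof (fun=> m) (fun=> erefl)).

Lemma padic_add_subproof x y k :
  ((x k.+1 + y k.+1) %% p%:Z ^+ k = (x k + y k) %% p%:Z ^+ k)%Z.
Proof. by rewrite -modzDm !padic_mod modzDm. Qed.

Lemma padic_opp_subproof x k :
  ((- x k.+1) %% p%:Z ^+ k = (- x k) %% p%:Z ^+ k)%Z.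
Proof. by rewrite -modzNm padic_mod modzNm. Qed.

Lemma padic_mul_subproof x y k :
  ((x k.+1 * y k.+1) %% p%:Z ^+ k = (x k * y k) %% p%:Z ^+ k)%Z.
Proof. by rewrite -modzMm !padic_mod modzMm. Qed.

Definition padic_add x y := PadicInt (padic_red_subproof (padic_add_subproof x y)).
Definition padic_opp x := PadicInt (padic_red_subproof (padic_opp_subproof x)).
Definition padic_mul x y := PadicInt (padic_red_subproof (padic_mul_subproof x y)).

Fact padic_addA : associative padic_add.
Proof. by move=> x y z; apply: padic_eq => k /=; rewrite modzDmr modzDml addrA. Qed.
Fact padic_addC : commutative padic_add.
Proof. by move=> x y; apply: padic_eq => k /=; rewrite addrC. Qed.
Fact padic_add0 : left_id (padic_of_int 0) padic_add.
Proof. by move=> x; apply: padic_eq => k /=; rewrite modzDml add0r padic_modE. Qed.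
Fact padic_addN : left_inverse (padic_of_int 0) padic_opp padic_add.
Proof. by move=> x; apply: padic_eq => k /=; rewrite modzDml addNr. Qed.
Fact padic_mulA : associative padic_mul.
Proof. by move=> x y z; apply: padic_eq => k /=; rewrite modzMmr modzMml mulrA. Qed.
Fact padic_mulC : commutative padic_mul.
Proof. by move=> x y; apply: padic_eq => k /=; rewrite mulrC. Qed.
Fact padic_mul1 : left_id (padic_of_int 1) padic_mul.
Proof. by move=> x; apply: padic_eq => k /=; rewrite modzMml mul1r padic_modE. Qed.
Fact padic_mulDl : left_distributive padic_mul padic_add.
Proof. by move=> x y z; apply: padic_eq => k /=; rewrite modzMml modzDm mulrDl. Qed.

HB.instance Definition _ := GRing.isZmodule.Build (padic_int p)
  padic_addA padic_addC padic_add0 padic_addN.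
HB.instance Definition _ := GRing.Zmodule_isComPzRing.Build (padic_int p)
  padic_mulA padic_mulC padic_mul1 padic_mulDl.

End PadicIntRing.

Definition has_primitive_int_sol (n : nat) (B C : int) : Prop :=
  exists x y z : int,
    gcdz (gcdz x y) z = 1 /\ x ^+ 2 + B * y ^+ 2 = C * z ^+ n.

Definition has_primitive_padic_sol (n : nat) (B C : int) (p : nat) : Prop :=
  exists x y z : padic_int p,
    ~ (exists x' y' z' : padic_int p,
         [/\ x = p%:R * x', y = p%:R * y' & z = p%:R * z']) /\
    x ^+ 2 + B%:~R * y ^+ 2 = C%:~R * z ^+ n.

Definition count_pairs {R : realType} (P : int -> int -> Prop) (T : R) : nat :=
  #|` fset_set [set BC : int * int |
        [/\ BC.1 != 0, BC.2 != 0, `|BC.1|%:~R < T, `|BC.2|%:~R < T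
          & P BC.1 BC.2]] |.

Definition N_glob {R : realType} (n : nat) (T : R) : nat :=
  count_pairs (has_primitive_int_sol n) T.

Definition N_loc {R : realType} (n : nat) (T : R) : nat :=
  count_pairs
    (fun B C => forall p : nat, prime p -> has_primitive_padic_sol n B C p) T.

(* Number fields are viewed inside the field algC of algebraic numbers. *)
Definition quadratic_field (d : int) : set algC :=
  [set x | exists a b : rat, x = ratr a + ratr b * sqrtC d%:~R].

Section ClassGroup.
Variable K : set algC.
Implicit Types I J : set algC.

Definition ring_of_integers : set algC := [set x | K x /\ x \in Aint].

Definition fractional_ideal I : Prop :=
  [/\ I `<=` K,
      (exists2 x, I x & x != 0),
      (forall x y, I x -> I y -> I (x - y)),
      (forall a x, ring_of_integers a -> I x -> I (a * x)) &
      (exists d, [/\ ring_of_integers d, d != 0 &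
                     forall x, I x -> ring_of_integers (d * x)])].

Definition ideal_mul I J : set algC :=
  [set x | exists2 s : seq (algC * algC),
             (forall u, u \in s -> I u.1 /\ J u.2) &
             x = \sum_(u <- s) u.1 * u.2].

Definition ideal_exp I (n : nat) : set algC :=
  iter n (ideal_mul I) ring_of_integers.

(* The class of I: all its translates by nonzero principal ideals. *)
Definition ideal_class I : set (set algC) :=
  [set J | exists a, [/\ K a, a != 0 & J = [set a * x | x in I]]].

Definition class_group_torsion (n : nat) : set (set (set algC)) :=
  [set ideal_class I | I in
     [set I | fractional_ideal I /\
              ideal_class (ideal_exp I n) = ideal_class ring_of_integers]].

End ClassGroup.

Definition squarefree (B : nat) : bool :=
  [forall d : 'I_B.+1, (d ^ 2 %| B)%N ==> (d == 1 :> nat)].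

(* Summed in \bar R, where counting is the cardinality (+oo if infinite), so
   that the finiteness of class groups is not built into the definition. *)
Definition torsion_sum {R : realType} (n : nat) (sgn : int) (T : R) : \bar R :=
  (\sum_(1 <= B < (Num.truncn T).+1 | squarefree B)
     counting (class_group_torsion (quadratic_field (sgn * B%:Z)) n))%E.

Definition zeta2 (R : realType) : R :=
  limn (series (fun k : nat => (k.+1%:R ^+ 2)^-1 : R)).

Definition asymptotically {R : realType} (f : R -> \bar R) (g : R -> R) : Prop :=
  (f T * (g T)^-1%:E)%E @[T --> +oo] --> 1%:E.

(* Main.v *)
Require Import Defs.
From HB Require Import structures.
From mathcomp Require Import all_boot all_order all_algebra all_field.
From mathcomp Require Import finmap.
From mathcomp Require Import all_classical all_reals all_analysis.
From mathcomp Require Import zify ring lra.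

(* A local solution forces -B to be a square modulo every odd prime dividing C to
   an odd power and not dividing B. For fixed B such C are counted by a sieve (Hall's
   device) in terms of a sum of reciprocals of products of split primes, and
   averaging this sum over B gives N_loc(T) = O(T^2 / sqrt(log T)).

   Conversely, a nontrivial n-torsion group has at least 3 elements. Since its
   average order over the fields Q(sqrt(-B)) is 2, the n-torsion vanishes for a
   positive proportion of the squarefree B. For such B every odd squarefree C
   composed of split primes is represented: the ideal c = (C, r + sqrt(-B)) has
   norm C and finite order m prime to n in the class group, so a power c^(3 m e)
   with 3 m e = 1 + j n is generated by some x + y sqrt(-B) with x, y integers, the
   factor 3 removing the denominator 2 and requiring n > 3; then
   x^2 + B y^2 = C (C^j)^n, primitively. Finally, Chebyshev's inequality (for the
   number of split primes in short ranges) and Markov's inequality (for the sum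
   over nonsplit primes) show that most B have at least T / sqrt(log T) such C up
   to a constant. *)

Set Implicit Arguments.
Unset Strict Implicit.
Unset Printing Implicit Defensive.

Import Order.TTheory GRing.Theory Num.Theory.
Import numFieldNormedType.Exports.

Local Open Scope classical_set_scope.
Local Open Scope ring_scope.

(** * Arithmetic sums and Chebyshev's estimates *)

(** Both counts have order T^2 / sqrt(log T) for the same reason: at an odd prime p about half of
    the residues B make -B a square, so sums of reciprocals over products of primes so restricted
    average to at most a constant times sqrt(log T). The small split primes of an individual field
    are hard to control, so everything is averaged over B, where distinct primes are independent by
    the Chinese remainder theorem. Averages give only upper bounds; the lower bound for the split
    sum comes from the nonsplit one, as the two multiply to at least a constant times log T. The
    proportions must fit: torsion leaves N / 40 good B, since 3 elements exceed the average 2, and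
    the two exceptional sets are kept below N / 100 each. The scale k, with 16^(30 k) <= N < 16^(30
    (k + 1)) and N the integer part of T, stands for log T. Base 16 lets crude Chebyshev estimates
    find primes in every block (16^j, 16^(j+1)] with j >= 3; the exponent 30 = 2 * 14 + 2 keeps the
    blocks used, j <= 14 k, below the square root of N with a power to spare. *)

Lemma sum_uniq_sub (R : realType) (I : eqType) (s t : seq I) (F : I -> R) :
  uniq s -> {subset s <= t} -> (forall x, x \in t -> 0 <= F x) ->
  \sum_(x <- s) F x <= \sum_(x <- t) F x.
Proof.
elim: s t => [|x s IH] t /=.
  by move=> _ _ h; rewrite big_nil big_seq; apply: sumr_ge0 => i; exact: h.
case/andP=> xs us sub h.
have xt : x \in t by apply: sub; rewrite mem_head.
rewrite (perm_big _ (perm_to_rem xt)) !big_cons lerD2l; apply: IH => //.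
  move=> y ys; have yt : y \in t by apply: sub; rewrite in_cons ys orbT.
  move: yt; rewrite (perm_mem (perm_to_rem xt)) in_cons => /orP[/eqP yx|//].
  by rewrite -yx ys in xs.
by move=> y /mem_rem; exact: h.
Qed.

Lemma ler_sum_inj (R : realType) (I J : eqType) (s : seq I) (t : seq J)
    (f : I -> J) (F : J -> R) :
  uniq s -> {in s &, injective f} -> (forall x, x \in s -> f x \in t) ->
  (forall y, y \in t -> 0 <= F y) ->
  \sum_(x <- s) F (f x) <= \sum_(y <- t) F y.
Proof.
move=> us inj st h; rewrite -(big_map f xpredT); apply: sum_uniq_sub => //.
  by rewrite map_inj_in_uniq.
by move=> y /mapP[x xs ->]; exact: st.
Qed.

Lemma ler_sum_surj (R : realType) (I J : eqType) (s : seq I) (t : seq J)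
    (f : I -> J) (F : J -> R) :
  uniq t -> (forall y, y \in t -> exists2 x, x \in s & f x = y) ->
  (forall x, x \in s -> 0 <= F (f x)) ->
  \sum_(y <- t) F y <= \sum_(x <- s) F (f x).
Proof.
move=> ut st h; rewrite -(big_map f xpredT); apply: sum_uniq_sub => //.
  by move=> y /st[x xs <-]; apply/map_f.
by move=> _ /mapP[x xs ->]; exact: h.
Qed.

Lemma squarefreeP m : (0 < m)%N ->
  reflect (forall p, prime p -> ~~ (p ^ 2 %| m)%N) (squarefree m).
Proof.
move=> m0; apply: (iffP forallP) => [h p pp | h d].
  apply/negP => pm; have pl : (p < m.+1)%N.
    by rewrite ltnS; apply: dvdn_leq => //; apply: dvdn_trans pm; rewrite dvdn_exp.
  have /implyP/(_ pm)/eqP/= e := h (Ordinal pl).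
  by rewrite e in pp.
apply/implyP => dm; apply/negP => /negP d1.
have d0 : (0 < d)%N.
  by rewrite lt0n; apply/negP => /eqP d0; move: dm; rewrite d0 dvd0n; lia.
have d2 : (1 < d)%N by move: d1 d0; case: (nat_of_ord d) => [|[|]].
have /negP := h _ (pdiv_prime d2); apply.
by apply: dvdn_trans dm; rewrite dvdn_exp2r // pdiv_dvd.
Qed.

Lemma squarefree_dvd d m : (0 < m)%N -> (d %| m)%N -> squarefree m -> squarefree d.
Proof.
move=> m0 dm /(squarefreeP m0) h; apply/squarefreeP; first exact: dvdn_gt0 dm.
by move=> p /h; apply: contra => /dvdn_trans; apply.
Qed.

Lemma squarefree_mul_prime p m : prime p -> (0 < m)%N ->
  squarefree (p * m) = ~~ (p %| m)%N && squarefree m.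
Proof.
move=> pp m0; have pm0 : (0 < p * m)%N by rewrite muln_gt0 prime_gt0.
apply/idP/andP => [h|[pm /(squarefreeP m0) h]].
  split; last exact: squarefree_dvd (dvdn_mull _ _) h.
  by move/(squarefreeP pm0): h => /(_ p pp); rewrite expnS expn1 dvdn_pmul2l // prime_gt0.
apply/squarefreeP => // q qp; have [->|qNp] := eqVneq q p.
  by rewrite expnS expn1 dvdn_pmul2l // prime_gt0.
rewrite Gauss_dvdr ?h // coprimeXl // prime_coprime //.
by rewrite dvdn_prime2.
Qed.

Lemma squarefree_decomp m : (0 < m)%N ->
  exists u d, [/\ (0 < u)%N, (0 < d)%N, squarefree u & m = u * d ^ 2]%N.
Proof.
elim/ltn_ind: m => m IH m0.
have [/squarefreeP sq|/squarefreeP nsq] := boolP (squarefree m).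
  exists m, 1%N; split => //; last by rewrite muln1.
  by apply/squarefreeP => //; apply: sq.
have [p pp pm] : exists2 p, prime p & (p ^ 2 %| m)%N.
  apply: contrapT => H; apply: nsq => // p pp; apply/negP => pm; apply: H.
  by exists p.
have p1 := prime_gt1 pp.
have mE := divnK pm; set k := (m %/ p ^ 2)%N in mE.
have k0 : (0 < k)%N by rewrite divn_gt0 ?expn_gt0 ?prime_gt0 // dvdn_leq.
have [u [d [u0 d0 su kE]]] : exists u d, [/\ (0 < u)%N, (0 < d)%N, squarefree u & k = u * d ^ 2]%N.
  by apply: IH => //; rewrite -mE; nia.
exists u, (d * p)%N; split => //; first by rewrite muln_gt0 d0; lia.
by rewrite -mE kE expnMn mulnA.
Qed.

Definition oddsqf (m : nat) := [&& (0 < m)%N, odd m & squarefree m].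

Definition oddsqf_all (P : pred nat) (m : nat) := oddsqf m && all P (primes m).

Lemma oddsqf1 : oddsqf 1.
Proof. by rewrite /oddsqf /=; apply/squarefreeP => // p pp; rewrite dvdn1 expnS expn1 muln_eq1; case: p pp => [|[|]]. Qed.

Lemma oddsqf_dvd d m : oddsqf m -> (d %| m)%N -> oddsqf d.
Proof.
case/and3P=> m0 om sm dm; apply/and3P; split.
- exact: dvdn_gt0 dm.
- exact: dvdn_odd dm om.
- exact: squarefree_dvd dm sm.
Qed.

Lemma oddsqf_gt0 m : oddsqf m -> (0 < m)%N. Proof. by case/and3P. Qed.

Lemma oddsqf_mul_prime p m : prime p ->
  oddsqf (p * m) = [&& odd p, ~~ (p %| m)%N & oddsqf m].
Proof.
move=> pp; rewrite /oddsqf; case: m => [|m]; first by rewrite muln0 dvdn0 !andbF.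
rewrite squarefree_mul_prime // oddM muln_gt0 prime_gt0 //=.
by case: (odd p); case: (_ %| _)%N; case: (odd _); rewrite ?andbT ?andbF.
Qed.

Lemma oddsqf_ind (Q : nat -> Prop) :
  Q 1%N ->
  (forall p m, prime p -> odd p -> ~~ (p %| m)%N -> oddsqf m -> Q m -> Q (p * m)%N) ->
  forall m, oddsqf m -> Q m.
Proof.
move=> Q1 Qp m; elim/ltn_ind: m => m IH om.
have [-> //|m1] := eqVneq m 1%N.
have m0 := oddsqf_gt0 om.
have m2 : (1 < m)%N by lia.
have pp := pdiv_prime m2; have pm := pdiv_dvd m.
have mE : m = (pdiv m * (m %/ pdiv m))%N by rewrite mulnC divnK.
rewrite mE oddsqf_mul_prime // in om; case/and3P: om => op pk ok.
rewrite mE; apply: Qp => //; apply: IH => //.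
by apply: ltn_Pdiv => //; apply: prime_gt1.
Qed.

Lemma oddsqf_all_dvd (P : pred nat) d m : oddsqf_all P m -> (d %| m)%N -> oddsqf_all P d.
Proof.
case/andP=> om /allP h dm; rewrite /oddsqf_all (oddsqf_dvd om dm) /=.
apply/allP => p; rewrite mem_primes => /and3P[pp d0 pd]; apply: h.
by rewrite mem_primes pp (oddsqf_gt0 om) (dvdn_trans pd dm).
Qed.

Lemma oddsqf_allP (P : pred nat) m : reflect
  (oddsqf m /\ forall p, prime p -> (p %| m)%N -> P p) (oddsqf_all P m).
Proof.
apply: (iffP andP) => -[om h]; split => //.
  by move=> p pp pm; move/allP: h; apply; rewrite mem_primes pp pm (oddsqf_gt0 om).
by apply/allP => p; rewrite mem_primes => /and3P[pp _ pm]; exact: h.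
Qed.

Lemma oddsqf_all_mul_prime (P : pred nat) p m : prime p ->
  oddsqf_all P (p * m) = [&& P p, odd p, ~~ (p %| m)%N & oddsqf_all P m].
Proof.
move=> pp; apply/idP/and4P => [/oddsqf_allP|[Pp op pm /oddsqf_allP[om h]]].
  rewrite oddsqf_mul_prime // => -[/and3P[op pm om] h]; split => //.
    by apply: h => //; rewrite dvdn_mulr.
  by apply/oddsqf_allP; split => // q qp qm; apply: h => //; rewrite dvdn_mull.
apply/oddsqf_allP; rewrite oddsqf_mul_prime // op pm om; split => // q qp.
by rewrite Euclid_dvdM // => /orP[|]; [rewrite dvdn_prime2 // => /eqP->|exact: h].
Qed.

Definition recip_sum (R : realType) (P : pred nat) (X : nat) : R :=
  \sum_(1 <= m < X.+1 | P m) m%:R^-1.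

Lemma recip_sum_ge0 (R : realType) P X : 0 <= recip_sum R P X.
Proof. by apply: sumr_ge0 => i _; rewrite invr_ge0. Qed.

Lemma recip_sumS (R : realType) P X :
  recip_sum R P X.+1 = recip_sum R P X + (if P X.+1 then X.+1%:R^-1 else 0).
Proof. by rewrite /recip_sum big_mkcond big_nat_recr //= -big_mkcond. Qed.

(** Both bounds are ln (1 + x) <= x, at x = 1/n and at x = -1/(n+1). *)
Lemma lnS_bounds (R : realType) (n : nat) : (0 < n)%N ->
  n.+1%:R^-1 <= ln n.+1%:R - ln (n%:R : R) <= n%:R^-1.
Proof.
move=> n0; have n0' : (0 : R) < n%:R by rewrite ltr0n.
have nE : ln n.+1%:R - ln (n%:R : R) = ln (1 + n%:R^-1).
  rewrite -ln_div ?posrE ?ltr0n // -(natr1 n) mulrDl divff ?mul1r //.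
  by rewrite gt_eqF.
have nE' : ln n.+1%:R - ln (n%:R : R) = - ln (1 - n.+1%:R^-1).
  rewrite -opprB -ln_div ?posrE ?ltr0n //; congr (- ln _).
  have : (n.+1%:R : R) != 0 by rewrite gt_eqF.
  by move=> h; apply: (mulIf h); rewrite mulrBl mul1r mulVf // divfK // -(natr1 n) addrK.
apply/andP; split.
  rewrite nE' lerNr; apply: le_ln1Dx.
  by rewrite ltrN2 invf_lt1 ?ltr0n // ltr1n.
by rewrite nE; apply: le_ln1Dx; apply: lt_trans (_ : 0 < _); rewrite ?invr_gt0 // ltrN10.
Qed.

Lemma harm_le (R : realType) X : (0 < X)%N -> recip_sum R predT X <= 1 + ln X%:R.
Proof.
case: X => // X _; elim: X => [|X IH].
  by rewrite /recip_sum big_nat1 invr1 ln1 addr0.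
rewrite recip_sumS /=; have /andP[h _] := @lnS_bounds R X.+1 isT.
by rewrite -[ln _](subrK (ln X.+1%:R)) [_ - _ + _]addrC addrA lerD.
Qed.

Lemma harm_ge (R : realType) X : ln X.+1%:R <= recip_sum R predT X.
Proof.
elim: X => [|X IH]; first by rewrite ln1 recip_sum_ge0.
rewrite recip_sumS /=; have /andP[_ h] := @lnS_bounds R X.+1 isT.
by rewrite -[ln _](subrK (ln X.+1%:R)) [_ - _ + _]addrC lerD.
Qed.

Lemma sum_inv_sq_le2 (R : realType) X : \sum_(1 <= d < X.+1) (d%:R ^+ 2)^-1 <= 2 :> R.
Proof.
(* The subtracted term makes the induction telescope: 1/(d+1)^2 <= 1/d - 1/(d+1). *)
have h Y : \sum_(1 <= d < Y.+2) (d%:R ^+ 2)^-1 <= 2 - Y.+1%:R^-1 :> R.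
  elim: Y => [|Y IH]; first by rewrite big_nat1 invr1 expr1n invr1; lra.
  rewrite big_nat_recr //=.
  suff: (Y.+2%:R ^+ 2)^-1 <= Y.+1%:R^-1 - Y.+2%:R^-1 :> R.
    by move=> /(lerD IH); rewrite addrA subrK.
  have y0 : (0 : R) < Y.+1%:R by rewrite ltr0n.
  rewrite -(natr1 Y.+1); move: y0; move: (Y.+1%:R) => y y0.
  have -> : y^-1 - (y + 1)^-1 = (y * (y + 1))^-1.
    by field; rewrite !gt_eqF ?addr_gt0.
  have y1 : 0 < y + 1 by lra.
  by rewrite lef_pV2 ?posrE ?mulr_gt0 ?exprn_gt0 // expr2 ler_wpM2r; lra.
case: X => [|X]; first by rewrite big_nil; lra.
by apply: le_trans (h X) _; rewrite gerBl invr_ge0.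
Qed.

Definition rng (P : pred nat) (X : nat) : seq nat :=
  [seq m <- index_iota 1 X.+1 | P m].

Lemma mem_rng P X m : (m \in rng P X) = [&& P m, (0 < m)%N & (m <= X)%N].
Proof. by rewrite mem_filter mem_index_iota ltnS. Qed.

Lemma rng_uniq P X : uniq (rng P X).
Proof. by rewrite filter_uniq // iota_uniq. Qed.

Lemma sum_rng (R : realType) P X (F : nat -> R) :
  \sum_(1 <= m < X.+1 | P m) F m = \sum_(m <- rng P X) F m.
Proof. by rewrite big_filter. Qed.

Lemma recip_sumE (R : realType) P X :
  recip_sum R P X = \sum_(m <- rng P X) m%:R^-1.
Proof. exact: sum_rng. Qed.

(** Tool for rearranging multiplicative sums: for an upper bound a parametrization need only cover
    [t], overlaps being harmless for nonnegative terms. The dual version below asks for injectivity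
    instead. *)
Lemma ler_sum_pairs (R : realType) (I J K : eqType) (s1 : seq I)
    (s2 : I -> seq J) (t : seq K) (f : I -> J -> K) (F : K -> R) :
  uniq t ->
  (forall y, y \in t -> exists i j, [/\ i \in s1, j \in s2 i & f i j = y]) ->
  (forall i j, i \in s1 -> j \in s2 i -> 0 <= F (f i j)) ->
  \sum_(y <- t) F y <= \sum_(i <- s1) \sum_(j <- s2 i) F (f i j).
Proof.
move=> ut st h.
have -> : \sum_(i <- s1) \sum_(j <- s2 i) F (f i j) =
  \sum_(z <- [seq existT (fun=> J) i j | i <- s1, j <- s2 i]) F (f (tag z) (tagged z)).
  by rewrite big_allpairs_dep.
apply: (@ler_sum_surj R _ _ _ t (fun z : {i : I & J} => f (tag z) (tagged z))) => //.
  move=> y /st[i [j [i1 j2 <-]]]; exists (existT (fun=> J) i j) => //.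
  by apply/allpairsPdep; exists i, j.
by move=> _ /allpairsPdep[i [j [i1 j2 ->]]] /=; exact: h.
Qed.

Lemma ler_pairs_sum (R : realType) (I J K : eqType) (s1 : seq I)
    (s2 : I -> seq J) (t : seq K) (f : I -> J -> K) (F : K -> R) :
  uniq s1 -> (forall i, i \in s1 -> uniq (s2 i)) ->
  (forall i j, i \in s1 -> j \in s2 i -> f i j \in t) ->
  (forall i j i' j', i \in s1 -> j \in s2 i -> i' \in s1 -> j' \in s2 i' ->
     f i j = f i' j' -> i = i' /\ j = j') ->
  (forall y, y \in t -> 0 <= F y) ->
  \sum_(i <- s1) \sum_(j <- s2 i) F (f i j) <= \sum_(y <- t) F y.
Proof.
move=> u1 u2 st inj h.
have -> : \sum_(i <- s1) \sum_(j <- s2 i) F (f i j) =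
  \sum_(z <- [seq existT (fun=> J) i j | i <- s1, j <- s2 i]) F (f (tag z) (tagged z)).
  by rewrite big_allpairs_dep.
apply: (@ler_sum_inj R _ _ _ t (fun z : {i : I & J} => f (tag z) (tagged z))) => //.
- apply: allpairs_uniq_dep => //.
  by move=> [i j] [i' j'] _ _.
- move=> _ _ /allpairsPdep[i [j [i1 j2 ->]]] /allpairsPdep[i' [j' [i1' j2' ->]]] /=.
  by move=> /inj[]// -> ->.
- by move=> _ /allpairsPdep[i [j [i1 j2 ->]]] /=; exact: st.
Qed.

(** The factor 3 is 2 * 3/2: removing the square part d^2 costs the sum of 1/d^2, at most 2, and
    removing a possible prime factor 2 costs 1 + 1/2. *)
Lemma harm_le_oddsqf (R : realType) X :
  recip_sum R predT X <= 3 * recip_sum R oddsqf X.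
Proof.
pose S := recip_sum R squarefree X.
have h1 : recip_sum R predT X <= 2 * S.
  rewrite /S !recip_sumE mulr_sumr.
  apply: le_trans (_ : \sum_(u <- rng squarefree X) \sum_(d <- rng predT X)
     ((u * d ^ 2)%N%:R)^-1 <= _).
    apply: (@ler_sum_pairs R _ _ _ _ (fun=> rng predT X) _ (fun u d => (u * d ^ 2)%N)
      (fun m => m%:R^-1)) => //; first exact: rng_uniq.
    move=> m; rewrite mem_rng => /and3P[_ m0 mX].
    have [u [d [u0 d0 su mE]]] := squarefree_decomp m0.
    exists u, d; rewrite !mem_rng su u0 d0 /=; split=> //; nia.
  apply: ler_sum => u _.
  have -> : \sum_(d <- rng predT X) ((u * d ^ 2)%N%:R)^-1 =
     u%:R^-1 * \sum_(1 <= d < X.+1) (d%:R ^+ 2)^-1 :> R.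
    rewrite sum_rng mulr_sumr; apply: eq_bigr => d _.
    by rewrite natrM natrX invfM.
  by rewrite mulrC ler_wpM2r ?invr_ge0 // sum_inv_sq_le2.
have h2 : S <= 3 / 2 * recip_sum R oddsqf X.
  have -> : S = recip_sum R oddsqf X +
                recip_sum R (fun m => squarefree m && ~~ odd m) X.
    rewrite /S !recip_sumE !big_filter /= (bigID odd) /=; congr (_ + _).
    rewrite [LHS]big_nat_cond [RHS]big_nat_cond; apply: eq_bigl => m; rewrite /oddsqf.
    by case: (0 < m)%N => //=; rewrite [squarefree _ && _]andbC.
  suff : recip_sum R (fun m => squarefree m && ~~ odd m) X <=
         2^-1 * recip_sum R oddsqf X by lra.
  rewrite !recip_sumE mulr_sumr.
  apply: le_trans (_ : \sum_(m <- rng oddsqf X) (2 * m)%N%:R^-1 <= _).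
    apply: (@ler_sum_surj R _ _ _ _ (fun m => 2 * m)%N (fun m => m%:R^-1)).
    - exact: rng_uniq.
    - move=> m; rewrite mem_rng => /and3P[/andP[sm om] m0 mX].
      have mE : m = (2 * m./2)%N by rewrite mul2n; lia.
      have k0 : (0 < m./2)%N by lia.
      move: sm; rewrite mE squarefree_mul_prime // dvdn2 negbK => /andP[ok sk].
      by exists m./2; rewrite // mem_rng /oddsqf k0 ok sk /=; lia.
    - by move=> m _; rewrite invr_ge0.
  by apply: ler_sum => m _; rewrite natrM invfM.
by apply: le_trans h1 _; lra.
Qed.

Lemma primes_prop_part (P : pred nat) (m : nat) (pi := [pred p | P p] : nat_pred) :
  oddsqf m -> oddsqf_all P (m`_pi)%N /\ oddsqf_all (predC P) (m`_(negn pi))%N.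
Proof.
move=> om; have m0 := oddsqf_gt0 om.
by split; rewrite /oddsqf_all (oddsqf_dvd om (dvdn_part _ _)) /=;
  rewrite primes_part; apply/allP => p; rewrite mem_filter => /andP[].
Qed.

(** Each odd squarefree m is the product of its [P]-part and the complementary part, both at most
    [X]. Later an upper bound for one factor becomes a lower bound for the other. *)
Lemma recip_sum_split (R : realType) (P : pred nat) X :
  recip_sum R oddsqf X <=
  recip_sum R (oddsqf_all P) X * recip_sum R (oddsqf_all (predC P)) X.
Proof.
rewrite !recip_sumE mulr_suml.
under [leRHS]eq_bigr do rewrite mulr_sumr.
apply: le_trans (_ : \sum_(a <- rng (oddsqf_all P) X)
    \sum_(b <- rng (oddsqf_all (predC P)) X) ((a * b)%N%:R)^-1 <= _); last first.
  by apply: ler_sum => a _; apply: ler_sum => b _; rewrite natrM invfM.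
apply: (@ler_sum_pairs R _ _ _ _ (fun=> rng (oddsqf_all (predC P)) X) _ muln
  (fun m => m%:R^-1)) => //; first exact: rng_uniq.
move=> m; rewrite mem_rng => /and3P[om m0 mX].
have [h1 h2] := primes_prop_part P om.
pose pi := [pred p | P p] : nat_pred.
exists (m`_pi)%N, (m`_(negn pi))%N; rewrite !mem_rng h1 h2 !part_gt0 /=.
split; last exact: partnC.
  by apply: leq_trans mX; apply: dvdn_leq => //; apply: dvdn_part.
by apply: leq_trans mX; apply: dvdn_leq => //; apply: dvdn_part.
Qed.

(** * Divisor functions and the averaged sieve *)

Definition tau (m : nat) := size (divisors m).

Lemma tau_gt0 m : (0 < m)%N -> (0 < tau m)%N.
Proof. by move=> /divisors_id; rewrite /tau; case: (divisors m). Qed.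

Lemma mem_divisors d m : (0 < m)%N -> (d \in divisors m) = (d %| m)%N.
Proof. by move=> m0; rewrite dvdn_divisors. Qed.

(** A divisor d of ab is recovered from the pair gcd(d, a), d / gcd(d, a), whose second entry
    divides b. *)
Lemma tau_submul a b : (0 < a)%N -> (0 < b)%N -> (tau (a * b) <= tau a * tau b)%N.
Proof.
move=> a0 b0; have ab0 : (0 < a * b)%N by rewrite muln_gt0 a0.
rewrite /tau -(size_allpairs muln); apply: uniq_leq_size (divisors_uniq _) _ => d.
rewrite mem_divisors // => dab; apply/allpairsP; exists (gcdn d a, (d %/ gcdn d a)%N).
have g0 : (0 < gcdn d a)%N by rewrite gcdn_gt0 a0 orbT.
split => /=; rewrite ?mem_divisors ?dvdn_gcdr //; last by rewrite mulnC divnK // dvdn_gcdl.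
have cop : coprime (d %/ gcdn d a) (a %/ gcdn d a).
  by rewrite /coprime -(eqn_pmul2r g0) muln_gcdl !divnK ?dvdn_gcdl ?dvdn_gcdr // mul1n.
rewrite -(Gauss_dvdr _ cop) -(dvdn_pmul2r g0) divnK ?dvdn_gcdl //.
by rewrite mulnAC divnK ?dvdn_gcdr.
Qed.

Lemma tau_dvd d m : (0 < m)%N -> (d %| m)%N -> (tau d <= tau m)%N.
Proof.
move=> m0 dm; apply: uniq_leq_size (divisors_uniq _) _ => e.
have d0 := dvdn_gt0 m0 dm.
by rewrite !mem_divisors // => /dvdn_trans; apply.
Qed.

Lemma tau_prime p : prime p -> (tau p <= 2)%N.
Proof.
move=> pp; apply: (@uniq_leq_size _ _ [:: 1%N; p]) (divisors_uniq _) _ => d.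
rewrite mem_divisors ?prime_gt0 // !inE => dp.
by case/primeP: pp => _ /(_ _ dp).
Qed.

(** Spreading 1/m over the divisors of m gives each the weight 1/(m tau(m)). The pairs (a, b) of the
    expanded square inject into pairs (m, divisor) by (ab, a), and submultiplicativity of [tau]
    compares the weights. *)
Lemma recip_tau_sqr (R : realType) X :
  (\sum_(a <- rng predT X) (a * tau a)%N%:R^-1) ^+ 2 <=
  recip_sum R predT (X * X).
Proof.
rewrite expr2 mulr_suml; under eq_bigr do rewrite mulr_sumr.
pose F (m : nat) : R := (m * tau m)%N%:R^-1.
have -> : recip_sum R predT (X * X) =
    \sum_(m <- rng predT (X * X)) \sum_(d <- divisors m) F m.
  rewrite recip_sumE; apply: eq_big_seq => m; rewrite mem_rng => /and3P[_ m0 _].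
  rewrite big_const_seq count_predT iter_addr_0 -/(tau m) /F natrM invfM.
  by rewrite -[RHS]mulr_natr -mulrA mulVf ?mulr1 // pnatr_eq0 -lt0n tau_gt0.
apply: le_trans (_ : \sum_(a <- rng predT X) \sum_(b <- rng predT X) F (a * b)%N <= _).
  rewrite big_seq [leRHS]big_seq; apply: ler_sum => a; rewrite mem_rng => /and3P[_ a0 _].
  rewrite big_seq [leRHS]big_seq; apply: ler_sum => b; rewrite mem_rng => /and3P[_ b0 _].
  rewrite /F -invfM -natrM lef_pV2 ?posrE ?ltr0n ?muln_gt0 ?a0 ?b0 ?tau_gt0 ?muln_gt0 ?a0 //.
  by rewrite ler_nat mulnACA leq_mul // tau_submul.
pose t := [seq (m, d) | m <- rng predT (X * X), d <- divisors m].
have -> : \sum_(m <- rng predT (X * X)) \sum_(d <- divisors m) F m =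
    \sum_(z <- t) F z.1 by rewrite big_allpairs_dep.
apply: (@ler_pairs_sum R _ _ _ _ (fun=> rng predT X) t (fun a b => (a * b, a)%N)
  (fun z => F z.1)); do ?[exact: rng_uniq | by move=> *; exact: rng_uniq].
- move=> a b; rewrite !mem_rng => /and3P[_ a0 aX] /and3P[_ b0 bX].
  apply/allpairsPdep; exists (a * b)%N, a; rewrite mem_rng mem_divisors ?muln_gt0 ?a0 //.
  by rewrite b0 /= leq_mul ?dvdn_mulr.
- move=> a b a' b'; rewrite mem_rng => /and3P[_ a0 _] _ _ _ [e aa]; rewrite -aa in e *.
  by move/eqP: e; rewrite eqn_pmul2l // => /eqP.
- by move=> z _; rewrite invr_ge0.
Qed.

Definition sigma (R : realType) (m : nat) : R := \sum_(d <- divisors m) d%:R.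

Lemma sigma_mul_prime (R : realType) p m : prime p -> (0 < m)%N -> ~~ (p %| m)%N ->
  p.+1%:R * sigma R m <= sigma R (p * m).
Proof.
move=> pp m0 pm; have p0 := prime_gt0 pp.
have -> : p.+1%:R * sigma R m =
    \sum_(e <- [:: 1%N; p]) \sum_(d <- divisors m) (e * d)%N%:R.
  rewrite !big_cons big_nil addr0 -natr1 mulrDl mul1r addrC; congr (_ + _).
    by apply: eq_bigr => d _; rewrite mul1n.
  by rewrite mulr_sumr; apply: eq_bigr => d _; rewrite natrM.
have div_m d : d \in divisors m -> ~~ (p %| d)%N.
  by rewrite mem_divisors // => dm; apply: contra pm => /dvdn_trans; apply.
apply: (@ler_pairs_sum R _ _ _ _ (fun=> divisors m) (divisors (p * m)) muln
  (fun d => d%:R)) => //.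
- by rewrite /= inE andbT neq_ltn prime_gt1.
- by move=> *; exact: divisors_uniq.
- move=> e d; rewrite !mem_divisors ?muln_gt0 ?p0 // => e1 dm; apply: dvdn_mul => //.
  by move: e1; rewrite !inE => /orP[] /eqP-> //; exact: dvd1n.
- move=> e d e' d' e1 d1 e1' d1' E.
  have eE : e = e'.
    move: e1 e1' (div_m _ d1) (div_m _ d1'); rewrite !inE.
    move=> /orP[] /eqP ee /orP[] /eqP ee'; move: E; rewrite ee ee' ?mul1n //.
      by move=> ->; rewrite dvdn_mulr.
    by move=> <- _; rewrite dvdn_mulr.
  split => //; move: E; rewrite eE => /eqP; rewrite eqn_pmul2l; first by move/eqP.
  by move: e1'; rewrite !inE => /orP[] /eqP->.
Qed.

Definition rcount (P : nat -> pred nat) (a : nat) : nat :=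
  count (fun x => all (P^~ x) (primes a)) (iota 0 a).

Definition residual (P : nat -> pred nat) := forall p x, P p (x %% p)%N = P p x.

Lemma residual_mod P p k x : residual P -> (p %| k)%N -> P p (x %% k)%N = P p x.
Proof. by move=> h pk; rewrite -h modn_dvdm // h. Qed.

Lemma rcount_prime P p : prime p -> rcount P p = count (P p) (iota 0 p).
Proof.
by move=> pp; rewrite /rcount primes_prime //; apply: eq_count => x /=; rewrite andbT.
Qed.

(** Chinese remainder theorem: a residue modulo pm is determined by its residues modulo p and m, and
    the tests at the primes of pm are distributed over the two. *)
Lemma rcount_mul P p m : residual P -> prime p -> (0 < m)%N -> ~~ (p %| m)%N ->
  (rcount P (p * m) <= rcount P p * rcount P m)%N.
Proof.
move=> rP pp m0 pm; have p0 := prime_gt0 pp.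
have cop : coprime p m by rewrite prime_coprime.
rewrite /rcount -!size_filter -(size_allpairs pair).
set s := [seq x <- iota 0 (p * m) | _].
rewrite -(size_map (fun x => (x %% p, x %% m)%N) s); apply: uniq_leq_size.
  rewrite map_inj_in_uniq ?filter_uniq ?iota_uniq // => x y.
  rewrite !mem_filter !mem_iota !add0n /= => /andP[_ xl] /andP[_ yl] [] ep em.
  have : x == y %[mod p * m] by rewrite chinese_remainder // ep em !eqxx.
  by rewrite !modn_small // => /eqP.
move=> _ /mapP[x + ->]; rewrite mem_filter => /andP[/allP h _].
apply/allpairsP; exists (x %% p, x %% m)%N; split => //=.
  rewrite mem_filter mem_iota /= ltn_mod p0 andbT; apply/allP => q qp /=.
  rewrite residual_mod //; first by apply: h; rewrite primesM // qp.
  by move: qp; rewrite mem_primes => /and3P[].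
rewrite mem_filter mem_iota /= ltn_mod m0 andbT; apply/allP => q qm /=.
rewrite residual_mod //; first by apply: h; rewrite primesM // qm orbT.
by move: qm; rewrite mem_primes => /and3P[].
Qed.

(** The comparison is made one prime at a time: since tau(p) = 2 and sigma(p) = p + 1, the
    hypothesis says tau(p) * [rcount P p] <= sigma(p). *)
Lemma rcount_bound (R : realType) P a : residual P ->
  (forall p, prime p -> odd p -> 2 * count (P p) (iota 0 p) <= p.+1)%N ->
  oddsqf a -> (rcount P a * tau a)%N%:R <= sigma R a.
Proof.
move=> rP half; move: a; apply: oddsqf_ind => [|p m pp op pm om IH].
  by rewrite /sigma /tau /rcount /= /divisors /= big_seq1.
have m0 := oddsqf_gt0 om.
apply: le_trans (sigma_mul_prime R pp m0 pm).
apply: le_trans (ler_wpM2l _ IH); rewrite ?ler0n // -natrM ler_nat.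
apply: leq_trans (leq_mul (rcount_mul rP pp m0 pm) (tau_submul (prime_gt0 pp) m0)) _.
rewrite mulnACA leq_mul2r; apply/orP; right.
apply: leq_trans (half p pp op); rewrite rcount_prime // mulnC.
by rewrite leq_mul2r tau_prime ?orbT.
Qed.

Lemma count_periodic (Q : pred nat) a k : (forall x, Q (x + a)%N = Q x) ->
  count Q (iota 0 (k * a)) = (k * count Q (iota 0 a))%N.
Proof.
move=> h; have hk j x : Q (j * a + x)%N = Q x.
  by elim: j x => [|j IH] x //; rewrite mulSn -addnA addnC h IH.
elim: k => [|k IH]; first by rewrite !mul0n.
have -> : (k.+1 * a = k * a + a)%N by rewrite mulSn addnC.
rewrite iotaD count_cat IH add0n mulSn addnC; congr addn.
rewrite -[(k * a)%N]addn0 iotaDl count_map.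
by apply: eq_count => x /=; rewrite hk.
Qed.

(** The window is covered by floor(N/a) + 1 full periods, at most 2N/a of them because a <= N. *)
Lemma count_window (P : nat -> pred nat) a N : residual P -> (0 < a <= N)%N ->
  (a * count (fun x => all (P^~ x) (primes a)) (iota 0 N) <= 2 * N * rcount P a)%N.
Proof.
move=> rP /andP[a0 aN]; set Q := fun x => _.
have QE x : Q (x + a)%N = Q x.
  apply: eq_in_all => p; rewrite mem_primes => /and3P[_ _ pa].
  by rewrite -[LHS](residual_mod _ rP pa) modnDr residual_mod.
apply: leq_trans (_ : a * count Q (iota 0 ((N %/ a).+1 * a)) <= _)%N.
  rewrite leq_mul2l; apply/orP; right.
  have NE : ((N %/ a).+1 * a)%N = (N + ((N %/ a).+1 * a - N))%N.
    by rewrite subnKC // ltnW // ltn_ceil.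
  by rewrite NE iotaD count_cat leq_addr.
rewrite count_periodic // mulnA leq_mul2r; apply/orP; right.
by have := leq_divM N a; nia.
Qed.

(* For fixed squarefree a the proportion of x passing all tests at the primes
   p | a is at most about sigma(a) / (a tau(a)), so the average is bounded by the
   sum of sigma(a) / (a^2 tau(a)), whose square is O(log X) because
   tau(a b) <= tau(a) tau(b). *)
Lemma avg_recip_sum (R : realType) (P : nat -> pred nat) N X : residual P ->
  (forall p, prime p -> odd p -> 2 * count (P p) (iota 0 p) <= p.+1)%N ->
  (X <= N)%N ->
  \sum_(x <- iota 0 N) recip_sum R (oddsqf_all (P^~ x)) X <=
  4 * N%:R * Num.sqrt (recip_sum R predT (X * X)).
Proof.
move=> rP half XN.
set T1 := \sum_(a <- rng predT X) ((a * tau a)%N%:R : R)^-1.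
have T1le : T1 <= Num.sqrt (recip_sum R predT (X * X)).
  rewrite -[T1]ger0_norm; last by apply: sumr_ge0 => i _; rewrite invr_ge0.
  by rewrite -sqrtr_sqr ler_wsqrtr // recip_tau_sqr.
suff h : \sum_(x <- iota 0 N) recip_sum R (oddsqf_all (P^~ x)) X <=
    2 * N%:R * (2 * T1).
  apply: le_trans h _; have -> : 2 * N%:R * (2 * T1) = 4 * N%:R * T1 :> R by ring.
  by rewrite ler_wpM2l // mulr_ge0.
have -> : \sum_(x <- iota 0 N) recip_sum R (oddsqf_all (P^~ x)) X =
    \sum_(a <- rng oddsqf X) a%:R^-1 *
      (count (fun x => all (P^~ x) (primes a)) (iota 0 N))%:R.
  under eq_bigr do rewrite /recip_sum /oddsqf_all big_mkcondr.
  rewrite exchange_big sum_rng /=; apply: eq_bigr => a _.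
  rewrite -sum1_count natr_sum mulr_sumr [RHS]big_mkcond.
  by apply: eq_bigr => x _; case: ifP; rewrite ?mulr1.
apply: le_trans (_ : \sum_(a <- rng oddsqf X)
    2 * N%:R * \sum_(d <- divisors a) (d%:R / (a%:R ^+ 2 * (tau a)%:R)) <= _).
  rewrite big_seq [leRHS]big_seq; apply: ler_sum => a; rewrite mem_rng => /and3P[oa a0 aX].
  rewrite -mulr_suml -/(sigma R a).
  have a0' : (0 : R) < a%:R by rewrite ltr0n.
  have t0' : (0 : R) < (tau a)%:R by rewrite ltr0n tau_gt0.
  have aN : (0 < a <= N)%N by rewrite a0 (leq_trans aX XN).
  have := count_window rP aN; have := rcount_bound R rP half oa.
  set c := count _ _; set s := sigma R a; rewrite natrM -(ler_nat R) !natrM => h1 h2.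
  rewrite mulrA ler_pdivlMr ?mulr_gt0 ?exprn_gt0 //.
  have -> : a%:R^-1 * c%:R * (a%:R ^+ 2 * (tau a)%:R) = a%:R * c%:R * (tau a)%:R :> R.
    by field; rewrite gt_eqF.
  apply: le_trans (ler_wpM2r (ltW t0') h2) _.
  by rewrite -!mulrA !ler_wpM2l // mulrA.
rewrite -mulr_sumr ler_wpM2l ?mulr_ge0 //.
(* With a = de the term d / (a^2 tau(a)) is at most 1/(e^2 d tau(d)), as tau(d) <= tau(a). The
   variables separate and the sum over e is at most 2. *)
apply: le_trans (_ : \sum_(d <- rng predT X) \sum_(e <- rng predT X)
   ((e%:R ^+ 2)^-1 * ((d * tau d)%N%:R)^-1 : R) <= _); last first.
  under eq_bigr do rewrite -mulr_suml.
  rewrite -mulr_sumr ler_wpM2r //.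
    by apply: sumr_ge0 => i _; rewrite invr_ge0.
  by rewrite -sum_rng sum_inv_sq_le2.
pose t := [seq (d, e) | d <- rng predT X, e <- rng predT X].
pose F (z : nat * nat) : R := (z.2%:R ^+ 2)^-1 * ((z.1 * tau z.1)%N%:R)^-1.
have -> : \sum_(d <- rng predT X) \sum_(e <- rng predT X)
   ((e%:R ^+ 2)^-1 * ((d * tau d)%N%:R)^-1 : R) = \sum_(z <- t) F z.
  by rewrite big_allpairs_dep.
apply: le_trans (_ : \sum_(a <- rng oddsqf X) \sum_(d <- divisors a)
   F (d, a %/ d)%N <= _).
  rewrite big_seq [leRHS]big_seq; apply: ler_sum => a; rewrite mem_rng => /and3P[oa a0 aX].
  rewrite big_seq [leRHS]big_seq; apply: ler_sum => d; rewrite mem_divisors // => da.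
  have d0 := dvdn_gt0 a0 da; have tda := tau_dvd a0 da.
  have e0 : (0 < a %/ d)%N by rewrite divn_gt0 // dvdn_leq.
  rewrite /F /= -[in leLHS](divnK da) divnK //.
  have aE : (a%:R : R) = (a %/ d)%:R * d%:R by rewrite -natrM divnK.
  rewrite aE natrM.
  have d0' : (0 : R) < d%:R by rewrite ltr0n.
  have e0' : (0 : R) < (a %/ d)%:R by rewrite ltr0n.
  have ta0 : (0 : R) < (tau a)%:R by rewrite ltr0n tau_gt0.
  have td0 : (0 : R) < (tau d)%:R by rewrite ltr0n tau_gt0.
  rewrite -(ler_nat R) in tda; move: tda d0' e0' ta0 td0.
  move: (tau a)%:R (tau d)%:R (a %/ d)%:R (d%:R) => ta td e d' tda d0' e0' ta0 td0.
  have -> : d' / ((e * d') ^+ 2 * ta) = (e ^+ 2)^-1 * (d' * ta)^-1.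
    by field; rewrite !gt_eqF.
  apply: ler_wpM2l; first by rewrite invr_ge0 exprn_ge0 // ltW.
  by rewrite lef_pV2 ?posrE ?mulr_gt0 // ler_wpM2l // ltW.
apply: (@ler_pairs_sum R _ _ _ _ divisors t (fun a d => (d, a %/ d)%N) F).
- exact: rng_uniq.
- by move=> *; exact: divisors_uniq.
- move=> a d; rewrite mem_rng => /and3P[_ a0 aX]; rewrite mem_divisors // => da.
  have d0 := dvdn_gt0 a0 da.
  apply/allpairsPdep; exists d, (a %/ d)%N; rewrite !mem_rng /= d0.
  rewrite (leq_trans (dvdn_leq a0 da) aX) divn_gt0 // (dvdn_leq a0 da).
  by rewrite (leq_trans (leq_div _ _) aX).
- move=> a d a' d'; rewrite !mem_rng => /and3P[_ a0 _] + /and3P[_ a0' _].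
  rewrite !mem_divisors // => da da' [dd e]; split => //.
  by rewrite -(divnK da) e dd divnK.
- by move=> z _; rewrite mulr_ge0 // invr_ge0 // exprn_ge0.
Qed.

(** * Chebyshev's function and primes in blocks *)

Definition theta (R : realType) (n : nat) : R :=
  \sum_(1 <= p < n.+1 | prime p) ln p%:R.

Lemma prod_primes_dvd (s : seq nat) m : uniq s -> all prime s ->
  {in s, forall p, p %| m}%N -> (\prod_(p <- s) p %| m)%N.
Proof.
elim: s => [|p s IH] /=; first by rewrite big_nil dvd1n.
move=> /andP[ps us] /andP[pp ss] h; rewrite big_cons Gauss_dvd.
  by rewrite h ?mem_head // IH // => q qs; apply: h; rewrite inE qs orbT.
rewrite prime_coprime // big_seq; elim/big_ind: _.
- by rewrite Euclid_dvd1.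
- by move=> x y hx hy; rewrite Euclid_dvdM // negb_or hx.
- move=> q qs; rewrite dvdn_prime2 //; last by move/allP: ss; apply.
  by apply: contraNneq ps => ->.
Qed.

Lemma prime_dvd_fact p n : prime p -> (p %| n`!)%N = (p <= n)%N.
Proof.
move=> pp; apply/idP/idP => [|pn]; last by rewrite dvdn_fact // prime_gt0.
elim: n => [|n IH]; first by rewrite fact0 Euclid_dvd1.
rewrite factS Euclid_dvdM // => /orP[/dvdn_leq-> //|/IH]; lia.
Qed.

(** The two middle coefficients of (1 + 1)^(2m+1) are equal, so each is at most half of 2^(2m+1). *)
Lemma bin_mid_le m : ('C(m.*2.+1, m) <= 4 ^ m)%N.
Proof.
have sumE : (\sum_(i < m.*2.+2) 'C(m.*2.+1, i) = 2 ^ m.*2.+1)%N.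
  rewrite -[in RHS](addn1 1) expnDn; apply: eq_bigr => i _.
  by rewrite !exp1n !muln1.
have h : ('C(m.*2.+1, m) + 'C(m.*2.+1, m.+1) <= 2 ^ m.*2.+1)%N.
  have i1 : (m < m.*2.+2)%N by lia.
  have i2 : (m.+1 < m.*2.+2)%N by lia.
  rewrite -sumE (bigD1 (Ordinal i1)) // (bigD1 (Ordinal i2)) /=.
    by rewrite addnA leq_addr.
  by rewrite -val_eqE /=; lia.
have e : 'C(m.*2.+1, m.+1) = 'C(m.*2.+1, m).
  by rewrite -bin_sub; [congr 'C(_, _)|]; lia.
move: h; rewrite e -[4%N]/(2 ^ 2)%N -expnM expnS mul2n; lia.
Qed.

(** Erdos' induction: for n = 2m+1 the primes in (m+1, 2m+1] all divide C(2m+1, m) <= 4^m, and the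
    primes up to m+1 are covered by the induction hypothesis. An even n > 2 adds no prime. *)
Lemma primorial_le n : (\prod_(1 <= p < n.+1 | prime p) p <= 4 ^ n)%N.
Proof.
elim/ltn_ind: n => n IH.
case: (ltnP n 3) => [|n3].
  by case: n {IH} => [|[|[|]]] // _; rewrite unlock /=.
have [on|en] := boolP (odd n); last first.
  case: n n3 en IH => // n n3 en IH; rewrite big_mkcond big_nat_recr //= -big_mkcond.
  have -> : prime n.+1 = false.
    by apply/negbTE; apply: contra en => /even_prime[]; lia.
  by rewrite muln1; apply: leq_trans (IH n _) _ => //; rewrite leq_exp2l.
pose m := n./2; have nE : n = m.*2.+1 by rewrite /m; lia.
rewrite nE (@big_cat_nat _ _ _ m.+2) /=; try lia.
have -> : (4 ^ m.*2.+1 = 4 ^ m.+1 * 4 ^ m)%N by rewrite -expnD; congr expn; lia.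
apply: leq_mul; first by apply: IH; lia.
apply: leq_trans (bin_mid_le m); apply: dvdn_leq; first by rewrite bin_gt0; lia.
rewrite -big_filter; apply: prod_primes_dvd.
- by rewrite filter_uniq // iota_uniq.
- by apply/allP => p; rewrite mem_filter => /andP[].
move=> p; rewrite mem_filter mem_index_iota => /andP[pp /andP[mp pm]].
have : (p %| (m.*2.+1)`!)%N by rewrite prime_dvd_fact //; lia.
have h := @bin_fact m.*2.+1 m; rewrite -h; last by lia.
by rewrite !Euclid_dvdM // !prime_dvd_fact // => /or3P[] //; lia.
Qed.

Lemma ln_prod (R : realType) (I : eqType) (s : seq I) (P : pred I) (F : I -> R) :
  (forall i, P i -> 0 < F i) ->
  ln (\prod_(i <- s | P i) F i) = \sum_(i <- s | P i) ln (F i).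
Proof.
move=> h; suff [] : 0 < \prod_(i <- s | P i) F i /\
   ln (\prod_(i <- s | P i) F i) = \sum_(i <- s | P i) ln (F i) by [].
elim: s => [|i s [IH1 IH2]]; first by rewrite !big_nil ln1.
rewrite !big_cons; case: ifP => // Pi; have Fi := h _ Pi; split.
  by rewrite mulr_gt0.
by rewrite lnM ?posrE // IH2.
Qed.

Lemma ln_nat_le (R : realType) a b : (0 < a)%N -> (a <= b)%N ->
  ln (a%:R : R) <= ln b%:R.
Proof.
by move=> a0 ab; rewrite ler_ln ?posrE ?ltr0n // ?ler_nat // (leq_trans a0 ab).
Qed.

Lemma theta_le (R : realType) n : theta R n <= n%:R * ln 4.
Proof.
rewrite /theta -ln_prod; last by move=> p /prime_gt0; rewrite ltr0n.
rewrite mulr_natl -lnXn ?ltr0n // -natr_prod -natrX.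
by apply: ln_nat_le (primorial_le _); rewrite prodn_cond_gt0 // => p /prime_gt0.
Qed.

(** Legendre's formula: the exponent is a sum of floor(2n/p^k) - 2 floor(n/p^k), each term being 0
    or 1 and vanishing once p^k > 2n. *)
Lemma logn_bin_le p n : prime p -> (0 < n)%N ->
  (logn p 'C(n.*2, n) <= trunc_log p n.*2)%N.
Proof.
move=> pp n0; set t := trunc_log _ _; have p1 := prime_gt1 pp.
have nn : (n <= n.*2)%N by lia.
have := bin_fact nn; have -> : (n.*2 - n = n)%N by lia.
move/(congr1 (logn p)); rewrite !lognM ?muln_gt0 ?fact_gt0 ?bin_gt0 // !logn_fact //.
have step k : ((n.*2 %/ p ^ k) <= 2 * (n %/ p ^ k) + (k <= t))%N.
  have pk0 : (0 < p ^ k)%N by rewrite expn_gt0 prime_gt0.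
  case: (leqP k t) => kt.
    have := leq_divM n.*2 (p ^ k); have := ltn_ceil n pk0; nia.
  rewrite divn_small //; apply: leq_trans (trunc_log_ltn n.*2 p1) _.
  by rewrite leq_exp2l.
have ext : (\sum_(1 <= k < n.*2.+1) n %/ p ^ k = \sum_(1 <= k < n.+1) n %/ p ^ k)%N.
  rewrite (@big_cat_nat _ _ _ n.+1) /=; try lia.
  rewrite [X in (_ + X)%N]big_nat [X in (_ + X)%N]big1 ?addn0 // => k /andP[nk _].
  by rewrite divn_small // (leq_trans nk) // ltnW // ltn_expl.
have : (\sum_(1 <= k < n.*2.+1) n.*2 %/ p ^ k <=
    2 * (\sum_(1 <= k < n.+1) n %/ p ^ k) + t)%N.
  rewrite -ext big_distrr /=.
  apply: leq_trans (_ : \sum_(1 <= k < n.*2.+1) (2 * (n %/ p ^ k) + (k <= t)) <= _)%N.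
    by apply: leq_sum => k _; exact: step.
  rewrite big_split /= leq_add2l -[leqRHS](@size_iota 1) -big_mkcond sum1_count.
  rewrite -size_filter; apply: uniq_leq_size; first by rewrite filter_uniq // iota_uniq.
  by move=> k; rewrite mem_filter mem_index_iota mem_iota; lia.
lia.
Qed.

(** Primes with p^2 > 2n occur at most to the first power and are counted by [theta]; each of the
    others, at most [s] in number, contributes a prime power not exceeding 2n. *)
Lemma ln_bin_le_theta (R : realType) n s : (0 < n)%N ->
  (forall p, p ^ 2 <= n.*2 -> p <= s)%N ->
  ln ('C(n.*2, n)%:R : R) <= theta R n.*2 + s%:R * ln n.*2%:R.
Proof.
move=> n0 hs; set C := 'C(_, _).
have C0 : (0 < C)%N by rewrite bin_gt0; lia.
have N1 : (1 : R) <= n.*2%:R by rewrite ler1n; lia.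
have lnN0 : 0 <= ln (n.*2%:R : R) by rewrite ln_ge0.
rewrite (prod_prime_decomp C0) prime_decompE big_map natr_prod /= big_seq ln_prod; last first.
  by move=> p; rewrite mem_primes => /and3P[pp _ _]; rewrite ltr0n expn_gt0 prime_gt0.
rewrite -big_seq.
pose G (p : nat) : R := ln p%:R + (if (p ^ 2 <= n.*2)%N then ln n.*2%:R else 0).
apply: le_trans (_ : \sum_(p <- primes C) G p <= _).
  rewrite big_seq [leRHS]big_seq; apply: ler_sum => p; rewrite mem_primes => /and3P[pp _ pC].
  have p0 : (0 : R) < p%:R by rewrite ltr0n prime_gt0.
  have p1 := prime_gt1 pp.
  have lnp0 : 0 <= ln (p%:R : R) by rewrite ln_ge0 // ler1n prime_gt0.
  have hv := logn_bin_le pp n0.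
  have nn0 : (0 < n.*2)%N by lia.
  rewrite /G; case: (leqP (p ^ 2) n.*2) => psq.
    apply: le_trans (_ : ln (n.*2%:R : R) <= _); last by rewrite lerDr.
    apply: ln_nat_le; first by rewrite expn_gt0 prime_gt0.
    by apply: leq_trans (trunc_logP p1 nn0); rewrite leq_exp2l.
  rewrite addr0 natrX lnXn // -[leRHS]mulr1n ler_wpMn2l //.
  apply: leq_trans hv _; rewrite -ltnS -(ltn_exp2l _ _ p1).
  exact: leq_ltn_trans (trunc_logP p1 nn0) psq.
apply: le_trans (_ : \sum_(p <- rng prime n.*2) G p <= _).
  apply: sum_uniq_sub; first exact: primes_uniq.
    move=> p; rewrite mem_primes mem_rng => /and3P[pp _ pC]; rewrite pp prime_gt0 //=.
    rewrite -prime_dvd_fact //; apply: dvdn_trans pC _.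
    have nn : (n <= n.*2)%N by lia.
    by rewrite -(bin_fact nn) dvdn_mulr.
  move=> p; rewrite mem_rng => /and3P[pp p0 _].
  by rewrite addr_ge0 ?ln_ge0 ?ler1n //; case: ifP.
rewrite big_split /= -sum_rng -/(theta R _) lerD2l -big_mkcond /= big_filter_cond.
rewrite -big_filter big_const_seq count_predT iter_addr_0 -[leLHS]mulr_natl ler_wpM2r // ler_nat.
rewrite -[leqRHS](@size_iota 1); apply: uniq_leq_size.
  by rewrite filter_uniq // iota_uniq.
move=> p; rewrite mem_filter mem_index_iota mem_iota => /andP[/andP[_ psq] /andP[p0 _]].
by have := hs _ psq; lia.
Qed.

Lemma exp2_le_bin_mid n : (2 ^ n <= 'C(n.*2, n))%N.
Proof.
elim: n => [|n IH]; first by rewrite bin0.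
have -> : (n.+1).*2 = n.*2.+2 by lia.
rewrite binS expnS mul2n -addnn leq_add //.
  by apply: leq_trans IH _; rewrite [leqRHS]binS leq_addl.
by apply: leq_trans IH _; rewrite leq_bin2l.
Qed.

Lemma ln2_ge (R : realType) : 2^-1 <= ln 2 :> R.
Proof.
have := @le_ln1Dx R (- 2^-1); have -> : 1 + - 2^-1 = 2^-1 :> R by field.
rewrite lnV ?posrE // lerN2; apply; lra.
Qed.

Lemma ln2_le1 (R : realType) : ln 2 <= 1 :> R.
Proof. by have := @le_ln1Dx R 1; rewrite -natr1; apply; lra. Qed.

(** Put Y = 16^j and n = 8Y. From C(2n, n) >= 2^n comes theta(16Y) >= 8Y ln 2 minus an error 16
    (j+1) 4^j ln 2, which is at most 2Y ln 2 once j >= 3, while theta(Y) <= 2Y ln 2. What remains is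
    4Y ln 2 >= Y. *)
Lemma theta_interval (R : realType) j : (3 <= j)%N ->
  (16 ^ j)%:R <= theta R (16 ^ j.+1) - theta R (16 ^ j).
Proof.
move=> j3; pose n := (8 * 16 ^ j)%N.
have n0 : (0 < n)%N by rewrite muln_gt0 expn_gt0.
have nE : (16 ^ j.+1 = n.*2)%N by rewrite expnS /n; lia.
have sE : (16 ^ j.+1 = (4 ^ j.+1) ^ 2)%N by rewrite -expnM mulnC expnM.
have hs p : (p ^ 2 <= n.*2 -> p <= 4 ^ j.+1)%N.
  by rewrite -nE sE leq_exp2r.
have h1 := ln_bin_le_theta R n0 hs.
have h2 : n%:R * ln 2 <= ln ('C(n.*2, n)%:R : R).
  rewrite mulr_natl -lnXn // -natrX.
  by apply: ln_nat_le (exp2_le_bin_mid _); rewrite expn_gt0.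
have h3 := theta_le R (16 ^ j); have l2 := ln2_ge R.
have ln4E : ln 4 = 2 * ln 2 :> R.
  have -> : 4 = 2 ^+ 2 :> R by ring.
  by rewrite lnXn // mulr_natl.
have ln16 : ln (16 ^ j.+1)%N%:R = 4 * j.+1%:R * ln 2 :> R.
  have -> : (16 ^ j.+1)%N%:R = 2 ^+ (4 * j.+1) :> R by rewrite natrX exprM; congr (_ ^+ _); ring.
  by rewrite lnXn // -[LHS]mulr_natl natrM.
rewrite -nE in h2; rewrite -nE ln16 in h1; rewrite ln4E in h3.
have e : (16 * j.+1 * 4 ^ j <= 2 * 16 ^ j)%N.
  have -> : (16 ^ j = 4 ^ j * 4 ^ j)%N by rewrite -expnMn.
  rewrite mulnA leq_mul2r; apply/orP; right.
  elim: j j3 {n n0 nE sE hs h1 h2 h3 ln16} => // j IH; rewrite leq_eqVlt => /orP[/eqP<-//|/IH].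
  by rewrite expnS; lia.
rewrite -(ler_nat R) !natrM in e; rewrite {1}/n natrM in h2.
rewrite (expnS 4) natrM in h1.
have {h1 h2} h := le_trans h2 h1.
have Y0 : (0 : R) <= (16 ^ j)%:R by [].
move: Y0 h h3 e l2; move: (theta R (16 ^ j.+1)) (theta R (16 ^ j)) (ln 2 : R).
move: ((16 ^ j)%:R : R) ((4 ^ j)%:R : R) (j.+1%:R : R) => Y s k t2 t1 l Y0 h h3 e l2.
have e' : (16 * k * s) * l <= 2 * Y * l by rewrite ler_wpM2r //; lra.
have e2 : Y * 2^-1 <= Y * l by rewrite ler_wpM2l.
lra.
Qed.

(** * Counting split primes *)

Lemma sum_blocks (R : realType) (F : nat -> R) k m :
  \sum_(x <- iota 0 (k * m)) F x =
  \sum_(t <- iota 0 k) \sum_(a <- iota 0 m) F (t * m + a)%N.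
Proof.
elim: k => [|k IH]; first by rewrite mul0n !big_nil.
have -> : (k.+1 * m = k * m + m)%N by rewrite mulSn addnC.
rewrite -addn1 !iotaD !big_cat /= IH big_seq1 add0n; congr (_ + _).
by rewrite -[X in iota X m]addn0 iotaDl big_map.
Qed.

Lemma sum_affine_residues (R : realType) (g : nat -> R) q r a :
  (0 < q)%N -> coprime r q -> (forall x, g (x %% q)%N = g x) ->
  \sum_(t <- iota 0 q) g (t * r + a)%N = \sum_(t <- iota 0 q) g t.
Proof.
move=> q0 cop per; under eq_bigr do rewrite -per.
rewrite -(big_map (fun t => (t * r + a) %% q)%N xpredT); apply: perm_big.
have us : uniq [seq ((t * r + a) %% q)%N | t <- iota 0 q].
  rewrite map_inj_in_uniq ?iota_uniq // => x y.
  rewrite !mem_iota !add0n /= => xq yq /eqP; rewrite eqn_modDr.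
  wlog xy : x y xq yq / (x <= y)%N.
    move=> H h; case: (leqP x y) => [|/ltnW] xy; first exact: H.
    by apply/esym; apply: H; rewrite 1?eq_sym.
  rewrite eq_sym eqn_mod_dvd ?leq_mul2r ?xy ?orbT // -mulnBl Gauss_dvdl; last first.
    by rewrite coprime_sym.
  by move=> h; have := dvdn_leq _ h; lia.
apply: uniq_perm => //; first exact: iota_uniq.
have sub : {subset [seq ((t * r + a) %% q)%N | t <- iota 0 q] <= iota 0 q}.
  by move=> _ /mapP[t _ ->]; rewrite mem_iota add0n /= ltn_mod.
by have [] := uniq_min_size us sub; rewrite // size_map.
Qed.

(** Over a full period pq the sum vanishes: on each class modulo p the factor [f] is constant while
    [g] runs once through its period, p being invertible modulo q. The incomplete period left over
    has fewer than pq terms of absolute value at most 1. *)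
Lemma sum_coprime_periods (R : realType) (f g : nat -> R) p q N :
  (0 < p)%N -> (0 < q)%N -> coprime p q ->
  (forall x, f (x %% p)%N = f x) -> (forall x, g (x %% q)%N = g x) ->
  \sum_(x <- iota 0 q) g x = 0 ->
  (forall x, `|f x| <= 1) -> (forall x, `|g x| <= 1) ->
  `|\sum_(x <- iota 0 N) f x * g x| <= (p * q)%:R.
Proof.
move=> p0 q0 cop perf perg sg f1 g1; set m := (q * p)%N.
have fE t a : f (t * p + a)%N = f a by rewrite -perf modnMDl perf.
have gE s t a : g ((s * q + t) * p + a)%N = g (t * p + a)%N.
  by rewrite -perg mulnDl -addnA mulnAC modnMDl perg.
have z0 k : \sum_(x <- iota 0 (k * m)) f x * g x = 0.
  rewrite /m mulnA sum_blocks exchange_big big1 // => a _.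
  under eq_bigr do rewrite fE.
  rewrite -mulr_sumr sum_blocks.
  rewrite big1 ?mulr0 // => s _; under eq_bigr do rewrite gE.
  by rewrite sum_affine_residues.
have m0 : (0 < m)%N by rewrite muln_gt0 q0.
rewrite (divn_eq N m) iotaD big_cat /= z0 add0r.
apply: le_trans (ler_norm_sum _ _ _) _.
apply: le_trans (_ : \sum_(x <- iota (0 + N %/ m * m) (N %% m)) (1 : R) <= _).
  by apply: ler_sum => x _; rewrite normrM mulr_ile1.
rewrite big_const_seq count_predT size_iota iter_addr_0 -/(_%:R) ler_nat mulnC -/m.
by rewrite ltnW // ltn_mod.
Qed.

(** For an odd prime p this is 1 + (-b/p) with the Legendre symbol, so [rho] minus 1 plays the
    quadratic character. For p = 2 it is always 1. *)
Definition rho (p : nat) (b : int) : nat :=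
  count (fun y : nat => (p%:Z %| y%:Z ^+ 2 + b)%Z) (iota 0 p).

Lemma rho_congr p (b c : int) : (p%:Z %| b - c)%Z -> rho p b = rho p c.
Proof.
move=> h; apply: eq_count => y /=.
by rewrite -[b](subrK c) [_ - _ + _]addrC addrA rpredDr.
Qed.

Lemma Euclid_dvdzM p (a b : int) : prime p ->
  (p%:Z %| a * b)%Z = (p%:Z %| a)%Z || (p%:Z %| b)%Z.
Proof. by move=> pp; rewrite !dvdzE abszM Euclid_dvdM. Qed.

Lemma dvdz_small p (y : nat) : (y < p)%N -> (p%:Z %| y%:Z)%Z -> y = 0%N.
Proof. by rewrite dvdzE /= => yp; case: y yp => // y yp /dvdn_leq; lia. Qed.

Lemma rho_roots p b y z : prime p -> (y < p)%N -> (z < p)%N ->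
  (p%:Z %| y%:Z ^+ 2 + b)%Z -> (p%:Z %| z%:Z ^+ 2 + b)%Z -> z = y \/ (z + y = p \/ z + y = 0)%N.
Proof.
move=> pp yp zp hy hz.
have : (p%:Z %| (z%:Z - y%:Z) * (z%:Z + y%:Z))%Z.
  have -> : (z%:Z - y%:Z) * (z%:Z + y%:Z) = (z%:Z ^+ 2 + b) - (y%:Z ^+ 2 + b) by ring.
  by rewrite rpredB.
rewrite Euclid_dvdzM // !dvdzE /= => /orP[] h; [left|right].
  have [/dvdn_leq] := (h, leqP 1 `|z%:Z - y%:Z|); lia.
have hzy : (p %| z + y)%N by [].
case: (posnP (z + y)) => [|zy0]; [by right|left].
case/dvdnP: hzy => k kE; have : (0 < k < 2)%N by nia.
by case: k kE => [|[|]] //; lia.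
Qed.

Lemma rho_le2 p b : prime p -> (rho p b <= 2)%N.
Proof.
move=> pp; rewrite /rho -size_filter.
set s := seq.filter _ _; have us : uniq s by rewrite filter_uniq // iota_uniq.
case sE : s => [|y t] //; rewrite -sE.
have : y \in s by rewrite sE mem_head.
rewrite mem_filter mem_iota /= add0n => /andP[hy yp].
apply: (@uniq_leq_size _ _ [:: y; p - y]%N) => // z.
rewrite mem_filter mem_iota /= add0n => /andP[hz zp].
by rewrite !inE; have := rho_roots pp yp zp hy hz; lia.
Qed.

Lemma rho0 p b : prime p -> (p%:Z %| b)%Z -> rho p b = 1%N.
Proof.
move=> pp pb; have p0 := prime_gt0 pp.
rewrite (@rho_congr p b 0) ?subr0 // /rho.
rewrite -[RHS](_ : count (pred1 0%N) (iota 0 p) = 1%N); last first.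
  by rewrite count_uniq_mem ?iota_uniq // mem_iota p0.
apply: eq_in_count => y; rewrite mem_iota /= add0n => yp; rewrite addr0.
apply/idP/eqP => [|->]; last by rewrite expr0n.
by rewrite expr2 Euclid_dvdzM // orbb => /(dvdz_small yp).
Qed.

Lemma rho_gt0E p b : prime p -> odd p -> ~~ (p%:Z %| b)%Z -> (0 < rho p b)%N -> rho p b = 2%N.
Proof.
move=> pp op pb; rewrite -has_count => /hasP[y].
rewrite mem_iota /= add0n => yp hy.
apply/eqP; rewrite eqn_leq rho_le2 //= /rho -size_filter.
have y0 : (0 < y)%N.
  by case: y yp hy => // yp; rewrite expr0n add0r (negbTE pb).
apply: (@uniq_leq_size _ [:: y; p - y]%N); first by rewrite /= inE andbT; lia.
move=> z; rewrite !inE mem_filter mem_iota /= add0n => /orP[] /eqP ->.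
  by rewrite hy.
rewrite ltn_subrL y0 prime_gt0 // andbT.
have -> : (p - y)%N%:Z ^+ 2 + b = (y%:Z ^+ 2 + b) + p%:Z * (p%:Z - 2 * y%:Z).
  by rewrite -subzn 1?ltnW //; ring.
by rewrite rpredD // dvdz_mulr.
Qed.

Lemma count_linear_root p (m s : int) : (0 < p)%N -> s * s = 1 ->
  count (fun x : nat => (p%:Z %| m + s * x%:Z)%Z) (iota 0 p) = 1%N.
Proof.
move=> p0 ss; have p0' : p%:Z != 0 by rewrite eqz_nat -lt0n.
pose x0 := `|((- (s * m)) %% p%:Z)%Z|%N.
have x0E : x0%:Z = ((- (s * m)) %% p%:Z)%Z by rewrite gez0_abs // modz_ge0.
have x0p : (x0 < p)%N by rewrite -ltz_nat x0E ltz_pmod // ltz_nat.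
rewrite -[RHS](_ : count (pred1 x0) (iota 0 p) = 1%N); last first.
  by rewrite count_uniq_mem ?iota_uniq // mem_iota x0p.
apply: eq_in_count => x; rewrite mem_iota /= add0n => xp.
have -> : (p%:Z %| m + s * x%:Z)%Z = (p%:Z %| x%:Z - - (s * m))%Z.
  have -> : x%:Z - - (s * m) = s * (m + s * x%:Z).
    by rewrite mulrDr mulrA ss mul1r opprK addrC.
  apply/idP/idP => [|h]; first exact: dvdz_mull.
  by rewrite -[m + _]mul1r -ss -mulrA dvdz_mull.
rewrite -eqz_mod_dvd modz_small; last by rewrite /= ltz_nat.
by rewrite -x0E eqz_nat.
Qed.

(** For fixed y the condition is linear in x and has one root, so [rho] has mean 1, which says that
    the quadratic character has mean 0. The sign [s] treats positive and negative B together. *)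
Lemma sum_rho p (s : int) : (0 < p)%N -> s * s = 1 ->
  (\sum_(x <- iota 0 p) rho p (s * x%:Z) = p)%N.
Proof.
move=> p0 ss; rewrite /rho; under eq_bigr do rewrite -sum1_count big_mkcond.
rewrite exchange_big /= -[RHS](size_iota 0) -sum1_size; apply: eq_bigr => y _.
by rewrite -big_mkcond sum1_count count_linear_root.
Qed.

Lemma count_sum (T : Type) (P : pred T) (s : seq T) :
  count P s = (\sum_(x <- s) P x)%N.
Proof. by rewrite -sum1_count big_mkcond. Qed.

(** [rho] is 1 when p divides x and 0 or 2 otherwise, so 2 [rho > 0] <= rho + [p | x], and the right
    side sums to p + 1. *)
Lemma count_rho_gt0 p (s : int) : prime p -> odd p -> s * s = 1 ->
  (2 * count (fun x : nat => 0 < rho p (s * x%:Z)) (iota 0 p) <= p.+1)%N.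
Proof.
move=> pp op ss; have p0 := prime_gt0 pp.
have := sum_rho p0 ss; have := count_linear_root 0 p0 ss => c0 h.
have -> : p.+1 = (\sum_(x <- iota 0 p) (rho p (s * x%:Z)%R + (p%:Z %| (0 + s * x%:Z)%R)%Z))%N.
  by rewrite big_split /= h -count_sum c0 addn1.
rewrite count_sum big_distrr /=; apply: leq_sum => x _; rewrite add0r.
case: (posnP (rho p (s * x%:Z))) => // r0.
have [/(rho0 pp) ->//|nd] := boolP (p%:Z %| s * x%:Z)%Z.
by rewrite (rho_gt0E pp op nd r0).
Qed.

(** Dual count: rho <= [p | x] + 2 [rho = 2] sums to p <= 1 + 2 #{rho = 2}, which bounds the
    complement. *)
Lemma count_rho_neq2 p : prime p -> odd p ->
  (2 * count (fun x : nat => rho p x%:Z != 2) (iota 0 p) <= p.+1)%N.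
Proof.
move=> pp op; have p0 := prime_gt0 pp.
have e : (1 : int) * 1 = 1 by [].
have := sum_rho p0 e; have := count_linear_root 0 p0 e => c0 h.
have c2 := count_predC (fun x : nat => rho p x%:Z == 2) (iota 0 p).
rewrite size_iota in c2.
suff : (p <= 1 + 2 * count (fun x : nat => rho p x%:Z == 2) (iota 0 p))%N.
  have -> : count (fun x : nat => rho p x%:Z != 2) (iota 0 p) =
      count (predC (fun x : nat => rho p x%:Z == 2)) (iota 0 p) by exact: eq_count.
  move: c2; set A := count _ _; set B := count _ _ => c2 A2; lia.
rewrite -[leqLHS]h -[X in (X + _)%N]c0 !count_sum big_distrr -big_split /=.
apply: leq_sum => x _; rewrite add0r mul1r.
have [/(rho0 pp) ->//|nd] := boolP (p%:Z %| x%:Z)%Z.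
case: (posnP (rho p x%:Z)) => [->//|r0].
by rewrite (rho_gt0E pp op nd r0).
Qed.

Definition split_count (j x : nat) : nat :=
  count (fun q => prime q && (rho q x%:Z == 2)) (index_iota (16 ^ j).+1 (16 ^ j.+1).+1).

Lemma rho_residual p (s : int) x : (p%:Z %| s * (x %% p)%N%:Z - s * x%:Z)%Z.
Proof.
rewrite -mulrBr dvdz_mull // [X in _ - X%:Z](divn_eq x p) PoszD opprD addrCA subrr addr0.
by rewrite rpredN PoszM dvdz_mull.
Qed.

Definition primes_in j := [seq q <- index_iota (16 ^ j).+1 (16 ^ j.+1).+1 | prime q].

Lemma ln16_le (R : realType) j : ln (16 ^ j)%:R <= 4 * j%:R :> R.
Proof.
have -> : ((16 ^ j)%N%:R : R) = 2 ^+ (4 * j) by rewrite natrX exprM; congr (_ ^+ _); ring.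
by rewrite lnXn // -[leLHS]mulr_natl natrM ler_piMr // ln2_le1.
Qed.

Lemma primes_inP j q : (0 < j)%N -> q \in primes_in j ->
  [/\ prime q, odd q & (q <= 16 ^ j.+1)%N].
Proof.
rewrite mem_filter mem_index_iota => j0 /andP[pq /andP[q1 q2]]; split => //.
case/even_prime: pq => // q2E; move: q1; rewrite q2E.
by have : (16 ^ 1 <= 16 ^ j)%N; [rewrite leq_exp2l|rewrite expn1; lia].
Qed.

(** Put Z = 16^(j+1). When the square is expanded, distinct primes are nearly uncorrelated: their
    sum is at most qq' <= Z^2 by [sum_coprime_periods], while a diagonal sum is at most N. There are
    at most Z primes, whence ZN + Z^4, multiplied by the square of the bound 4 (j+1) for the
    logarithms. *)
Lemma variance_bound (R : realType) j N : (0 < j)%N ->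
  \sum_(x <- iota 0 N) (\sum_(q <- primes_in j) ln q%:R * ((rho q x%:Z)%:R - 1)) ^+ 2 <=
  (4 * j.+1%:R) ^+ 2 * ((16 ^ j.+1 * N)%:R + (16 ^ j.+1)%:R ^+ 4) :> R.
Proof.
move=> j0; set Z := (16 ^ j.+1)%N; set W := 4 * j.+1%:R.
have W0 : 0 <= W :> R by rewrite mulr_ge0.
pose f q (x : nat) : R := (rho q x%:Z)%:R - 1.
have qP q := @primes_inP j q j0.
have f1 q x : q \in primes_in j -> `|f q x| <= 1.
  by case/qP => pq _ _; rewrite /f; have := rho_le2 x%:Z pq;
    case: (rho q x) => [|[|[|]]] // _; rewrite ler_norml; lra.
have ln01 q : q \in primes_in j -> 0 <= ln (q%:R : R) <= W.
  case/qP => pq _ qZ; rewrite ln_ge0 ?ler1n ?prime_gt0 //=.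
  apply: le_trans (ln_nat_le R (prime_gt0 pq) qZ) _.
  exact: ln16_le.
have -> : \sum_(x <- iota 0 N) (\sum_(q <- primes_in j) ln q%:R * ((rho q x%:Z)%:R - 1)) ^+ 2 =
    \sum_(q <- primes_in j) \sum_(q' <- primes_in j)
       ln q%:R * ln q'%:R * \sum_(x <- iota 0 N) f q x * f q' x :> R.
  under eq_bigr do rewrite expr2 mulr_suml; rewrite exchange_big; apply: eq_bigr => q _.
  under eq_bigr do rewrite mulr_sumr; rewrite exchange_big; apply: eq_bigr => q' _.
  by rewrite mulr_sumr; apply: eq_bigr => x _; rewrite /f; ring.
have fsum q : q \in primes_in j -> \sum_(x <- iota 0 q) f q x = 0.
  case/qP => pq _ _; rewrite /f sumrB big_const_seq count_predT size_iota iter_addr_0.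
  rewrite -natr_sum; have := @sum_rho q 1 (prime_gt0 pq) erefl.
  by under eq_bigr do rewrite mul1r; move=> ->; rewrite subrr.
have fper q x : f q (x %% q)%N = f q x.
  by rewrite /f (@rho_congr q (x %% q)%N%:Z x%:Z) //; have := rho_residual q 1 x; rewrite !mul1r.
have inner q q' : q \in primes_in j -> q' \in primes_in j ->
   `|\sum_(x <- iota 0 N) f q x * f q' x| <= (if q == q' then N else Z * Z)%:R.
  move=> qI q'I; have [pq oq qZ] := qP _ qI; have [pq' oq' q'Z] := qP _ q'I.
  case: eqVneq => [<-|neq].
    apply: le_trans (ler_norm_sum _ _ _) _.
    apply: le_trans (_ : \sum_(x <- iota 0 N) (1 : R) <= _).
      by apply: ler_sum => x _; rewrite normrM mulr_ile1 ?f1.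
    by rewrite big_const_seq count_predT size_iota iter_addr_0.
  apply: le_trans (_ : (q * q')%:R <= _); last by rewrite ler_nat leq_mul.
  apply: sum_coprime_periods; rewrite ?prime_gt0 //; try by move=> x; rewrite ?f1.
    by rewrite prime_coprime // dvdn_prime2.
  exact: fsum.
have szI : (size (primes_in j) <= Z)%N.
  rewrite -(size_iota 1 Z); apply: uniq_leq_size.
    by rewrite filter_uniq // iota_uniq.
  by move=> q /qP[pq _ qZ]; rewrite mem_iota prime_gt0 //= add1n ltnS.
apply: le_trans (_ : \sum_(q <- primes_in j) \sum_(q' <- primes_in j)
    W ^+ 2 * (if q == q' then N else Z * Z)%:R <= _).
  rewrite big_seq [leRHS]big_seq; apply: ler_sum => q qI.
  rewrite big_seq [leRHS]big_seq; apply: ler_sum => q' q'I.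
  have /andP[l0 l1] := ln01 _ qI; have /andP[l0' l1'] := ln01 _ q'I.
  apply: le_trans (ler_norm _) _; rewrite normrM ger0_norm ?mulr_ge0 //.
  by rewrite expr2 ler_pM ?mulr_ge0 ?ler_pM ?inner.
under eq_bigr do rewrite -mulr_sumr; rewrite -mulr_sumr ler_wpM2l ?sqr_ge0 //.
apply: le_trans (_ : \sum_(q <- primes_in j) (N%:R + Z%:R ^+ 3) <= _).
  rewrite big_seq [leRHS]big_seq; apply: ler_sum => q qI.
  apply: le_trans (_ : \sum_(q' <- primes_in j) ((if q == q' then N else 0)%:R + (Z * Z)%:R) <= _).
    by apply: ler_sum => q' _; case: ifP; rewrite -natrD ler_nat ?leq_addr ?leq_addl.
  rewrite big_split /= big_const_seq count_predT iter_addr_0 lerD //.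
    rewrite -natr_sum ler_nat -big_mkcond -big_filter big_const_seq count_predT iter_addn_0.
    rewrite -[leqRHS]muln1 leq_mul2l; apply/orP; right; rewrite size_filter.
    rewrite (eq_count (a2 := pred1 q)) ?count_uniq_mem ?filter_uniq ?iota_uniq ?leq_b1 //.
  rewrite -[_ *+ size _]mulr_natl -!natrX -natrM ler_nat expnS -mulnn.
  by rewrite leq_mul2r szI orbT.
rewrite big_const_seq count_predT iter_addr_0 -[_ *+ size _]mulr_natl natrM.
have e0 : (0 : R) <= N%:R + Z%:R ^+ 3 by rewrite addr_ge0.
apply: le_trans (ler_wpM2r e0 (_ : _ <= Z%:R)) _; first by rewrite ler_nat.
by rewrite mulrDr -exprS.
Qed.

Lemma sum_ln_prime_divisors_le (R : realType) (s : seq nat) x : (0 < x)%N ->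
  uniq s -> all prime s -> \sum_(q <- s | (q %| x)%N) ln (q%:R : R) <= ln x%:R.
Proof.
move=> x0 us /allP ps; rewrite -ln_prod; last by move=> q /(dvdn_gt0 x0); rewrite ltr0n.
rewrite -natr_prod; apply: ln_nat_le.
  by rewrite prodn_cond_gt0 // => q /(dvdn_gt0 x0).
apply: dvdn_leq => //; rewrite -big_filter; apply: prod_primes_dvd.
- by rewrite filter_uniq.
- by apply/allP => q; rewrite mem_filter => /andP[_ /ps].
- by move=> q; rewrite mem_filter => /andP[].
Qed.

(* Chebyshev's inequality applied to the variance bound. *)
Lemma few_split_rare (R : realType) j N : (3 <= j)%N ->
  4 * ln (N%:R : R) <= (16 ^ j)%:R ->
  (count (fun x => (0 < x) && (split_count j x * (16 * j.+1) < 16 ^ j))%N (iota 0 N))%:R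
    * (16 ^ j)%:R ^+ 2 <=
  16 * (4 * j.+1%:R) ^+ 2 * ((16 ^ j.+1 * N)%:R + (16 ^ j.+1)%:R ^+ 4) :> R.
Proof.
move=> j3 lnN; have j0 : (0 < j)%N by lia.
set Y := (16 ^ j)%N.
pose V (x : nat) : R := \sum_(q <- primes_in j) ln q%:R * ((rho q x%:Z)%:R - 1).
have := variance_bound R N j0; rewrite -/(V _) => hv.
rewrite -mulrA; have {hv} := ler_wpM2l (ler0n R 16) hv.
apply: le_trans; rewrite mulr_sumr.
rewrite -sum1_count natr_sum mulr_suml big_mkcond big_seq [leRHS]big_seq.
apply: ler_sum => x; rewrite mem_iota /= add0n => xN.
case: ifP => [/andP[x0 few]|_]; last by rewrite mulr_ge0 ?sqr_ge0.
(* Few split primes force a large deviation: with A the sum of all ln q in the block, A + V <= Y/2 +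
   Y/4 and A >= Y give V <= -Y/4. The factor 16 in front of the variance is the square of this 4. *)
rewrite mul1r; suff : Y%:R <= - 4 * V x.
  have Y0 : (0 : R) <= Y%:R by [].
  by move=> h; rewrite -/(V x); nra.
pose A := \sum_(q <- primes_in j) ln (q%:R : R).
have AE : Y%:R <= A.
  rewrite /A big_filter.
  have -> : \sum_(i <- index_iota (16 ^ j).+1 (16 ^ j.+1).+1 | prime i) ln (i%:R : R) =
      theta R (16 ^ j.+1) - theta R (16 ^ j).
    rewrite /theta [X in X - _](@big_cat_nat _ _ _ (16 ^ j).+1) //=; first by rewrite addrAC subrr add0r.
    by rewrite ltnS leq_exp2l.
  exact: theta_interval.
have us : uniq (primes_in j) by rewrite filter_uniq // iota_uniq.
have ps : all prime (primes_in j) by apply/allP => q; rewrite mem_filter => /andP[].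
(* A + V is the sum of ln q weighted by [rho]: split primes count twice, inert ones not at all, and
   primes dividing x once, which costs at most ln x in total. *)
have AV : A + V x <= 2 * ((4 * j.+1%:R) * (split_count j x)%:R) + ln x%:R.
  apply: le_trans (lerD (lexx _) (sum_ln_prime_divisors_le R x0 us ps)).
  have -> : (split_count j x)%:R = \sum_(q <- primes_in j | rho q x%:Z == 2) (1 : R).
    by rewrite /split_count -sum1_count natr_sum /primes_in big_filter_cond.
  rewrite /A /V -big_split mulr_sumr mulr_sumr /= (big_mkcond (fun q => rho q _ == _)).
  rewrite (big_mkcond (fun q => (q %| x)%N)) -big_split /=.
  rewrite big_seq [leRHS]big_seq; apply: ler_sum => q /(primes_inP j0)[pq oq qY].
  have l0 : 0 <= ln (q%:R : R) by rewrite ln_ge0 ?ler1n ?prime_gt0.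
  have l1 := le_trans (ln_nat_le R (prime_gt0 pq) qY) (ln16_le R j.+1).
  have -> : ln q%:R + ln q%:R * ((rho q x)%:R - 1) = ln q%:R * (rho q x)%:R :> R by ring.
  have [qx|nqx] := boolP (q %| x)%N.
    have -> : rho q x = 1%N by apply: rho0; rewrite // dvdzE.
    by rewrite /= mulr1 add0r.
  rewrite addr0; case: eqVneq => [->|r2].
    by rewrite mulr1 mulrC ler_wpM2l.
  case: (posnP (rho q x%:Z)) => [->|r0]; first by rewrite !mulr0.
  have nqx' : ~~ (q%:Z %| x%:Z)%Z by rewrite dvdzE.
  by rewrite (rho_gt0E pq oq nqx' r0) in r2.
have lnx : ln x%:R <= ln (N%:R : R) by apply: ln_nat_le => //; exact: ltnW.
rewrite -(ltr_nat R) !natrM in few.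
move: few AV AE lnN lnx; rewrite -/Y; move: (split_count j x)%:R (j.+1%:R) (ln x%:R) (ln N%:R) => n k lx lN.
lra.
Qed.

(** * The local count *)

Lemma ln4_le2 (R : realType) : ln 4 <= 2 :> R.
Proof.
have -> : 4 = 2 ^+ 2 :> R by ring.
by rewrite lnXn // mulr2n; have := ln2_le1 R; lra.
Qed.

Lemma logn_squarefree p u : (0 < u)%N -> squarefree u -> prime p -> (p %| u)%N -> logn p u = 1%N.
Proof.
move=> u0 /(squarefreeP u0) su pp pu; apply/eqP; rewrite eqn_leq.
rewrite -[(1 <= _)%N]pfactor_dvdn // expn1 pu andbT -ltnS ltnNge -pfactor_dvdn //.
exact: su.
Qed.

Lemma ln_squarefree (R : realType) u : (0 < u)%N -> squarefree u ->
  ln (u%:R : R) = \sum_(p <- primes u) ln p%:R.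
Proof.
move=> u0 su; rewrite [in LHS](prod_prime_decomp u0) prime_decompE big_map natr_prod /=.
rewrite big_seq ln_prod; last first.
  by move=> p; rewrite mem_primes => /and3P[pp _ _]; rewrite ltr0n expn_gt0 prime_gt0.
rewrite [RHS]big_seq; apply: eq_bigr => p; rewrite mem_primes => /and3P[pp _ pu].
by rewrite logn_squarefree // expn1.
Qed.

(* Hall's device: weight each element u of the sifted set by
   ln Y = sum_(p | u) ln p + ln (Y / u) and interchange the sums. *)
Lemma sifted_count (R : realType) (P : pred nat) Y : (0 < Y)%N ->
  (size (rng (oddsqf_all P) Y))%:R * ln (Y%:R : R) <=
  3 * Y%:R * recip_sum R (oddsqf_all P) Y.
Proof.
move=> Y0; set s := rng _ _; have Y0' : (0 : R) < Y%:R by rewrite ltr0n.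
have sP u : u \in s -> [/\ (0 < u)%N, (u <= Y)%N, squarefree u & oddsqf_all P u].
  by rewrite mem_rng => /and3P[h u0 uY]; split => //; case/andP: h => /and3P[].
have -> : (size s)%:R * ln (Y%:R : R) = \sum_(u <- s) (ln u%:R + ln (Y%:R / u%:R)).
  rewrite mulr_natl -iter_addr_0 -(count_predT s) -big_const_seq; apply: eq_big_seq => u.
  case/sP => u0 _ _ _; have u0' : (0 : R) < u%:R by rewrite ltr0n.
  by rewrite -lnM ?posrE ?divr_gt0 // mulrCA mulfV ?mulr1 // gt_eqF.
rewrite big_split /=.
have h2 : \sum_(u <- s) ln (Y%:R / u%:R) <= Y%:R * recip_sum R (oddsqf_all P) Y.
  rewrite recip_sumE mulr_sumr big_seq [leRHS]big_seq; apply: ler_sum => u /sP[u0 _ _ _].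
  by apply/ltW/ln_sublinear; rewrite divr_gt0 // ltr0n.
(* A pair (u, p) with p | u is sent to (u/p, p): u/p is again sifted and p <= Y/(u/p), so
   Chebyshev's bound applies to the inner sum. *)
have h1 : \sum_(u <- s) ln (u%:R : R) <= \sum_(m <- s) theta R (Y %/ m).
  have -> : \sum_(u <- s) ln (u%:R : R) = \sum_(u <- s) \sum_(p <- primes u) ln p%:R.
    by apply: eq_big_seq => u /sP[u0 _ su _]; exact: ln_squarefree.
  under [leRHS]eq_bigr do rewrite /theta sum_rng.
  pose t := [seq (m, p) | m <- s, p <- rng prime (Y %/ m)].
  have -> : \sum_(m <- s) \sum_(p <- rng prime (Y %/ m)) ln (p%:R : R) =
     \sum_(z <- t) ln z.2%:R by rewrite big_allpairs_dep.
  apply: (@ler_pairs_sum R _ _ _ _ primes t (fun u p => (u %/ p, p)%N) (fun z => ln z.2%:R)).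
  - exact: rng_uniq.
  - by move=> *; exact: primes_uniq.
  - move=> u p us; have [u0 uY su hu] := sP _ us.
    rewrite mem_primes => /and3P[pp _ pu]; have p0 := prime_gt0 pp.
    have k0 : (0 < u %/ p)%N by rewrite divn_gt0 // dvdn_leq.
    apply/allpairsPdep; exists (u %/ p)%N, p; split => //.
      rewrite mem_rng (oddsqf_all_dvd hu) ?dvdn_div // k0 /=.
      exact: leq_trans (leq_div _ _) uY.
    by rewrite mem_rng pp p0 /= leq_divRL // mulnC divnK.
  - move=> u p u' p' us; rewrite !mem_primes => /and3P[pp _ pu] us' /and3P[pp' _ pu'] [e ep].
    by split => //; rewrite -(divnK pu) e ep divnK.
  - move=> z /allpairsPdep[m [p [_]]]; rewrite mem_rng => /and3P[_ p0 _] -> /=.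
    by rewrite ln_ge0 // ler1n.
have h3 : \sum_(m <- s) theta R (Y %/ m) <= 2 * (Y%:R * recip_sum R (oddsqf_all P) Y).
  rewrite recip_sumE !mulr_sumr big_seq [leRHS]big_seq; apply: ler_sum => m /sP[m0 _ _ _].
  have m0' : (0 : R) < m%:R by rewrite ltr0n.
  apply: le_trans (theta_le R _) _; rewrite mulrC; apply: ler_pM => //.
  - by rewrite ln_ge0 // ler1n.
  - exact: ln4_le2.
  - by rewrite ler_pdivlMr // -natrM ler_nat leq_divM.
lra.
Qed.

Lemma sum_ln_inv_sq_le2 (R : realType) D :
  \sum_(1 <= d < D.+1) ln d%:R / d%:R ^+ 2 <= 2 :> R.
Proof.
(* Modelled on the antiderivative -(1 + ln x)/x of ln x / x^2; the constants make the bound an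
   equality at the start of the induction. *)
have h E : \sum_(1 <= d < E.+2) ln d%:R / d%:R ^+ 2 <= 2 - (2 + ln E.+1%:R) / E.+1%:R :> R.
  elim: E => [|E IH]; first by rewrite big_nat1 ln1; lra.
  rewrite big_nat_recr //=; have /andP[_ hl] := @lnS_bounds R E.+1 isT.
  have x1 : (1 : R) <= E.+1%:R by rewrite ler1n.
  have l'0 : 0 <= ln (E.+2%:R : R) by rewrite ln_ge0 // ler1n.
  apply: le_trans (lerD IH (lexx _)) _.
  move: hl x1 l'0; rewrite -(natr1 E.+1); move: (E.+1%:R) => x; move: (ln x) (ln (x + 1)) => l l' hl x1 l0.
  have x0 : 0 < x by lra.
  have i0 : 0 < x^-1 by rewrite invr_gt0.
  have i1 : x^-1 <= 1 by rewrite invf_le1.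
  have j0 : 0 < (x + 1)^-1 by rewrite invr_gt0; lra.
  suff : l' / (x + 1) ^+ 2 + (2 + l') / (x + 1) <= (2 + l) / x by lra.
  apply: le_trans (_ : (2 + (l' - x^-1)) / x <= _); last by apply: ler_wpM2r; lra.
  rewrite -subr_ge0.
  have -> : (2 + (l' - x^-1)) / x - (l' / (x + 1) ^+ 2 + (2 + l') / (x + 1)) =
    (l' * (x + 1)^-1 + (1 - x^-1)) * x^-1 * (x+1)^-1.
    by field; rewrite !gt_eqF //; lra.
  have a0 : 0 <= 1 - x^-1 by lra.
  have b0 : 0 <= l' * (x + 1)^-1 by rewrite mulr_ge0 // ltW.
  by rewrite !mulr_ge0 ?(ltW i0) ?(ltW j0) // addr_ge0.
case: D => [|D]; first by rewrite big_nil; lra.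
apply: le_trans (h D) _; rewrite gerBl divr_ge0 // addr_ge0 // ln_ge0 // ler1n //.
Qed.

Definition oddval_all (P : pred nat) C :=
  all (fun p => odd p ==> odd (logn p C) ==> P p) (primes C).

(** The squarefree part of C consists of the primes of odd valuation; e takes up a possible factor
    2, on which [oddval_all] imposes nothing. *)
Lemma oddval_decomp (P : pred nat) C : (0 < C)%N -> oddval_all P C ->
  exists e u d, [/\ e \in [:: 1; 2]%N, oddsqf_all P u, (0 < d)%N & C = u * (e * d ^ 2)]%N.
Proof.
move=> C0 /allP hC; have [v [d [v0 d0 sv CE]]] := squarefree_decomp C0.
have key u : (0 < u)%N -> (u %| v)%N -> odd u -> oddsqf_all P u.
  move=> u0 uv ou; apply/oddsqf_allP; split.
    by rewrite /oddsqf u0 ou (squarefree_dvd v0 uv).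
  move=> p pp pu; have op := dvdn_odd pu ou.
  have pC : p \in primes C.
    by rewrite mem_primes pp C0 CE dvdn_mulr // (dvdn_trans pu uv).
  have := hC _ pC; rewrite op CE lognM ?expn_gt0 ?d0 // lognX.
  by rewrite logn_squarefree ?(dvdn_trans pu uv) // oddD mul2n odd_double /=.
have [ov|ev] := boolP (odd v).
  by exists 1%N, v, d; rewrite mul1n key.
exists 2%N, v./2, d; have vE : (v = v./2 * 2)%N by lia.
split => //; last by rewrite mulnA -vE.
have h0 : (0 < v./2)%N by lia.
apply: key => //; first by rewrite {2}vE dvdn_mulr.
by move: sv; rewrite {1}vE mulnC squarefree_mul_prime // dvdn2 negbK => /andP[].
Qed.

(** The sieve bound is summed over C = u e d^2. For large d the range Y = N/(e d^2) is short and ln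
    N may exceed ln Y by 2 + 2 ln d; this excess is paid with the trivial count Y and the
    convergence of the sum of ln d / d^2. The constant is 28 = 10 * 2 + 4 * 2. *)
Lemma oddval_count (R : realType) (P : pred nat) N : (0 < N)%N ->
  (size (rng (oddval_all P) N))%:R * ln (N%:R : R) <=
  28 * N%:R * recip_sum R (oddsqf_all P) N.
Proof.
move=> N0; have N0' : (0 : R) < N%:R by rewrite ltr0n.
set S := recip_sum _ _ _.
(* The term m = 1 alone; it lets contributions without the factor S be absorbed. *)
have S1 : 1 <= S.
  rewrite /S recip_sumE; apply: le_trans (_ : \sum_(m <- [:: 1%N]) m%:R^-1 <= _).
    by rewrite big_seq1 invr1.
  apply: sum_uniq_sub => // m; rewrite inE => /eqP ->.
  by rewrite mem_rng N0 andbT /oddsqf_all oddsqf1.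
pose r Y := size (rng (oddsqf_all P) Y).
have rle Y : (r Y <= Y)%N.
  rewrite -[leqRHS](size_iota 1); apply: uniq_leq_size; first exact: rng_uniq.
  by move=> m; rewrite mem_rng mem_iota add1n ltnS => /and3P[_ -> ->].
have cnt : ((size (rng (oddval_all P) N))%:R : R) <=
    \sum_(d <- rng predT N) \sum_(e <- [:: 1; 2]%N) (r (N %/ (e * d ^ 2))%N)%:R.
  pose t := [seq (d, e) | d <- rng predT N, e <- [:: 1; 2]%N].
  have -> : \sum_(d <- rng predT N) \sum_(e <- [:: 1; 2]%N) (r (N %/ (e * d ^ 2))%N)%:R =
    \sum_(z <- t) \sum_(u <- rng (oddsqf_all P) (N %/ (z.2 * z.1 ^ 2))%N) (1 : R).
    rewrite big_allpairs_dep; apply: eq_bigr => d _; apply: eq_bigr => e _.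
    by rewrite big_const_seq count_predT iter_addr_0.
  have -> : ((size (rng (oddval_all P) N))%:R : R) = \sum_(C <- rng (oddval_all P) N) 1.
    by rewrite big_const_seq count_predT iter_addr_0.
  apply: (@ler_sum_pairs R _ _ _ t (fun z => rng (oddsqf_all P) (N %/ (z.2 * z.1 ^ 2))%N) _
    (fun z u => (u * (z.2 * z.1 ^ 2))%N) (fun=> 1)) => //; first exact: rng_uniq.
  move=> C; rewrite mem_rng => /and3P[hC C0 CN].
  have [e [u [d [e12 hu d0 CE]]]] := oddval_decomp C0 hC.
  have u0 : (0 < u)%N by case/andP: hu => /oddsqf_gt0.
  have e0 : (0 < e)%N by move: e12; rewrite !inE => /orP[] /eqP->.
  exists (d, e), u; split => //=.
    apply/allpairsPdep; exists d, e; split => //; rewrite mem_rng d0 /=.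
    apply: leq_trans CN; rewrite CE mulnA expnS expn1 mulnA leq_pmull //.
    by rewrite !muln_gt0 u0 e0 d0.
  by rewrite mem_rng hu u0 /= leq_divRL ?muln_gt0 ?e0 ?expn_gt0 ?d0 // -CE.
have lnN0 : 0 <= ln (N%:R : R) by rewrite ln_ge0 // ler1n.
apply: le_trans (ler_wpM2r lnN0 cnt) _.
rewrite mulr_suml.
apply: le_trans (_ : \sum_(d <- rng predT N)
    N%:R * S * (10 * (d%:R ^+ 2)^-1 + 4 * (ln d%:R / d%:R ^+ 2)) <= _); last first.
  rewrite -mulr_sumr big_split /= -!mulr_sumr -!sum_rng.
  have := sum_inv_sq_le2 R N; have := sum_ln_inv_sq_le2 R N.
  move: (\sum_(_ <= _ < _) _) (\sum_(_ <= _ < _) _) => a b ha hb.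
  have -> : 28 * N%:R * S = N%:R * S * 28 by ring.
  by apply: ler_wpM2l; [rewrite mulr_ge0 //|]; lra.
rewrite big_seq [leRHS]big_seq; apply: ler_sum => d; rewrite mem_rng => /and3P[_ d0 dN].
have d0' : (0 : R) < d%:R by rewrite ltr0n.
have lnd0 : 0 <= ln (d%:R : R) by rewrite ln_ge0 // ler1n.
have each e : e \in [:: 1; 2]%N -> (r (N %/ (e * d ^ 2))%N)%:R * ln (N%:R : R) <=
   N%:R * S * (5 * (d%:R ^+ 2)^-1 + 2 * (ln d%:R / d%:R ^+ 2)).
  move=> e12; have e0 : (0 < e)%N by move: e12; rewrite !inE => /orP[] /eqP->.
  have e2 : (e <= 2)%N by move: e12; rewrite !inE => /orP[] /eqP->.
  set Y := (N %/ (e * d ^ 2))%N.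
  case: (posnP Y) => [->|Y0].
    have -> : r 0 = 0%N by apply/eqP; rewrite -leqn0 rle.
    rewrite mul0r mulr_ge0 ?mulr_ge0 //; first lra.
    by rewrite addr_ge0 // ?mulr_ge0 // ?invr_ge0 ?divr_ge0 ?exprn_ge0 //.
  have ed0 : (0 < e * d ^ 2)%N by rewrite muln_gt0 e0 expn_gt0 d0.
  have NY : (N <= Y * (4 * d ^ 2))%N.
    have := ltn_ceil N ed0; rewrite -/Y => h; apply: ltnW; apply: leq_trans h _.
    by rewrite (_ : Y * (4 * d ^ 2) = (Y * 2) * (2 * d ^ 2))%N; [apply: leq_mul; [lia|rewrite leq_mul2r e2 orbT]|ring].
  have YN : (Y%:R : R) <= N%:R * (d%:R ^+ 2)^-1.
    rewrite ler_pdivlMr ?exprn_gt0 // -natrX -natrM ler_nat.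
    by apply: leq_trans (leq_divM N (e * d ^ 2)); rewrite leq_mul2l leq_pmull ?orbT.
  have lnN : ln (N%:R : R) <= ln Y%:R + (2 + 2 * ln d%:R).
    apply: le_trans (ln_nat_le R N0 NY) _.
    rewrite natrM lnM ?posrE ?ltr0n ?muln_gt0 ?expn_gt0 ?d0 //.
    rewrite natrM natrX lnM ?posrE ?exprn_gt0 // lnXn // mulr2n.
    by have := ln4_le2 R; lra.
  have SY : recip_sum R (oddsqf_all P) Y <= S.
    rewrite /S !recip_sumE; apply: sum_uniq_sub; first exact: rng_uniq.
      move=> m; rewrite !mem_rng => /and3P[-> -> mY]; exact: leq_trans mY (leq_div _ _).
    by move=> m _; rewrite invr_ge0.
  have h := sifted_count R P Y0.
  have rY : ((r Y)%:R : R) <= Y%:R by rewrite ler_nat.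
  have YR0 : (0 : R) <= Y%:R by [].
  apply: le_trans (_ : (r Y)%:R * (ln Y%:R + (2 + 2 * ln d%:R)) <= _).
    by rewrite ler_wpM2l.
  apply: le_trans (_ : Y%:R * (S * (5 + 2 * ln d%:R)) <= _).
    rewrite mulrDr; apply: le_trans (lerD h (lexx _)) _.
    have h2 : (r Y)%:R * (2 + 2 * ln d%:R) <= Y%:R * (2 + 2 * ln d%:R) :> R.
      by rewrite ler_wpM2r //; lra.
    have h3 : Y%:R * recip_sum R (oddsqf_all P) Y <= Y%:R * S by rewrite ler_wpM2l.
    have h4 : Y%:R * (2 + 2 * ln d%:R) <= Y%:R * (S * (2 + 2 * ln d%:R)) :> R.
      by rewrite ler_wpM2l // ler_peMl //; lra.
    lra.
  have -> : N%:R * S * (5 * (d%:R ^+ 2)^-1 + 2 * (ln d%:R / d%:R ^+ 2)) =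
     (N%:R * (d%:R ^+ 2)^-1) * (S * (5 + 2 * ln d%:R)) by ring.
  by rewrite ler_wpM2r // mulr_ge0 //; lra.
rewrite !big_cons big_nil addr0 mulrDl.
apply: le_trans (lerD (each 1%N _) (each 2%N _)) _ => //.
by rewrite -mulrDr ler_wpM2l ?mulr_ge0 //; lra.
Qed.

(** * p-adic solutions and valuations of the norm form *)

Section PadicReduction.
Context (p : nat).
Implicit Types x y z : padic_int p.

Lemma padic_addE x y k : (x + y) k = ((x k + y k) %% p%:Z ^+ k)%Z.
Proof. by []. Qed.
Lemma padic_mulE x y k : (x * y) k = ((x k * y k) %% p%:Z ^+ k)%Z.
Proof. by []. Qed.
Lemma padic_oppE x k : (- x) k = ((- x k) %% p%:Z ^+ k)%Z.
Proof. by []. Qed.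
Lemma padic_oneE k : (1 : padic_int p) k = (1 %% p%:Z ^+ k)%Z.
Proof. by []. Qed.
Lemma padic_zeroE k : (0 : padic_int p) k = (0 %% p%:Z ^+ k)%Z.
Proof. by []. Qed.

Lemma padic_natE m k : (m%:R : padic_int p) k = (m%:Z %% p%:Z ^+ k)%Z.
Proof.
elim: m => [|m IH]; first by rewrite padic_zeroE.
by rewrite -natr1 padic_addE IH padic_oneE modzDm -addn1 PoszD.
Qed.

Lemma padic_intE (m : int) k : (m%:~R : padic_int p) k = (m %% p%:Z ^+ k)%Z.
Proof.
case: m => m; first by rewrite -padic_natE.
by rewrite NegzE mulrNz padic_oppE -[(m.+1%:~R)]/(m.+1%:R) padic_natE modzNm.
Qed.

Lemma padic_expE x m k : (x ^+ m) k = ((x k) ^+ m %% p%:Z ^+ k)%Z.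
Proof.
elim: m => [|m IH]; first by rewrite !expr0 padic_oneE.
by rewrite !exprS padic_mulE IH modzMmr.
Qed.

(** Divisibility by p is visible at every positive level alike. Division by p costs one digit, so
    level k of the quotient is read off from level k + 1 of x. *)
Lemma padic_div x K : (0 < p)%N -> (0 < K)%N -> (p%:Z %| x K)%Z -> exists x', x = p%:R * x'.
Proof.
move=> p0; case: K => // K _ pxK.
have p0' : p%:Z != 0 by rewrite eqz_nat -lt0n.
have hx k : (p%:Z %| x k.+1)%Z = (p%:Z %| x 1%N)%Z.
  elim: k => // k <-.
  have /eqP := padic_mod x k.+1; rewrite eqz_mod_dvd => h.
  rewrite -[x k.+2](subrK (x k.+1)) rpredDl //.
  by apply: (dvdz_trans _ h); rewrite exprS dvdz_mulr.
have px k : (p%:Z %| x k.+1)%Z by rewrite hx -(hx K).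
have coh k : ((x k.+2 %/ p%:Z)%Z %% p%:Z ^+ k)%Z = ((x k.+1 %/ p%:Z)%Z %% p%:Z ^+ k)%Z.
  apply/eqP; rewrite eqz_mod_dvd -(dvdz_mul2r p0') -exprSr mulrBl !divzK //.
  by rewrite -eqz_mod_dvd; apply/eqP; rewrite padic_mod.
exists (PadicInt (padic_red_subproof coh)); apply: padic_eq => k.
rewrite padic_mulE padic_natE /= modzMml modzMmr mulrC divzK //.
by rewrite padic_mod padic_modE.
Qed.

Lemma padic_eqmod x y (B C : int) n z : x ^+ 2 + B%:~R * y ^+ 2 = C%:~R * z ^+ n ->
  forall k, (p%:Z ^+ k %| ((x k) ^+ 2 + B * (y k) ^+ 2) - C * (z k) ^+ n)%Z.
Proof.
move=> e k; rewrite -eqz_mod_dvd.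
have /(congr1 (fun u : padic_int p => u k)) := e.
rewrite padic_addE !padic_mulE !padic_intE !padic_expE.
by rewrite modzDm -modzDmr !modzMm modzDmr => ->.
Qed.

End PadicReduction.

Lemma rho_gt0 p (b y : int) : (0 < p)%N -> (p%:Z %| y ^+ 2 + b)%Z -> (0 < rho p b)%N.
Proof.
move=> p0 hy; have p0' : p%:Z != 0 by rewrite eqz_nat -lt0n.
rewrite -has_count; apply/hasP; exists `|(y %% p%:Z)%Z|%N.
  by rewrite mem_iota add0n /= -ltz_nat gez0_abs ?modz_ge0 // ltz_pmod // ltz_nat.
rewrite /= gez0_abs ?modz_ge0 //.
have -> : (y %% p%:Z)%Z ^+ 2 + b = (y ^+ 2 + b) + ((y %% p%:Z)%Z ^+ 2 - y ^+ 2) by ring.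
by rewrite rpredD // -eqz_mod_dvd modzXm.
Qed.

(** If p did not divide Y, then X/Y would be a square root of -b modulo p. *)
Lemma anisotropic_dvd p (b X Y : int) : prime p -> rho p b = 0%N ->
  (p%:Z %| X ^+ 2 + b * Y ^+ 2)%Z -> (p%:Z %| X)%Z /\ (p%:Z %| Y)%Z.
Proof.
move=> pp r0 h; have p0 := prime_gt0 pp.
have pY : (p%:Z %| Y)%Z.
  apply: contraT => nY; have : coprimez Y p%:Z.
    by rewrite coprimezE coprime_sym prime_coprime //.
  case/coprimezP => -[u v] /= uv; suff : (0 < rho p b)%N by rewrite r0.
  apply: (@rho_gt0 p b (X * u)) => //.
  have -> : (X * u) ^+ 2 + b = u ^+ 2 * (X ^+ 2 + b * Y ^+ 2) +
      p%:Z * (b * v * (1 + u * Y)).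
    have -> : p%:Z * (b * v * (1 + u * Y)) = b * (v * p%:Z) * (1 + u * Y) by ring.
    have -> : v * p%:Z = 1 - u * Y by rewrite -uv; ring.
    by ring.
  by apply: rpredD; [exact: dvdz_mull|exact: dvdz_mulr].
split => //; have : (p%:Z %| X ^+ 2)%Z.
  rewrite -[X ^+ 2](addrK (b * Y ^+ 2)) rpredB //.
  by rewrite expr2 mulrA dvdz_mull.
by rewrite expr2 Euclid_dvdzM // orbb.
Qed.

(** Descent: X and Y are both divisible by p, and dividing both removes p^2. Hence the norm form
    takes only even valuations at p. *)
Lemma anisotropic_even p (b X Y : int) i : prime p -> rho p b = 0%N ->
  (p%:Z ^+ i.*2.+1 %| X ^+ 2 + b * Y ^+ 2)%Z -> (p%:Z ^+ i.*2.+2 %| X ^+ 2 + b * Y ^+ 2)%Z.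
Proof.
move=> pp r0; have p0 : p%:Z != 0 by rewrite eqz_nat -lt0n prime_gt0.
elim: i X Y => [|i IH] X Y h.
  rewrite expr1 in h; have [/dvdzP[x ->] /dvdzP[y ->]] := anisotropic_dvd pp r0 h.
  have -> : (x * p%:Z) ^+ 2 + b * (y * p%:Z) ^+ 2 = (x ^+ 2 + b * y ^+ 2) * p%:Z ^+ 2 by ring.
  exact: dvdz_mull.
have h1 : (p%:Z %| X ^+ 2 + b * Y ^+ 2)%Z by apply: dvdz_trans h; rewrite exprS dvdz_mulr.
have [/dvdzP[x XE] /dvdzP[y YE]] := anisotropic_dvd pp r0 h1.
move: h; rewrite XE YE.
have -> : (x * p%:Z) ^+ 2 + b * (y * p%:Z) ^+ 2 = (x ^+ 2 + b * y ^+ 2) * p%:Z ^+ 2 by ring.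
have -> : (i.+1.*2.+2 = i.*2.+2 + 2)%N by lia.
have -> : (i.+1.*2.+1 = i.*2.+1 + 2)%N by lia.
rewrite !exprD !dvdz_mul2r ?expf_neq0 //.
exact: IH.
Qed.

(** Suppose -B is a nonsquare modulo p. If p | z, the form forces p | x and p | y, against
    primitivity; otherwise C z^n has the odd valuation of C while the norm form has only even ones.
    One level beyond the valuation of C is enough precision. *)
Lemma local_residue n (B C : int) p : (0 < n)%N -> prime p -> C != 0 ->
  odd (logn p `|C|) -> has_primitive_padic_sol n B C p -> (0 < rho p B)%N.
Proof.
move=> n0 pp C0 oC [x [y [z [prim e]]]]; rewrite lt0n; apply/eqP => r0.
have p0 := prime_gt0 pp; set K := (logn p `|C|).+1.
have := padic_eqmod e K; set X := x K; set Y := y K; set Z := z K => h.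
have CE i : (p%:Z ^+ i %| C)%Z = (i <= logn p `|C|)%N.
  by rewrite dvdzE abszX /= pfactor_dvdn // absz_gt0.
have low j : (j <= K)%N -> (p%:Z ^+ j %| C * Z ^+ n)%Z -> (p%:Z ^+ j %| X ^+ 2 + B * Y ^+ 2)%Z.
  move=> jK hj; rewrite -[X ^+ 2 + _](subrK (C * Z ^+ n)) rpredD //.
  by apply: (dvdz_trans _ h); rewrite dvdz_exp2l.
have [pZ|npZ] := boolP (p%:Z %| Z)%Z.
  have h1 : (p%:Z %| X ^+ 2 + B * Y ^+ 2)%Z.
    rewrite -[p%:Z]expr1; apply: low => //; rewrite expr1.
    by case: (n) n0 => // m _; rewrite exprS mulrCA dvdz_mulr.
  have [pX pY] := anisotropic_dvd pp r0 h1; apply: prim.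
  have [x' ->] := padic_div p0 (isT : 0 < K)%N pX.
  have [y' ->] := padic_div p0 (isT : 0 < K)%N pY.
  have [z' ->] := padic_div p0 (isT : 0 < K)%N pZ.
  by exists x', y', z'.
have KE : K = (logn p `|C|)./2.*2.+2 by rewrite /K; lia.
have h2 : (p%:Z ^+ (logn p `|C|)./2.*2.+1 %| X ^+ 2 + B * Y ^+ 2)%Z.
  apply: low; first by rewrite KE.
  by rewrite dvdz_mulr // CE; lia.
have h3 := anisotropic_even pp r0 h2; rewrite -KE in h3.
have : (p%:Z ^+ K %| C * Z ^+ n)%Z.
  by rewrite -[C * _](subKr (X ^+ 2 + B * Y ^+ 2)) rpredB.
rewrite Gauss_dvdzl; last first.
  by rewrite coprimezE !abszX coprimeXl // coprimeXr // prime_coprime.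
by rewrite CE ltnn.
Qed.

Lemma card_fset_set_le (T : choiceType) (S : set T) (L : seq T) :
  (forall z, S z -> z \in L) -> (#|` fset_set S| <= size L)%N.
Proof.
move=> h; have fS : finite_set S.
  by apply: (@sub_finite_set _ _ [set` L]) (finite_seq L) => z /h.
apply: uniq_leq_size; first exact: fset_uniq.
by move=> z; rewrite in_fset_set // inE => /h.
Qed.

(** [L] certifies finiteness, without which [fset_set S] would be empty. *)
Lemma card_fset_set_ge (T : choiceType) (S : set T) (s L : seq T) :
  (forall z, S z -> z \in L) -> uniq s -> (forall z, z \in s -> S z) ->
  (size s <= #|` fset_set S|)%N.
Proof.
move=> h us hs; have fS : finite_set S.
  by apply: (@sub_finite_set _ _ [set` L]) (finite_seq L) => z /h.
apply: uniq_leq_size => // z zs; rewrite in_fset_set // inE; exact: hs.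
Qed.

Lemma harm_sqr_le (R : realType) N : (16 <= N)%N ->
  recip_sum R predT (N * N) <= 4 * ln (N%:R : R) /\ 1 <= ln (N%:R : R).
Proof.
move=> N16; have N0 : (0 < N)%N by lia.
have l1 : 2 <= ln (N%:R : R).
  have := @ln_nat_le R 16 N isT N16.
  have -> : 16%:R = 2 ^+ 4 :> R by ring.
  by rewrite lnXn // -[_ *+ 4]mulr_natl; have := ln2_ge R; lra.
split; last by lra.
apply: le_trans (@harm_le R _ (_ : 0 < N * N)%N) _; first by rewrite muln_gt0 N0.
by rewrite natrM lnM ?posrE ?ltr0n //; lra.
Qed.

Lemma abs_lt_truncn (R : realType) (T : R) (b : int) :
  `|b|%:~R < T -> (`|b| <= Num.truncn T)%N.
Proof.
rewrite -natr_absz => h; have T0 : 0 <= T by apply: ltW; apply: le_lt_trans h.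
by rewrite truncn_ge_nat // ltW.
Qed.

Lemma le_four_signs (R : realType) (z x y l v c : R) : z = (x + x) + (y + y) ->
  x * l <= c * (2 * v) -> y * l <= c * (2 * v) -> z * l <= 8 * c * v.
Proof. by move=> ->; rewrite !mulrDl; lra. Qed.

(** Each of the four sign patterns gives 28 N * 8 N * 2 sqrt(ln N): the sieve for fixed B, then the
    average over B, where 4 (N + 1) <= 8 N. Hence 224 = 28 * 8. *)
Lemma N_loc_upper (R : realType) (n : nat) (T : R) (N := Num.truncn T) :
  (0 < n)%N -> (16 <= N)%N ->
  (N_loc n T)%:R * ln (N%:R : R) <= 8 * (224 * N%:R ^+ 2) * Num.sqrt (ln (N%:R : R)).
Proof.
move=> n0 N16; have N0 : (0 < N)%N by lia.
have [hN l1] := harm_sqr_le R N16.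
pose P (s : int) (p : nat) : pred nat := fun x => (0 < rho p (s * x%:Z))%N.
pose good s x := rng (oddval_all ((P s)^~ x)) N.
pose L := [seq ((s.1 * x.1%:Z, s.2 * x.2%:Z) : int * int) |
   s <- [seq (s1, s2) | s1 <- [:: 1; -1 : int], s2 <- [:: 1; -1 : int]],
   x <- [seq (b, c) | b <- iota 0 N.+1, c <- good s.1 b]].
have hL : (N_loc n T <= size L)%N.
  apply: card_fset_set_le => -[B C] /= [B0 C0 BT CT loc].
  have BN := abs_lt_truncn BT; have CN := abs_lt_truncn CT.
  have sgnE (m : int) : exists2 s : int, s \in [:: 1; -1] & m = s * `|m|%N%:Z.
    case: (lerP 0 m) => m0.
      by exists 1; rewrite ?inE // mul1r gez0_abs.
    by exists (-1); rewrite ?inE ?eqxx ?orbT // mulN1r ltz0_abs // opprK.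
  have [s1 s1i BE] := sgnE B; have [s2 s2i CE] := sgnE C.
  apply/allpairsPdep; exists (s1, s2), (`|B|%N, `|C|%N); split; last by rewrite /= -BE -CE.
    by apply/allpairsPdep; exists s1, s2.
  apply/allpairsPdep; exists `|B|%N, `|C|%N; split => //.
    by rewrite mem_iota add0n ltnS.
  rewrite mem_rng absz_gt0 C0 CN !andbT; apply/allP => p.
  rewrite mem_primes => /and3P[pp _ pC]; apply/implyP => op; apply/implyP => oC.
  by rewrite /P -BE; apply: (local_residue n0 pp C0 oC); exact: loc.
have sizeL : (size L)%:R = \sum_(s1 <- [:: 1; -1 : int]) \sum_(s2 <- [:: 1; -1 : int])
    \sum_(b <- iota 0 N.+1) (size (good s1 b))%:R :> R.
  rewrite -sum1_size big_allpairs_dep natr_sum big_allpairs_dep.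
  apply: eq_bigr => s1 _; apply: eq_bigr => s2 _.
  rewrite big_allpairs_dep natr_sum; apply: eq_bigr => b _.
  by rewrite sum1_size.
have each s : s \in [:: 1; -1 : int] -> (\sum_(b <- iota 0 N.+1) (size (good s b))%:R) * ln (N%:R : R)
    <= 224 * N%:R ^+ 2 * (2 * Num.sqrt (ln (N%:R : R))).
  move=> si; have ss : s * s = 1 by move: si; rewrite !inE => /orP[] /eqP->.
  rewrite mulr_suml.
  apply: le_trans (_ : \sum_(b <- iota 0 N.+1) 28 * N%:R * recip_sum R (oddsqf_all ((P s)^~ b)) N <= _).
    by apply: ler_sum => b _; exact: oddval_count.
  rewrite -mulr_sumr.
  have rP : residual (P s).
    by move=> p x; rewrite /P (@rho_congr p _ (s * x%:Z)) // rho_residual.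
  have half p : prime p -> odd p -> (2 * count (P s p) (iota 0 p) <= p.+1)%N.
    by move=> pp op; exact: count_rho_gt0.
  have := @avg_recip_sum R (P s) N.+1 N rP half (leqnSn N).
  set A := \sum_(_ <- _) _; move=> hA.
  have sq : Num.sqrt (recip_sum R predT (N * N)) <= 2 * Num.sqrt (ln (N%:R : R)).
    have -> : 2 = Num.sqrt (4 : R).
      have -> : 4 = 2 ^+ 2 :> R by ring.
      by rewrite sqrtr_sqr ger0_norm.
    by rewrite -sqrtrM // ler_wsqrtr.
  have N1 : (N.+1%:R : R) <= 2 * N%:R by rewrite -natrM ler_nat; lia.
  have s0 : 0 <= Num.sqrt (recip_sum R predT (N * N)) by exact: sqrtr_ge0.
  have hA2 : A <= 8 * N%:R * (2 * Num.sqrt (ln (N%:R : R))).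
    apply: le_trans hA _; apply: ler_pM => //; lra.
  have NR0 : (0 : R) <= 28 * N%:R by rewrite mulr_ge0.
  apply: le_trans (ler_wpM2l NR0 hA2) _.
  by rewrite le_eqVlt; apply/orP; left; apply/eqP; ring.
have lnN0 : 0 <= ln (N%:R : R) by lra.
apply: le_trans (ler_wpM2r lnN0 (_ : _ <= (size L)%:R)) _; first by rewrite ler_nat.
have e2 : (-1 : int) \in [:: 1; -1 : int] by rewrite !inE eqxx orbT.
pose F s := \sum_(b <- iota 0 N.+1) (size (good s b))%:R : R.
have sE : (size L)%:R = (F 1 + F 1) + (F (-1) + F (-1)).
  have two (G : int -> R) : \sum_(s <- [:: 1; -1 : int]) G s = G 1 + G (-1).
    by rewrite big_cons big_seq1.
  by rewrite sizeL two !two.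
have f1 : F 1 * ln (N%:R : R) <= 224 * N%:R ^+ 2 * (2 * Num.sqrt (ln (N%:R : R))).
  exact: (each 1 (mem_head _ _)).
have f2 := each (-1) e2.
move: f1 f2 sE; rewrite -/(F (-1)); move: (F 1) (F (-1)) ((size L)%:R) => x y z f1 f2 sE.
exact: le_four_signs sE f1 f2.
Qed.

(** * Products of split primes *)

Lemma inv_nat_le (R : realType) a b : (0 < a)%N -> (a <= b)%N ->
  (b%:R : R)^-1 <= a%:R^-1.
Proof.
by move=> a0 ab; rewrite lef_pV2 ?posrE ?ltr0n // ?ler_nat // (leq_trans a0 ab).
Qed.

(** At a prime p: two distinct square roots of -b modulo p, so p splits in Q(sqrt(-b)). It fails at
    2 and at the primes dividing b, where [rho] is 1. *)
Definition splits (b : nat) : pred nat := fun p => rho p b%:Z == 2.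

Definition split_primes (b lo hi : nat) : seq nat :=
  [seq q <- index_iota lo hi | prime q && splits b q].

Lemma mem_split_primes b lo hi q :
  (q \in split_primes b lo hi) = [&& prime q, splits b q & (lo <= q < hi)%N].
Proof. by rewrite mem_filter mem_index_iota -andbA. Qed.

Lemma split_countE b j : split_count j b = size (split_primes b (16 ^ j).+1 (16 ^ j.+1).+1).
Proof. by rewrite /split_count size_filter. Qed.

(** Block j contributes at least [split_count] / 16^(j+1) >= 1/(256 (j+1)), and j + 1 <= (u+1) k.
    The k blocks together give a bound independent of k. *)
Lemma recip_split_primes (R : realType) b u k : (0 < u)%N -> (0 < k)%N ->
  (forall j, u * k <= j < u.+1 * k -> 16 ^ j <= split_count j b * (16 * j.+1))%N ->
  (256 * u.+1%:R)^-1 <= \sum_(q <- split_primes b (16 ^ (u * k)) (16 ^ (u.+1 * k))) q%:R^-1 :> R.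
Proof.
move=> u0 k0 h; set t := split_primes _ _ _.
have k0' : (0 : R) < k%:R by rewrite ltr0n.
apply: le_trans (_ : \sum_(j <- index_iota (u * k) (u.+1 * k)) (256 * (u.+1 * k)%:R)^-1 <= _).
  rewrite big_const_seq count_predT size_iota iter_addr_0.
  have -> : (u.+1 * k - u * k = k)%N by rewrite mulSn addnK.
  rewrite -[_ *+ k]mulr_natl natrM.
  have u1 : (0 : R) < u.+1%:R by rewrite ltr0n.
  suff -> : k%:R * (256 * (u.+1%:R * k%:R))^-1 = (256 * u.+1%:R)^-1 :> R by rewrite lexx.
  have c0 : (0 : R) < 256 by rewrite ltr0n.
  move: k0' u1 c0; move: (k%:R : R) (u.+1%:R : R) (256 : R) => x y c x0 y0 c0.
  by field; rewrite !gt_eqF.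
apply: le_trans (_ : \sum_(j <- index_iota (u * k) (u.+1 * k))
   \sum_(q <- split_primes b (16 ^ j).+1 (16 ^ j.+1).+1) q%:R^-1 <= _).
  rewrite big_seq [leRHS]big_seq; apply: ler_sum => j; rewrite mem_index_iota => hj.
  apply: le_trans (_ : \sum_(q <- split_primes b (16 ^ j).+1 (16 ^ j.+1).+1) ((16 ^ j.+1)%:R)^-1 <= _); last first.
    rewrite big_seq [leRHS]big_seq; apply: ler_sum => q.
    rewrite mem_split_primes ltnS => /and3P[pq _ /andP[_ qj]].
    exact: inv_nat_le (prime_gt0 pq) qj.
  rewrite big_const_seq count_predT iter_addr_0 -split_countE.
  rewrite -[_ *+ split_count _ _]mulr_natl.
  rewrite ler_pdivlMr ?ltr0n ?expn_gt0 // mulrC ler_pdivrMr; last first.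
    by rewrite -natrM ltr0n muln_gt0 muln_gt0 k0.
  rewrite -!natrM ler_nat expnS; have := h j hj; case/andP: hj => _ hj.
  have -> : (split_count j b * (256 * (u.+1 * k)) = 16 * (split_count j b * (16 * (u.+1 * k))))%N by ring.
  rewrite leq_mul2l /= => h1; apply: leq_trans h1 _.
  by rewrite leq_mul2l leq_mul2l hj !orbT.
apply: (@ler_pairs_sum R _ _ _ _ (fun j => split_primes b (16 ^ j).+1 (16 ^ j.+1).+1) t (fun j q => q)
  (fun q => q%:R^-1)).
- exact: iota_uniq.
- by move=> j _; rewrite filter_uniq // iota_uniq.
- move=> j q; rewrite mem_index_iota !mem_split_primes => /andP[j1 j2] /and3P[pq sq /andP[q1 q2]].
  rewrite pq sq /=; apply/andP; split.
    by apply: leq_trans (ltnW q1); rewrite leq_exp2l.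
  rewrite ltn_neqAle; apply/andP; split.
    apply: contraTneq pq => ->.
    case e : (u.+1 * k)%N => [|m]; first by move: j2; rewrite e.
    apply/primeP => -[_ /(_ 2%N)]; rewrite expnS -[16%N]/(2 * 8)%N -mulnA dvdn_mulr // => /(_ isT).
    by have : (0 < 16 ^ m)%N; [rewrite expn_gt0|lia].
  by rewrite ltnS in q2; apply: leq_trans q2 _; rewrite leq_exp2l.
- move=> j q j' q' _ + _ + E; rewrite -{}E !mem_split_primes => /and3P[_ _ /andP[q1 q2]] /and3P[_ _ /andP[q3 q4]].
  split => //; rewrite !ltnS in q2 q4.
  have a1 : (j < j'.+1)%N by rewrite -(@ltn_exp2l 16) // (leq_trans q1 q4).
  have a2 : (j' < j.+1)%N by rewrite -(@ltn_exp2l 16) // (leq_trans q3 q2).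
  by clear -a1 a2; lia.
- by move=> q _; rewrite invr_ge0.
Qed.

Lemma lg_bounds m lo hi : (16 ^ lo <= m < 16 ^ hi)%N ->
  (lo <= trunc_log 16 m < hi)%N.
Proof.
case/andP=> h1 h2; rewrite trunc_log_max //=.
have m0 : (0 < m)%N by apply: leq_trans h1; rewrite expn_gt0.
by rewrite -(@ltn_exp2l 16) // (leq_ltn_trans (trunc_logP _ _)).
Qed.

Definition prime_factors_lt (B m : nat) := forall p, prime p -> (p %| m)%N -> (p < B)%N.

Lemma prime_factors_lt_mul B q m : prime q -> (q < B)%N ->
  prime_factors_lt B m -> prime_factors_lt B (q * m).
Proof.
move=> pq qB h p pp; rewrite Euclid_dvdM // dvdn_prime2 // => /orP[/eqP->//|].
exact: h.
Qed.

Lemma prime_factors_lt_small B m : (0 < m < B)%N -> prime_factors_lt B m.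
Proof. by case/andP=> m0 mB p _ /(dvdn_leq m0) pm; exact: leq_ltn_trans pm mB. Qed.

(** The prime q is the only prime factor of the product that is not below B, so the product
    determines it. Three applications recover all factors of the products counted below. *)
Lemma cancel_top_prime B q q' m m' : prime q -> prime q' -> (B <= q)%N ->
  (B <= q')%N -> prime_factors_lt B m -> prime_factors_lt B m' ->
  (q * m = q' * m')%N -> q = q' /\ m = m'.
Proof.
move=> pq pq' Bq Bq' hm hm' e; have qq : q = q'.
  have : (q %| q' * m')%N by rewrite -e dvdn_mulr.
  rewrite Euclid_dvdM // dvdn_prime2 // => /orP[/eqP//|/(hm' _ pq)].
  by rewrite ltnNge Bq.
split => //; move/eqP: e; rewrite qq eqn_pmul2l ?prime_gt0 //; exact: eqP.
Qed.

Lemma oddsqf_all_mul_top (P : pred nat) B q m : prime q -> P q -> (2 < B)%N ->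
  (B <= q)%N -> prime_factors_lt B m -> oddsqf_all P m -> oddsqf_all P (q * m)%N.
Proof.
move=> pq Pq B2 Bq hm om; rewrite oddsqf_all_mul_prime // Pq om /= andbT.
apply/andP; split; first by case/even_prime: pq => // q2; move: Bq; rewrite q2 leqNgt B2.
by apply/negP => /(hm _ pq); rewrite ltnNge Bq.
Qed.

Lemma sum_exponents a b c j :
  (a + b + c + 4 + j = j.+1 + (c.+1 + (b.+1 + a.+1)))%N.
Proof. by lia. Qed.

(* The counted numbers are a q1 q2 q3 with a < 16^k and q1 < q2 < q3 split primes,
   q3 running over the block [16^j, 16^(j+1)] that makes the product slightly
   smaller than 16^(30 k). Three primes are used because the variance bound
   controls blocks only up to the square root of 16^(30 k); the factorization
   is unique since the three primes have separated ranges. *)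
Lemma split_products_count (R : realType) b k : (0 < k)%N ->
  (forall j, 7 * k <= j <= 14 * k -> 16 ^ j <= split_count j b * (16 * j.+1))%N ->
  (16 ^ (30 * k))%:R / ((16 ^ 4)%:R * (16 * (15 * k))%:R) *
    (recip_sum R (oddsqf_all (splits b)) (16 ^ k).-1 *
     ((256 * 8%:R)^-1 * (256 * 10%:R)^-1)) <=
  (size (rng (oddsqf_all (splits b)) (16 ^ (30 * k)).-1))%:R :> R.
Proof.
move=> k0 h; set M := (16 ^ (30 * k))%N.
set A := rng (oddsqf_all (splits b)) (16 ^ k).-1.
set Q1 := split_primes b (16 ^ (7 * k)) (16 ^ (8 * k)).
set Q2 := split_primes b (16 ^ (9 * k)) (16 ^ (10 * k)).
set t := rng _ M.-1.
set c := (16 ^ 4)%N.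
have c0 : (0 < c)%N by rewrite expn_gt0.
set K : R := M%:R / _.
have K0 : 0 <= K by rewrite /K divr_ge0 // mulr_ge0.
pose S (Q : seq nat) : R := \sum_(q <- Q) q%:R^-1.
have S1 : (256 * 8%:R)^-1 <= S Q1.
  by apply: recip_split_primes => // j hj; apply: h; clear -hj; lia.
have S2 : (256 * 10%:R)^-1 <= S Q2.
  by apply: recip_split_primes => // j hj; apply: h; clear -hj; lia.
pose lg := trunc_log 16.
(* The 4 compensates for four rounded logarithms, those of a, q1, q2 and q3: the product then lies
   between 16^(30 k - 4) and 16^(30 k). *)
pose j3 (z : nat * (nat * nat)) := (30 * k - 4 - lg z.1 - lg z.2.1 - lg z.2.2)%N.
pose s := [seq (a, x) | a <- A, x <- [seq (q1, q2) | q1 <- Q1, q2 <- Q2]].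
pose s3 z := split_primes b (16 ^ (j3 z)).+1 (16 ^ (j3 z).+1).+1.
have sP z : z \in s -> exists a q1 q2, [/\ z = (a, (q1, q2)), a \in A, q1 \in Q1 & q2 \in Q2].
  case/allpairsPdep => a [x [aA /allpairsPdep[q1 [q2 [h1 h2 ->]]] ->]].
  by exists a, q1, q2.
have AP a : a \in A -> [/\ oddsqf_all (splits b) a, (0 < a)%N, (a < 16 ^ k)%N & (lg a < k)%N].
  rewrite mem_rng => /and3P[oa a0 ak].
  have ak' : (a < 16 ^ k)%N by rewrite -(prednK (expn_gt0 16 k : 0 < 16 ^ k)%N) ltnS.
  have : (16 ^ 0 <= a < 16 ^ k)%N by rewrite a0 ak'.
  by move/lg_bounds => /andP[_ ->].
have QP u v q : q \in split_primes b (16 ^ (u * k)) (16 ^ (v * k)) ->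
   [/\ prime q, splits b q, (16 ^ (u * k) <= q)%N, (q < 16 ^ (v * k))%N & (u * k <= lg q < v * k)%N].
  by rewrite mem_split_primes => /and3P[-> -> /andP[q1 q2]]; split => //; apply: lg_bounds; rewrite q1 q2.
(* As lg a < k, lg q1 < 8k and lg q2 < 10k, the third block starts above q2; as lg q1 >= 7k and lg
   q2 >= 9k, its index stays in the range j <= 14k of the hypothesis. *)
have jP z : z \in s -> [/\ (10 * k <= j3 z)%N, ((j3 z).+1 <= 15 * k)%N, (j3 z <= 14 * k)%N &
    (lg z.1 + lg z.2.1 + lg z.2.2 + 4 + j3 z = 30 * k)%N].
  case/sP => a [q1 [q2 [-> /AP[_ _ _ la] /QP[_ _ _ _ l1] /QP[_ _ _ _ l2]]]].
  by rewrite /j3 /=; clear -la l1 l2 k0; split; lia.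
apply: le_trans (_ : \sum_(z <- s) K * (z.1%:R^-1 * (z.2.1%:R^-1 * z.2.2%:R^-1)) <= _).
  rewrite -mulr_sumr; apply: ler_wpM2l => //.
  have -> : \sum_(z <- s) (z.1%:R^-1 * (z.2.1%:R^-1 * z.2.2%:R^-1)) =
      recip_sum R (oddsqf_all (splits b)) (16 ^ k).-1 * (S Q1 * S Q2) :> R.
    rewrite big_allpairs_dep recip_sumE mulr_suml; apply: eq_bigr => a _ /=.
    rewrite -mulr_sumr; congr (_ * _); rewrite big_allpairs_dep /= mulr_suml.
    by apply: eq_bigr => q1 _ /=; rewrite mulr_sumr.
  apply: ler_wpM2l; first exact: recip_sum_ge0.
  by apply: (ler_pM _ _ S1 S2); rewrite invr_ge0 -natrM ler0n.
apply: le_trans (_ : \sum_(z <- s) \sum_(q3 <- s3 z) (1 : R) <= _).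
  rewrite big_seq [leRHS]big_seq; apply: ler_sum => z zs.
  have [j1 j2 j4 jE] := jP _ zs.
  rewrite big_const_seq count_predT iter_addr_0 -split_countE -/(_%:R).
  case/sP: zs => a [q1 [q2 [zE aA q1Q q2Q]]]; move: j1 j2 j4 jE; rewrite zE /=.
  set j := j3 _ => j1 j2 j4 jE.
  have [oa a0 _ _] := AP _ aA; have [p1 _ _ _ _] := QP _ _ _ q1Q; have [p2 _ _ _ _] := QP _ _ _ q2Q.
  have hj : (16 ^ j <= split_count j b * (16 * (15 * k)))%N.
    apply: leq_trans (h j _) _; first by rewrite j4 andbT (leq_trans _ j1) // leq_mul2r orbT.
    by rewrite leq_mul2l leq_mul2l j2 !orbT.
  have hM : (M <= (split_count j b * (c * (16 * (15 * k)))) * (a * (q1 * q2)))%N.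
    rewrite /M -jE !expnD -/c.
    have l0 : (16 ^ lg a <= a)%N by apply: trunc_logP.
    have l1 : (16 ^ lg q1 <= q1)%N by apply: trunc_logP => //; exact: prime_gt0.
    have l2 : (16 ^ lg q2 <= q2)%N by apply: trunc_logP => //; exact: prime_gt0.
    rewrite [leqRHS]mulnC [leqLHS](_ : _ = (16 ^ lg a * (16 ^ lg q1 * 16 ^ lg q2)) * (c * 16 ^ j))%N; last by ring.
    apply: leq_mul; first by rewrite !leq_mul.
    by rewrite mulnCA leq_mul2l hj orbT.
  have a0' : (0 : R) < a%:R by rewrite ltr0n.
  have q10 : (0 : R) < q1%:R by rewrite ltr0n prime_gt0.
  have q20 : (0 : R) < q2%:R by rewrite ltr0n prime_gt0.
  rewrite -!invfM -!natrM ler_pdivrMr; last by rewrite ltr0n !muln_gt0 a0 !prime_gt0.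
  rewrite /K -natrM ler_pdivrMr; last first.
    by rewrite ltr0n muln_gt0 c0 !muln_gt0 k0.
  by rewrite -!natrM ler_nat mulnAC.
have -> : (size t)%:R = \sum_(C <- t) (1 : R).
  by rewrite big_const_seq count_predT iter_addr_0.
have B2 u : (0 < u)%N -> (2 < 16 ^ (u * k))%N.
  move=> u0; apply: leq_trans (_ : 16 ^ 1 <= _)%N => //.
  by rewrite leq_exp2l // muln_gt0 u0.
have mono u v m : (m < 16 ^ (u * k))%N -> (u <= v)%N -> (m < 16 ^ (v * k))%N.
  by move=> hm uv; apply: leq_trans hm _; rewrite leq_exp2l // leq_mul2r uv orbT.
have low a q1 q2 : a \in A -> q1 \in Q1 -> q2 \in Q2 ->
   [/\ prime_factors_lt (16 ^ (7 * k)) a, prime_factors_lt (16 ^ (9 * k)) (q1 * a) &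
       prime_factors_lt (16 ^ (10 * k)) (q2 * (q1 * a))].
  move=> /AP[_ a0 ak _] /QP[p1 _ _ h1 _] /QP[p2 _ _ h2 _].
  have sm v : (0 < v)%N -> prime_factors_lt (16 ^ (v * k)) a.
    move=> v0; apply: prime_factors_lt_small; rewrite a0 (@mono 1%N) ?mul1n //.
  split; first exact: sm.
    by apply: prime_factors_lt_mul => //; [apply: mono h1 _|exact: sm].
  apply: prime_factors_lt_mul => //; apply: prime_factors_lt_mul => //; [exact: mono h1 _|exact: sm].
have q3P z q : z \in s -> q \in s3 z -> [/\ prime q, splits b q, (16 ^ (10 * k) <= q)%N & (q <= 16 ^ (j3 z).+1)%N].
  move=> /jP[j1 _ _ _]; rewrite mem_split_primes ltnS => /and3P[pq sq /andP[q1 q2]].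
  by split => //; apply: leq_trans (ltnW q1); rewrite leq_exp2l.
apply: (@ler_pairs_sum R _ _ _ s s3 t (fun z q => q * (z.2.2 * (z.2.1 * z.1)))%N (fun=> 1)) => //.
- apply: allpairs_uniq_dep; first exact: rng_uniq.
    move=> a _; apply: allpairs_uniq_dep; try by move=> *; rewrite filter_uniq // iota_uniq.
    by move=> [x y] [x' y'] _ _ /= [-> ->].
  by move=> [x y] [x' y'] _ _ /= [-> ->].
- by move=> z _; rewrite filter_uniq // iota_uniq.
- move=> z q zs; have [j1 j2 j4 jE] := jP _ zs => /(q3P _ _ zs).
  case/sP: zs jE j1 => a [q1 [q2 [-> aA h1 h2]]] /= jE j1 [pq sq qlo qhi].
  have [oa a0 ak _] := AP _ aA; have [l0 l1 l2] := low _ _ _ aA h1 h2.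
  have [p1 s1 lo1 hi1 _] := QP _ _ _ h1; have [p2 s2 lo2 hi2 _] := QP _ _ _ h2.
  have C0 : (0 < q * (q2 * (q1 * a)))%N by rewrite !muln_gt0 a0 (prime_gt0 pq) (prime_gt0 p1) (prime_gt0 p2).
  rewrite mem_rng C0 /=; apply/andP; split.
    apply: oddsqf_all_mul_top l2 _ => //; first exact: B2.
    apply: oddsqf_all_mul_top l1 _ => //; first exact: B2.
    by apply: oddsqf_all_mul_top l0 _ => //; exact: B2.
  rewrite -ltnS prednK ?expn_gt0 // /M -jE.
  have t0 := trunc_log_ltn a (isT : 1 < 16)%N.
  have t1 := trunc_log_ltn q1 (isT : 1 < 16)%N.
  have t2 := trunc_log_ltn q2 (isT : 1 < 16)%N.
  set j := j3 _ in qhi jE *.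
  rewrite sum_exponents.
  rewrite !(expnD 16 _ (_ + _)) (expnD 16 (lg q1).+1).
  have x0 : (q1 * a < 16 ^ (lg q1).+1 * 16 ^ (lg a).+1)%N by apply: ltn_mul.
  have x1 : (q2 * (q1 * a) < 16 ^ (lg q2).+1 * (16 ^ (lg q1).+1 * 16 ^ (lg a).+1))%N by apply: ltn_mul.
  apply: leq_ltn_trans (leq_mul qhi (leqnn _)) _.
  by rewrite ltn_mul2l expn_gt0.
- move=> z q z' q' zs qs zs' qs'; move: (q3P _ _ zs qs) (q3P _ _ zs' qs').
  case/sP: zs => a [q1 [q2 [-> aA h1 h2]]]; case/sP: zs' => a' [q1' [q2' [-> aA' h1' h2']]] /=.
  move=> [pq _ lo _] [pq' _ lo' _].
  have [l0 l1 l2] := low _ _ _ aA h1 h2; have [l0' l1' l2'] := low _ _ _ aA' h1' h2'.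
  have [p1 _ lo1 _ _] := QP _ _ _ h1; have [p2 _ lo2 _ _] := QP _ _ _ h2.
  have [p1' _ lo1' _ _] := QP _ _ _ h1'; have [p2' _ lo2' _ _] := QP _ _ _ h2'.
  case/(cancel_top_prime pq pq' lo lo' l2 l2') => -> /(cancel_top_prime p2 p2' lo2 lo2' l1 l1').
  by case=> -> /(cancel_top_prime p1 p1' lo1 lo1' l0 l0') [-> ->].
Qed.

Definition split_ok k b :=
  all (fun j => 16 ^ j <= split_count j b * (16 * j.+1))%N (iota (7 * k) (7 * k).+1).

Lemma split_okP k b j : split_ok k b -> (7 * k <= j <= 14 * k)%N ->
  (16 ^ j <= split_count j b * (16 * j.+1))%N.
Proof. by move=> /allP h hj; apply: h; rewrite mem_iota; clear -hj; lia. Qed.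

(** Used with E = 16^j and G = 16^(2k). Relative to E^2 N each term of the variance bound saves a
    factor G, the first because 2k <= j, the second because 2j + 2k <= 30k. The second condition is
    what limits the blocks to j <= 14k. *)
Lemma rare_arith E N G c d w m : (0 < E)%N -> (G <= E)%N -> (E ^ 2 * G <= N)%N ->
  (0 < d * (16 + w))%N -> (d * (16 + w) * m <= G)%N ->
  (c * E ^ 2 <= d * (16 * E * N + w * E ^ 4) -> c * m <= N)%N.
Proof.
move=> E0 GE EGN D0 DG h; set D := (d * (16 + w))%N in D0 DG.
have E20 : (0 < E ^ 2)%N by rewrite expn_gt0 E0.
have h1 : ((16 * E * N + w * E ^ 4) * G <= (16 + w) * (E ^ 2 * N))%N.
  have -> : ((16 + w) * (E ^ 2 * N) = (16 * E * N) * E + w * E ^ 2 * N)%N by ring.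
  have -> : ((16 * E * N + w * E ^ 4) * G = (16 * E * N) * G + w * E ^ 2 * (E ^ 2 * G))%N by ring.
  by rewrite leq_add // leq_mul2l ?GE ?EGN orbT.
have h2 : (c * G <= D * N)%N.
  rewrite -(leq_pmul2r E20) mulnAC.
  apply: leq_trans (leq_mul h (leqnn G)) _.
  rewrite -mulnA; apply: leq_trans (leq_mul (leqnn d) h1) _.
  by rewrite /D (_ : d * ((16 + w) * (E ^ 2 * N)) = d * (16 + w) * N * E ^ 2)%N //; ring.
rewrite -(leq_pmul2l D0); apply: leq_trans h2.
by rewrite mulnCA leq_mul2l DG orbT.
Qed.

(** Polynomial factors against 16^(2k): in powers of 2 the left side is at most 2^(43 + 3k) and the
    right side is 2^(8k), whence k >= 9. *)
Lemma split_fail_const k j : (9 <= k)%N -> (j.+1 <= 15 * k)%N ->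
  (16 * (4 * j.+1) ^ 2 * (16 + 16 ^ 4) * (100 * (7 * k).+1) <= 16 ^ (2 * k))%N.
Proof.
move=> k9 jk.
have k2 : (k <= 2 ^ k)%N by rewrite ltnW // ltn_expl.
have e16 m : (16 ^ m = 2 ^ (4 * m))%N by rewrite expnM.
have a1 : (16 * (4 * j.+1) ^ 2 <= 2 ^ 4 * (2 ^ 12 * (2 ^ k) ^ 2))%N.
  have -> : (2 ^ 12 = (2 ^ 6) ^ 2)%N by rewrite -expnM.
  rewrite -expnMn; apply: leq_mul => //; rewrite leq_exp2r //.
  apply: (@leq_trans (2 ^ 6 * k)); last by rewrite leq_mul2l k2 orbT.
  by have -> : (2 ^ 6 = 64)%N by []; clear -jk; lia.
have a2 : (16 + 16 ^ 4 <= 2 ^ 17)%N.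
  rewrite e16 [(2 ^ 17)%N]expnS -[(4 * 4)%N]/16%N mul2n -addnn leq_add2r.
  by rewrite -[16%N]/(2 ^ 4)%N leq_exp2l.
have a3 : (100 * (7 * k).+1 <= 2 ^ 10 * 2 ^ k)%N.
  apply: (@leq_trans (2 ^ 10 * k)); last by rewrite leq_mul2l k2 orbT.
  have -> : (2 ^ 10 = 1024)%N by rewrite -[10%N]/(5 + 5)%N expnD; lia.
  by clear -k9; lia.
apply: leq_trans (leq_mul (leq_mul a1 a2) a3) _.
rewrite -expnM -!expnD e16 leq_exp2l //; clear -k9; lia.
Qed.

(** Union bound over the 7k + 1 blocks, each failing for at most N / (100 (7k + 1)) values of x. *)
Lemma split_fail_rare (R : realType) k N : (9 <= k)%N ->
  (16 ^ (30 * k) <= N < 16 ^ (30 * k.+1))%N ->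
  (count (fun x => (0 < x) && ~~ split_ok k x) (iota 0 N) * 100 <= N)%N.
Proof.
move=> k9 /andP[N1 N2].
have N0 : (0 < N)%N by apply: leq_trans N1; rewrite expn_gt0.
pose few j := fun x => ((0 < x) && (split_count j x * (16 * j.+1) < 16 ^ j))%N.
have each j : (7 * k <= j <= 14 * k)%N -> (count (few j) (iota 0 N) * (100 * (7 * k).+1) <= N)%N.
  move=> /andP[j1 j2].
  have j3 : (3 <= j)%N by clear -k9 j1; lia.
  have lnN : 4 * ln (N%:R : R) <= (16 ^ j)%:R.
    have h := le_trans (ln_nat_le R N0 (ltnW N2)) (ln16_le R (30 * k.+1)).
    apply: le_trans (_ : (4 * (4 * (30 * k.+1)))%:R <= _).
      by rewrite natrM ler_wpM2l // natrM.
    rewrite ler_nat.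
    have k2 : (k.+1 <= 2 ^ k)%N by rewrite ltn_expl.
    have k3 : (2 ^ k * 2 ^ 9 <= 16 ^ j)%N.
      rewrite -expnD -[16%N]/(2 ^ 4)%N -expnM leq_exp2l //; clear -k9 j1; lia.
    apply: leq_trans k3; have -> : (2 ^ 9 = 512)%N by rewrite -[9%N]/(5 + 4)%N expnD; lia.
    by clear -k2; lia.
  have := few_split_rare j3 lnN.
  rewrite -/(few j) -(natrM _ 4) -!natrX -!natrM -!natrD -!natrM ler_nat => h.
  apply: (@rare_arith (16 ^ j) N (16 ^ (2 * k)) _ (16 * (4 * j.+1) ^ 2) (16 ^ 4)).
  - by rewrite expn_gt0.
  - by rewrite leq_exp2l //; clear -j1; lia.
  - by rewrite -expnM -expnD (leq_trans _ N1) // leq_exp2l //; clear -j2; lia.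
  - by rewrite !muln_gt0 addn_gt0.
  - by apply: split_fail_const => //; clear -j2 k9; lia.
  - by rewrite (expnS 16 j) (expnMn 16) in h.
have cnt : (count (fun x => (0 < x) && ~~ split_ok k x) (iota 0 N) <=
    \sum_(j <- iota (7 * k) (7 * k).+1) count (few j) (iota 0 N))%N.
  rewrite count_sum; under [leqRHS]eq_bigr do rewrite count_sum.
  rewrite exchange_big; apply: leq_sum => x _.
  have [/andP[x0 /allPn[j jI]]|//] := boolP ((0 < x) && ~~ split_ok k x)%N.
  rewrite -ltnNge => hj; have fx : few j x by rewrite /few x0 hj.
  by rewrite (bigD1_seq j) ?iota_uniq // fx.
rewrite -(leq_pmul2r (_ : 0 < (7 * k).+1)%N) //.
apply: leq_trans (_ : (\sum_(j <- iota (7 * k) (7 * k).+1) count (few j) (iota 0 N)) * (100 * (7 * k).+1) <= _)%N.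
  by rewrite -mulnA leq_mul2r cnt orbT.
have -> : (N * (7 * k).+1 = \sum_(j <- iota (7 * k) (7 * k).+1) N)%N.
  by rewrite big_const_seq count_predT size_iota iter_addn_0.
rewrite big_distrl.
rewrite big_seq [leqRHS]big_seq; apply: leq_sum => j; rewrite mem_iota => hj.
by apply: each; clear -hj; lia.
Qed.

(* By Markov's inequality the sum over products of nonsplit primes is O(sqrt k)
   for most x; since the two sums multiply to at least a constant times k, the
   sum over products of split primes is then at least of order sqrt k. *)
Lemma nonsplit_sum_large_rare (R : realType) k N : (0 < k)%N -> (16 ^ k <= N)%N ->
  (count (fun x => 1200 * Num.sqrt (k%:R : R) <
     recip_sum R (oddsqf_all (predC (splits x))) (16 ^ k).-1) (iota 0 N))%:R * 100
  <= (N%:R : R).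
Proof.
move=> k0 kN; set X := (16 ^ k).-1.
have k0' : (0 : R) < Num.sqrt k%:R by rewrite sqrtr_gt0 ltr0n.
pose P (p : nat) : pred nat := fun x => rho p x%:Z != 2.
have rP : residual P.
  move=> p x; rewrite /P (@rho_congr p _ x%:Z) //.
  by have := rho_residual p 1 x; rewrite !mul1r.
have XN : (X <= N)%N by apply: leq_trans kN; exact: leq_pred.
have := @avg_recip_sum R P N X rP count_rho_neq2 XN.
set S := \sum_(_ <- _) _ => hS.
have X1 : X.+1 = (16 ^ k)%N by rewrite prednK // expn_gt0.
have X0 : (0 < X)%N.
  by rewrite -ltnS X1 (leq_trans (_ : 1 < 16 ^ 1)%N) // leq_exp2l.
have hh : Num.sqrt (recip_sum R predT (X * X)) <= 3 * Num.sqrt (k%:R : R).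
  have -> : 3 = Num.sqrt (9 : R).
    have -> : 9 = 3 ^+ 2 :> R by ring.
    by rewrite sqrtr_sqr ger0_norm.
  rewrite -sqrtrM // ler_wsqrtr //.
  apply: le_trans (@harm_le R _ (_ : 0 < X * X)%N) _; first by rewrite muln_gt0 X0.
  have l1 : ln (X%:R : R) <= 4 * k%:R.
    by apply: le_trans (ln16_le R k); apply: ln_nat_le => //; rewrite -X1.
  have k1 : (1 : R) <= k%:R by rewrite ler1n.
  by rewrite natrM lnM ?posrE ?ltr0n //; lra.
(* The mean is at most 12 sqrt(k); Markov's inequality is applied at 100 times this value. *)
have {}hS : S <= N%:R * (12 * Num.sqrt (k%:R : R)).
  apply: le_trans hS _; have := ler_wpM2l (_ : 0 <= 4 * N%:R :> R) hh.
  by rewrite mulr_ge0 // => /(_ isT); lra.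
set c := count _ _.
have : c%:R * (1200 * Num.sqrt (k%:R : R)) <= S.
  rewrite /c -sum1_count natr_sum mulr_suml big_mkcond; apply: ler_sum => x _.
  case: ifP => [/ltW h|_]; last exact: recip_sum_ge0.
  by rewrite mul1r.
move=> h; have {h} := le_trans h hS.
have -> : c%:R * (1200 * Num.sqrt (k%:R : R)) = (c%:R * 100) * (12 * Num.sqrt k%:R).
  have -> : 1200 = 100 * 12%:R :> R by rewrite -natrM.
  by rewrite -!mulrA.
by rewrite ler_pM2r // mulr_gt0.
Qed.

Lemma split_sum_ge (R : realType) k x : (0 < k)%N ->
  recip_sum R (oddsqf_all (predC (splits x))) (16 ^ k).-1 <= 1200 * Num.sqrt (k%:R : R) ->
  Num.sqrt (k%:R : R) <= 1800 * recip_sum R (oddsqf_all (splits x)) (16 ^ k).-1.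
Proof.
move=> k0; set X := (16 ^ k).-1; set G := recip_sum _ _ _ => hG; set H := recip_sum _ _ _.
have X1 : X.+1 = (16 ^ k)%N by rewrite prednK // expn_gt0.
have k0' : (0 : R) < Num.sqrt k%:R by rewrite sqrtr_gt0 ltr0n.
have H0 : 0 <= H by exact: recip_sum_ge0.
(* The harmonic sum is at least ln 16^k = 4k ln 2 >= 2k; the 3 is the cost of passing to odd
   squarefree integers. *)
have h1 : 2 * k%:R <= 3 * (H * G).
  apply: le_trans (_ : ln (X.+1%:R : R) <= _).
    rewrite X1; have -> : ((16 ^ k)%N%:R : R) = 2 ^+ (4 * k) by rewrite natrX exprM; congr (_ ^+ _); ring.
    rewrite lnXn // -[ln 2 *+ _]mulr_natl natrM.
    have k1 : (0 : R) <= k%:R by [].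
    have := ler_wpM2l k1 (ln2_ge R); lra.
  apply: le_trans (harm_ge R X) _; apply: le_trans (harm_le_oddsqf R X) _.
  by apply: ler_wpM2l => //; exact: recip_sum_split.
have kE : (k%:R : R) = Num.sqrt k%:R * Num.sqrt k%:R by rewrite -expr2 sqr_sqrtr.
have h2 : H * G <= H * (1200 * Num.sqrt k%:R) by apply: ler_wpM2l.
rewrite -(ler_pM2r k0') -kE.
have -> : 1800 = 3 / 2 * 1200 :> R.
  have -> : 1200 = 2 * 600%:R :> R by rewrite -natrM.
  have -> : 1800 = 3 * 600%:R :> R by rewrite -natrM.
  by move: (600%:R : R) => y; field.
move: h1 h2; move: (1200 : R) (Num.sqrt _) (H * G) => c s z h1 h2.
lra.
Qed.

(** * Ideal classes of imaginary quadratic fields *)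

Definition subfield_set (K : set algC) := [/\ K 1,
  (forall x y, K x -> K y -> K (x - y)), (forall x y, K x -> K y -> K (x * y)) &
  (forall x, K x -> K x^-1)].

Section Ideals.
Context (K : set algC) (KF : subfield_set K).
Local Notation O := (ring_of_integers K).
Local Notation "I ** J" := (ideal_mul I J) (at level 40, left associativity).
Local Notation "I ^^ m" := (ideal_exp K I m) (at level 30).
Implicit Types I J L : set algC.

Definition scale (a : algC) I : set algC := [set a * x | x in I].

Lemma K1 : K 1. Proof. by case: KF. Qed.
Lemma KB x y : K x -> K y -> K (x - y). Proof. by case: KF => _ + _ _; apply. Qed.
Lemma KM x y : K x -> K y -> K (x * y). Proof. by case: KF => _ _ + _; apply. Qed.
Lemma KV x : K x -> K x^-1. Proof. by case: KF => _ _ _; apply. Qed.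
Lemma K0 : K 0. Proof. by rewrite -(subrr 1); apply: KB; exact: K1. Qed.
Lemma KN x : K x -> K (- x). Proof. by move=> Kx; rewrite -sub0r; exact: (KB K0). Qed.
Lemma KD x y : K x -> K y -> K (x + y).
Proof. by move=> Kx Ky; rewrite -[y]opprK; apply: KB => //; exact: KN. Qed.
Lemma KX x m : K x -> K (x ^+ m).
Proof. by move=> Kx; elim: m => [|m IH]; [exact: K1|rewrite exprS; exact: KM]. Qed.

Lemma O1 : O 1. Proof. by split; [exact: K1|exact: rpred1]. Qed.
Lemma O0 : O 0. Proof. by split; [exact: K0|exact: rpred0]. Qed.
Lemma OB x y : O x -> O y -> O (x - y).
Proof. by case=> Kx Ax [Ky Ay]; split; [exact: KB|exact: rpredB]. Qed.
Lemma OD x y : O x -> O y -> O (x + y).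
Proof. by case=> Kx Ax [Ky Ay]; split; [exact: KD|exact: rpredD]. Qed.
Lemma ON x : O x -> O (- x).
Proof. by case=> Kx Ax; split; [exact: KN|rewrite rpredN]. Qed.
Lemma OM x y : O x -> O y -> O (x * y).
Proof. by case=> Kx Ax [Ky Ay]; split; [exact: KM|exact: rpredM]. Qed.
(** An O-submodule, with no condition on denominators or nonvanishing: enough for the formal rules
    of multiplication and scaling. *)
Definition omod I := [/\ I 0, (forall x y, I x -> I y -> I (x + y)) &
  (forall a x, O a -> I x -> I (a * x))].

Lemma omodN I x : omod I -> I x -> I (- x).
Proof. by case=> _ _ h Ix; rewrite -mulN1r; apply: h => //; apply: ON; exact: O1. Qed.

Lemma omod_O : omod O.
Proof. by split; [exact: O0|exact: OD|exact: OM]. Qed.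

Lemma fractional_omod I : fractional_ideal K I -> omod I.
Proof.
case=> IK [x Ix _] IB IM _; have I0 : I 0 by rewrite -(subrr x); exact: IB.
split => // y z Iy Iz; rewrite -[z]opprK; apply: (IB) => //.
by rewrite -sub0r; exact: IB.
Qed.

Lemma ideal_mul_mem I J x y : I x -> J y -> (I ** J) (x * y).
Proof.
move=> Ix Jy; exists [:: (x, y)]; last by rewrite big_seq1.
by move=> u; rewrite inE => /eqP ->.
Qed.

(** Universal property of the product of ideals; most inclusions below follow from it by a suitable
    choice of [M]. *)
Lemma ideal_mul_min I J (M : set algC) : M 0 -> (forall x y, M x -> M y -> M (x + y)) ->
  (forall x y, I x -> J y -> M (x * y)) -> I ** J `<=` M.
Proof.
move=> M0 MD h _ [s hs ->]; elim: s hs => [|u s IH] hs; first by rewrite big_nil.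
rewrite big_cons; apply: MD; last by apply: IH => v vs; apply: hs; rewrite inE vs orbT.
by have [] := hs u (mem_head _ _); exact: h.
Qed.

Lemma ideal_mul0 I J : (I ** J) 0.
Proof. by exists [::]; rewrite ?big_nil. Qed.

Lemma ideal_mulD I J x y : (I ** J) x -> (I ** J) y -> (I ** J) (x + y).
Proof.
move=> [s hs ->] [t ht ->]; exists (s ++ t); last by rewrite big_cat.
by move=> u; rewrite mem_cat => /orP[/hs|/ht].
Qed.

Lemma omod_mul I J : omod I -> omod (I ** J).
Proof.
move=> [I0 ID IM]; split; [exact: ideal_mul0|exact: ideal_mulD|].
move=> a x Oa; apply: (@ideal_mul_min I J (fun z => (I ** J) (a * z))).
- by rewrite mulr0; exact: ideal_mul0.
- by move=> y z hy hz; rewrite mulrDr; exact: ideal_mulD.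
- by move=> y z Iy Jz; rewrite mulrA; apply: ideal_mul_mem => //; exact: IM.
Qed.

Lemma ideal_mulC I J : I ** J = J ** I.
Proof.
apply/seteqP; split; apply: ideal_mul_min; try exact: ideal_mul0; try exact: ideal_mulD;
by move=> x y Ix Jy; rewrite mulrC; exact: ideal_mul_mem.
Qed.

Lemma ideal_mulA_sub I J L : (I ** J) ** L `<=` I ** (J ** L).
Proof.
apply: ideal_mul_min; [exact: ideal_mul0|exact: ideal_mulD|].
move=> x z hx Lz; move: x hx; apply: (@ideal_mul_min I J (fun u => (I ** (J ** L)) (u * z))).
- by rewrite mul0r; exact: ideal_mul0.
- by move=> x y hx hy; rewrite mulrDl; exact: ideal_mulD.
- by move=> x y Ix Jy; rewrite -mulrA; apply: ideal_mul_mem => //; exact: ideal_mul_mem.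
Qed.

Lemma ideal_mulA I J L : I ** (J ** L) = (I ** J) ** L.
Proof.
apply/seteqP; split; last exact: ideal_mulA_sub.
rewrite [in X in X `<=` _]ideal_mulC [J ** L]ideal_mulC.
apply: subset_trans (@ideal_mulA_sub L J I) _.
by rewrite ideal_mulC [J ** I]ideal_mulC.
Qed.

Lemma ideal_mulO I : omod I -> O ** I = I.
Proof.
move=> [I0 ID IM]; apply/seteqP; split; first exact: ideal_mul_min.
by move=> x Ix; rewrite -[x]mul1r; apply: ideal_mul_mem => //; exact: O1.
Qed.

Lemma ideal_expS I m : I ^^ m.+1 = I ** I ^^ m. Proof. by []. Qed.

Lemma omod_exp I m : omod I -> omod (I ^^ m).
Proof. by move=> oI; case: m => [|m]; [exact: omod_O|exact: omod_mul]. Qed.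

Lemma ideal_exp1 I : omod I -> I ^^ 1 = I.
Proof. by move=> oI; rewrite /ideal_exp /= ideal_mulC ideal_mulO. Qed.

Lemma ideal_expD I a b : omod I -> I ^^ (a + b) = I ^^ a ** I ^^ b.
Proof.
move=> oI; elim: a => [|a IH]; first by rewrite add0n ideal_mulO //; exact: omod_exp.
by rewrite addSn !ideal_expS IH ideal_mulA.
Qed.

Lemma ideal_expM I a b : omod I -> I ^^ (a * b) = (I ^^ a) ^^ b.
Proof.
move=> oI; elim: b => [|b IH]; first by rewrite muln0.
by rewrite mulnS ideal_expD // IH.
Qed.

Lemma ideal_mul_exp I J m : omod I -> omod J -> (I ** J) ^^ m = I ^^ m ** J ^^ m.
Proof.
move=> oI oJ; elim: m => [|m IH]; first by rewrite /ideal_exp /= ideal_mulO //; exact: omod_O.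
rewrite !ideal_expS IH !ideal_mulA; congr (_ ** _).
by rewrite -!ideal_mulA [J ** _]ideal_mulC.
Qed.

Lemma scale_mem a I x : I x -> scale a I (a * x). Proof. by exists x. Qed.

Lemma scale1 I : scale 1 I = I.
Proof.
apply/seteqP; split => x; first by case=> y Iy <-; rewrite mul1r.
by exists x => //; rewrite mul1r.
Qed.

Lemma scaleA a c I : scale a (scale c I) = scale (a * c) I.
Proof.
apply/seteqP; split => x.
  by move=> [_ [y Iy <-] <-]; rewrite mulrA; exact: scale_mem.
by move=> [y Iy <-]; rewrite -mulrA; apply: scale_mem; exact: scale_mem.
Qed.

Lemma scale_mull a I J : scale a I ** J = scale a (I ** J).
Proof.
apply/seteqP; split.
  apply: ideal_mul_min.
  - by exists 0; rewrite ?mulr0 //; exact: ideal_mul0.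
  - by move=> _ _ [x hx <-] [y hy <-]; rewrite -mulrDr; apply: scale_mem; exact: ideal_mulD.
  - by move=> _ y [x Ix <-] Jy; rewrite -mulrA; apply: scale_mem; exact: ideal_mul_mem.
move=> _ [x hx <-]; move: x hx; apply: (@ideal_mul_min I J (fun u => (scale a I ** J) (a * u))).
- by rewrite mulr0; exact: ideal_mul0.
- by move=> x y hx hy; rewrite mulrDr; exact: ideal_mulD.
- by move=> x y Ix Jy; rewrite mulrA; apply: ideal_mul_mem => //; exact: scale_mem.
Qed.

Lemma scale_mulr a I J : I ** scale a J = scale a (I ** J).
Proof. by rewrite ideal_mulC scale_mull ideal_mulC. Qed.

Lemma omod_scale a I : omod I -> omod (scale a I).
Proof.
move=> [I0 ID IM]; split.
- by exists 0; rewrite ?mulr0.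
- by move=> _ _ [x Ix <-] [y Iy <-]; rewrite -mulrDr; apply: scale_mem; exact: ID.
- by move=> c _ Oc [x Ix <-]; rewrite mulrCA; apply: scale_mem; exact: IM.
Qed.

Lemma scale_exp a I m : omod I -> (scale a I) ^^ m = scale (a ^+ m) (I ^^ m).
Proof.
move=> oI; elim: m => [|m IH]; first by rewrite expr0 scale1.
by rewrite !ideal_expS IH scale_mull scale_mulr scaleA exprS.
Qed.

Lemma exp_O m : O ^^ m = O.
Proof. by elim: m => [|m IH] //; rewrite ideal_expS IH ideal_mulO //; exact: omod_O. Qed.

Lemma scale_inj a I J : a != 0 -> scale a I = scale a J -> I = J.
Proof.
move=> a0 e; have h L : scale a^-1 (scale a L) = L by rewrite scaleA mulVf // scale1.
by rewrite -(h I) e h.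
Qed.

Lemma ideal_class_eqP I J : ideal_class K I = ideal_class K J <->
  exists a, [/\ K a, a != 0 & J = scale a I].
Proof.
split => [e|[a [Ka a0 JE]]].
  have : ideal_class K I J.
    by rewrite e; exists 1; rewrite oner_neq0; split; [exact: K1| |rewrite -/(scale 1 J) scale1].
  by [].
apply/seteqP; split => L [c [Kc c0 ->]]; rewrite -/(scale _ _).
  exists (c / a); rewrite -/(scale _ _) mulf_neq0 ?invr_eq0 //; split => //.
    by apply: KM => //; exact: KV.
  by rewrite JE scaleA divfK.
exists (c * a); rewrite -/(scale _ _) mulf_neq0 //; split => //; first exact: KM.
by rewrite JE scaleA.
Qed.

Lemma fractional_O : fractional_ideal K O.
Proof.
split; first by move=> x [].
- by exists 1; [exact: O1|exact: oner_neq0].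
- exact: OB.
- exact: OM.
- by exists 1; rewrite oner_neq0; split => [||x]; rewrite ?mul1r //; exact: O1.
Qed.

Lemma fractional_mul I J : fractional_ideal K I -> fractional_ideal K J ->
  fractional_ideal K (I ** J).
Proof.
move=> fI fJ; have oI := fractional_omod fI; have oIJ := omod_mul J oI.
case: fI => IK [x Ix x0] _ _ [d [Od d0 hd]]; case: fJ => JK [y Jy y0] _ _ [e [Oe e0 he]].
split.
- apply: ideal_mul_min; [exact: K0|exact: KD|].
  by move=> u v /IK Ku /JK Kv; exact: KM.
- by exists (x * y); [exact: ideal_mul_mem|rewrite mulf_neq0].
- by move=> u v hu hv; case: (oIJ) => _ D _; apply: D => //; exact: omodN.
- by case: oIJ.
- exists (d * e); split; [exact: OM|by rewrite mulf_neq0|].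
  apply: (@ideal_mul_min I J (fun u => O (d * e * u))).
  + by rewrite mulr0; exact: O0.
  + by move=> u v hu hv; rewrite mulrDr; exact: OD.
  + by move=> u v hu hv; rewrite mulrACA; apply: OM; [exact: hd|exact: he].
Qed.

Lemma fractional_exp I m : fractional_ideal K I -> fractional_ideal K (I ^^ m).
Proof.
by move=> fI; elim: m => [|m IH]; [exact: fractional_O|exact: fractional_mul].
Qed.

Definition trivial_torsion n := forall I, fractional_ideal K I ->
  ideal_class K (I ^^ n) = ideal_class K O -> ideal_class K I = ideal_class K O.

(* The witnesses are a nontrivial class and its square. *)
Lemma nontrivial_torsion n : odd n -> (1 < n)%N -> ~ trivial_torsion n ->
  exists c1 c2, [/\ class_group_torsion K n c1, class_group_torsion K n c2,
    c1 <> ideal_class K O, c2 <> ideal_class K O & c1 <> c2].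
Proof.
move=> on n1; move/existsNP => [I /not_implyP[fI /not_implyP[e ne]]].
have oI := fractional_omod fI.
have fI2 := fractional_mul fI fI; have oI2 := fractional_omod fI2.
have [a [Ka a0 OE]] := (ideal_class_eqP _ _).1 e.
exists (ideal_class K I), (ideal_class K (I ** I)).
have back J : omod J -> (exists c, [/\ K c, c != 0 & J = scale c O]) -> ideal_class K J = ideal_class K O.
  move=> oJ [c [Kc c0 JE]]; apply/ideal_class_eqP; exists c^-1.
  by rewrite invr_eq0; split => //; [exact: KV|rewrite JE scaleA mulVf // scale1].
have InE : I ^^ n = scale a^-1 O by rewrite OE scaleA mulVf // scale1.
split => //.
- by exists I.
- exists (I ** I) => //; split => //; rewrite ideal_mul_exp // InE scale_mull scale_mulr.
  rewrite ideal_mulO ?scaleA; last exact: omod_O.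
  apply: back; first by apply: omod_scale; exact: omod_O.
  exists (a^-1 * a^-1); rewrite mulf_neq0 ?invr_eq0 //; split => //.
  by apply: KM; exact: KV.
(* With n = 2h + 1 and I^2 principal, I^n is a scaling of I; since I^n is principal, so is I. *)
- move=> e2; apply: ne; have [c [Kc c0 OE2]] := (ideal_class_eqP _ _).1 e2.
  have I2E : I ** I = scale c^-1 O by rewrite OE2 scaleA mulVf // scale1.
  have nE : (n = 2 * n./2 + 1)%N by rewrite mul2n; lia.
  apply: back => //; exists (a^-1 * c ^+ n./2); rewrite mulf_neq0 ?invr_eq0 ?expf_neq0 //.
  split => //; first by apply: KM; [exact: KV|exact: KX].
  apply: (@scale_inj (c^-1 ^+ n./2)); first by rewrite expf_neq0 // invr_eq0.
  have -> : scale (c^-1 ^+ n./2) (scale (a^-1 * c ^+ n./2) O) = scale a^-1 O.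
    by rewrite scaleA mulrCA -exprMn mulVf // expr1n mulr1.
  rewrite -InE [in RHS]nE ideal_expD // ideal_exp1 // ideal_expM //.
  have -> : I ^^ 2 = I ** I by rewrite ideal_expS ideal_exp1.
  rewrite I2E scale_exp; last exact: omod_O.
  by rewrite exp_O scale_mull ideal_mulO.
(* From I^2 = cI follows I^n = c^(n-1) I, so I is principal: the relation is raised to the power n
   instead of being cancelled by an inverse of I. *)
- move=> e2; apply: ne; have [c [Kc c0 I2E]] := (ideal_class_eqP _ _).1 e2.
  have IE m : I ^^ m.+1 = scale (c ^+ m) I.
    elim: m => [|m IH]; first by rewrite ideal_exp1 // expr0 scale1.
    by rewrite ideal_expS IH scale_mulr I2E scaleA exprSr.
  apply: back => //; exists ((c ^+ n.-1)^-1 * a^-1).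
  rewrite mulf_neq0 ?invr_eq0 ?expf_neq0 //; split => //.
    by apply: KM; apply: KV => //; exact: KX.
  rewrite -scaleA -InE -[n in I ^^ n]prednK; last exact: ltnW.
  by rewrite IE scaleA mulVf ?scale1 // expf_neq0.
Qed.

End Ideals.

(** * The field Q(sqrt(-b)) and its integers *)

Section ImaginaryQuadratic.
Context (b : nat) (b_gt0 : (0 < b)%N).
Local Notation K := (quadratic_field (-1 * b%:Z)).
Local Notation O := (ring_of_integers K).
Local Notation s := (sqrtC ((-1 * b%:Z)%:~R : algC)).
Local Notation "I ** J" := (ideal_mul I J) (at level 40, left associativity).
Local Notation "I ^^ m" := (ideal_exp K I m) (at level 30).

Lemma sqr_s : s * s = - b%:R.
Proof. by rewrite -expr2 sqrtCK mulN1r rmorphN. Qed.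

Lemma s_neq0 : s != 0.
Proof.
apply/eqP => s0; have /eqP := sqr_s; rewrite s0 mul0r eq_sym oppr_eq0 pnatr_eq0.
by rewrite eqn0Ngt b_gt0.
Qed.

Lemma conj_s : s^* = - s.
Proof.
apply: (mulfI s_neq0); rewrite -normCK mulrN sqr_s opprK.
have : `|s| ^+ 2 = `|s * s| by rewrite normrM.
by rewrite sqr_s normrN normr_nat.
Qed.

Definition qelt (x y : rat) : algC := ratr x + ratr y * s.

Lemma qeltB x y x' y' : qelt x y - qelt x' y' = qelt (x - x') (y - y').
Proof. by rewrite /qelt !rmorphB /=; ring. Qed.
Lemma qeltD x y x' y' : qelt x y + qelt x' y' = qelt (x + x') (y + y').
Proof. by rewrite /qelt !rmorphD /=; ring. Qed.
Lemma qeltM x y x' y' :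
  qelt x y * qelt x' y' = qelt (x * x' - b%:R * (y * y')) (x * y' + y * x').
Proof.
rewrite /qelt; move: (s) sqr_s => z hz.
rewrite rmorphB rmorphD !rmorphM /= rmorph_nat.
have -> : b%:R = - (z * z) by rewrite hz opprK.
by ring.
Qed.

Lemma conj_qelt x y : (qelt x y)^* = qelt x (- y).
Proof.
rewrite /qelt; move: (s) conj_s => z hz; rewrite rmorphD [X in _ + X = _]rmorphM /= hz !(fmorph_rat (Num.conj : {rmorphism algC -> algC})).
by rewrite rmorphN mulrN mulNr.
Qed.

Lemma qelt_inj x y x' y' : qelt x y = qelt x' y' -> x = x' /\ y = y'.
Proof.
move=> e; have e2 := congr1 (fun z : algC => z^*) e; rewrite /= !conj_qelt in e2.
have xx : x = x'.
  have : ratr (x + x) = ratr (x' + x') :> algC.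
    have := congr2 +%R e e2; rewrite !qeltD !subrr /qelt rmorph0 !mul0r !addr0.
    exact.
  by move/(fmorph_inj (ratr : {rmorphism rat -> algC})) => h; lra.
split => //; move: e; rewrite /qelt xx => /addrI /(mulIf s_neq0).
exact: (fmorph_inj (ratr : {rmorphism rat -> algC})).
Qed.

Lemma norm_qelt x y : qelt x y * (qelt x y)^* = ratr (x ^+ 2 + b%:R * y ^+ 2).
Proof.
rewrite conj_qelt qeltM /qelt; have -> : x * - y + y * x = 0 by ring.
by rewrite rmorph0 mul0r addr0; congr ratr; ring.
Qed.

Lemma norm_gt0 x y : qelt x y != 0 -> 0 < x ^+ 2 + b%:R * y ^+ 2.
Proof.
move=> h; rewrite lt_neqAle; apply/andP; split.
  apply: contraNneq h => e; have := norm_qelt x y; rewrite -e rmorph0.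
  by move/eqP; rewrite mulf_eq0 conjC_eq0 orbb.
by rewrite addr_ge0 ?sqr_ge0 // mulr_ge0 ?sqr_ge0.
Qed.

Lemma K_qelt x y : K (qelt x y). Proof. by exists x, y. Qed.
Hint Resolve K_qelt : core.

Lemma qelt_nat (m : int) : m%:~R = qelt m%:~R 0.
Proof. by rewrite /qelt rmorph0 mul0r addr0 ratr_int. Qed.

Lemma K_subfield : subfield_set K.
Proof.
split.
- by exists 1, 0; rewrite rmorph1 rmorph0 mul0r addr0.
- by move=> _ _ [x [y ->]] [x' [y' ->]]; rewrite -!/(qelt _ _) qeltB.
- by move=> _ _ [x [y ->]] [x' [y' ->]]; rewrite -!/(qelt _ _) qeltM.
move=> _ [x [y ->]]; rewrite -/(qelt x y); have [->|h] := eqVneq (qelt x y) 0.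
  by rewrite invr0; exists 0, 0; rewrite rmorph0 mul0r addr0.
have n0 := norm_gt0 h; set N := x ^+ 2 + _ in n0.
have N0 : ratr N != 0 :> algC by rewrite fmorph_eq0 gt_eqF.
have -> : (qelt x y)^-1 = qelt (x / N) (- y / N).
  apply: (mulfI h); rewrite mulfV // qeltM.
  have -> : x * (x / N) - b%:R * (y * (- y / N)) = N / N by rewrite -[X in _ = X / _]/(x ^+ 2 + b%:R * y ^+ 2); ring.
  have -> : x * (- y / N) + y * (x / N) = 0 by ring.
  by rewrite divff ?gt_eqF // /qelt rmorph0 mul0r addr0 rmorph1.
exact: K_qelt.
Qed.

Lemma K_conj x : K x -> K x^*.
Proof. by move=> [u [v ->]]; rewrite -/(qelt u v) conj_qelt. Qed.

Lemma O_conj x : O x -> O x^*.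
Proof. by case=> Kx Ax; split; [exact: K_conj|rewrite (Aint_aut (Num.conj : {rmorphism algC -> algC}))]. Qed.

Lemma Aint_ratr x : ratr x \in Aint -> exists m : int, x = m%:~R.
Proof.
move=> h; have /intrP[m e] := Cint_rat_Aint (Crat_rat x) h.
exists m; apply: (fmorph_inj (ratr : {rmorphism rat -> algC})).
by rewrite /= ratr_int.
Qed.

(** The trace 2x and the norm are rational algebraic integers, hence integers. *)
Lemma O_struct z : O z -> exists (x y : rat) (u N : int),
  [/\ z = qelt x y, 2 * x = u%:~R & x ^+ 2 + b%:R * y ^+ 2 = N%:~R].
Proof.
move=> Oz; have Oz' := O_conj Oz; have [[x [y zE]] Az] := Oz; rewrite -/(qelt x y) in zE.
have [_ At] := OD K_subfield Oz Oz'; have [_ An] := OM K_subfield Oz Oz'.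
have [u uE] : exists u : int, 2 * x = u%:~R.
  apply: Aint_ratr; move: At; rewrite zE conj_qelt qeltD subrr /qelt rmorph0 mul0r addr0.
  by have -> : 2 * x = x + x by ring.
have [N NE] : exists N : int, x ^+ 2 + b%:R * y ^+ 2 = N%:~R.
  by apply: Aint_ratr; rewrite -norm_qelt -zE.
by exists x, y, u, N.
Qed.

Lemma O_int (m : int) : O m%:~R.
Proof. by split; [rewrite qelt_nat|apply: Aint_int; rewrite intr_int]. Qed.

Lemma O_s : O s.
Proof.
split; first by exists 0, 1; rewrite rmorph0 rmorph1 mul1r add0r.
apply: (@root_monic_Aint ('X^2 + b%:R%:P)).
- by rewrite /root !hornerE sqrtCK mulN1r rmorphN addNr.
- by rewrite monicE lead_coefDl ?lead_coefXn // size_polyXn size_polyC; case: eqP.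
- by apply/polyOverP => i; rewrite coefD coefC coefXn; case: eqP => _; case: eqP => _; rewrite ?addr0 ?add0r ?rpred0 ?rpred1 ?rpredD ?rpred_nat.
Qed.

Lemma O_zelt (u v : int) : O (qelt u%:~R v%:~R).
Proof.
rewrite /qelt !ratr_int; apply: (OD K_subfield); first exact: O_int.
by apply: (OM K_subfield); [exact: O_int|exact: O_s].
Qed.

(** (2by)^2 = b (4N - u^2) is an integer, so the rational number 2by is an algebraic integer. The
    denominator 2b is crude but common to both coordinates. *)
Lemma O_denominator z : O z -> exists u v : int,
  z = qelt (u%:~R / (2 * b%:R)) (v%:~R / (2 * b%:R)).
Proof.
move=> /O_struct[x [y [u [N [-> hx hN]]]]].
have b0 : (b%:R : rat) != 0 by rewrite pnatr_eq0 -lt0n.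
have [v hv] : exists v : int, 2 * b%:R * y = v%:~R.
  apply: Aint_ratr; apply: (@root_monic_Aint ('X^2 - ((b%:Z * (4 * N - u ^+ 2))%:~R)%:P)).
  - rewrite /root !hornerE -rmorphXn /=.
    have -> : (2 * b%:R * y) ^+ 2 = ((b%:Z * (4 * N - u ^+ 2))%:~R : rat).
      rewrite !(rmorphM, rmorphB, rmorphXn) /= -hN -hx; ring.
    by rewrite ratr_int subrr.
  - by rewrite monicE lead_coefDl ?lead_coefXn // size_polyXn size_polyN size_polyC; case: eqP.
  - by apply/polyOverP => i; rewrite coefB coefC coefXn; case: eqP => _; case: eqP => _; rewrite ?subr0 ?sub0r ?rpred0 ?rpred1 ?rpredN ?rpredB ?intr_int ?rpred1.
exists (b%:Z * u), v; rewrite -hv rmorphM /= -hx.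
by congr qelt; field.
Qed.

End ImaginaryQuadratic.

Lemma split_period (c w : nat) (m : int) (P := (2 * c * w)%N%:Z) : (0 < c)%N -> (0 < w)%N ->
  m%:~R / (2 * c%:R) = (m %/ P)%Z%:~R * w%:R + `|(m %% P)%Z|%N%:R / (2 * c%:R) :> rat.
Proof.
move=> c0 w0; have P0 : P != 0 by rewrite eqz_nat -lt0n !muln_gt0 c0.
rewrite natr_absz ger0_norm ?modz_ge0 // [in LHS](divz_eq m P) intrD intrM mulrDl.
congr (_ + _); have -> : (P%:~R : rat) = 2 * c%:R * w%:R by rewrite /P -pmulrn !natrM.
by field; rewrite pnatr_eq0 -lt0n.
Qed.

(** * Coincidences among classes of powers, after Hurwitz *)

Section FiniteOrder.
Context (b : nat) (b_gt0 : (0 < b)%N).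
Local Notation K := (quadratic_field (-1 * b%:Z)).
Local Notation O := (ring_of_integers K).
Local Notation s := (sqrtC ((-1 * b%:Z)%:~R : algC)).
Local Notation "I ** J" := (ideal_mul I J) (at level 40, left associativity).
Local Notation "I ^^ m" := (ideal_exp K I m) (at level 30).
Local Notation q := (qelt b).
Let KF : subfield_set K := K_subfield b_gt0.

Definition frac (x : rat) : rat := x - (Num.floor x)%:~R.

Lemma frac_itv x : 0 <= frac x < 1.
Proof. by have /andP[h1 h2] := floor_itv x; rewrite /frac subr_ge0 h1 ltrBlDr addrC -(intrD _ _ 1). Qed.

Definition cell (x : rat) : 'I_b.+1 := inord `|Num.floor (b.+1%:R * frac x)|%N.

Lemma cell_close x y : cell x = cell y -> (b.+1%:R * (frac x - frac y)) ^+ 2 < 1.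
Proof.
have L0 : (0 : rat) < b.+1%:R by rewrite ltr0n.
have fl z : 0 <= Num.floor (b.+1%:R * frac z) < b.+1%:Z.
  have /andP[h0 h1] := frac_itv z; apply/andP; split.
    by rewrite floor_ge_int; apply: mulr_ge0.
  rewrite -(ltr_int rat); have /andP[h2 _] := floor_itv (b.+1%:R * frac z).
  by apply: le_lt_trans h2 _; rewrite gtr_pMr.
have cellE w : (cell w : nat) = `|Num.floor (b.+1%:R * frac w)|%N.
  by rewrite inordK //; have /andP[h0 h1] := fl w; rewrite -ltz_nat gez0_abs.
move/(congr1 (fun c : 'I_b.+1 => (nat_of_ord c)%:Z)); rewrite /= !cellE.
have /andP[hx _] := fl x; have /andP[hy _] := fl y; rewrite !gez0_abs // => e.
have /andP[x1 x2] := floor_itv (b.+1%:R * frac x).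
have /andP[y1 y2] := floor_itv (b.+1%:R * frac y); rewrite e in x1 x2.
rewrite intrD mulr1z in x2; rewrite intrD mulr1z in y2; rewrite mulrBr.
move: x1 x2 y1 y2; set f := (_%:~R : rat); move: f (b.+1%:R * frac x) (b.+1%:R * frac y) => f X Y *.
have : -1 < X - Y < 1 by lra.
case/andP => h1 h2; rewrite -subr_gt0.
have -> : 1 - (X - Y) ^+ 2 = (1 - (X - Y)) * (1 + (X - Y)) by ring.
by apply: mulr_gt0; lra.
Qed.

(* Hurwitz' substitute for the Euclidean algorithm: by the pigeonhole principle
   some multiple t g with 0 < t <= (b+1)^2 lies at norm < 1 from Z[s]. *)
Lemma hurwitz g : K g -> exists (t : nat) (u v : int) (x y : rat),
  [/\ (0 < t <= b.+1 * b.+1)%N, t%:R * g = q u%:~R v%:~R + q x y &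
      x ^+ 2 + b%:R * y ^+ 2 < 1].
Proof.
case=> X [Y ->]; rewrite -/(q X Y).
pose f (t : 'I_(b.+1 * b.+1).+1) := (cell (t%:R * X), cell (t%:R * Y)).
have [t1 [t2 [lt12 e]]] : exists t1 t2 : 'I_(b.+1 * b.+1).+1, (t1 < t2)%N /\ f t1 = f t2.
  apply: contrapT => H; have : injective f.
    move=> t1 t2 e; apply/val_inj => /=; apply: contrapT => ne; apply: H.
    by case: (ltngtP t1 t2) => // h; [exists t1, t2|exists t2, t1].
  by move/leq_card; rewrite card_prod !card_ord ltnn.
have [e1 e2] : cell (t2%:R * X) = cell (t1%:R * X) /\ cell (t2%:R * Y) = cell (t1%:R * Y).
  by case: e => -> ->.
have h1 := cell_close e1; have h2 := cell_close e2.
pose x := frac (t2%:R * X) - frac (t1%:R * X); pose y := frac (t2%:R * Y) - frac (t1%:R * Y).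
exists (t2 - t1)%N, (Num.floor (t2%:R * X) - Num.floor (t1%:R * X)),
  (Num.floor (t2%:R * Y) - Num.floor (t1%:R * Y)), x, y; split.
- by rewrite subn_gt0 lt12 /= (leq_trans (leq_subr _ _)) // -ltnS ltn_ord.
- rewrite qeltD; have -> : ((t2 - t1)%N%:R : algC) = q (t2 - t1)%N%:R 0.
    by rewrite /qelt rmorph0 mul0r addr0 rmorph_nat.
  rewrite qeltM natrB 1?ltnW //; congr qelt; rewrite /x /y /frac !intrB; ring.
rewrite -/x in h1; rewrite -/y in h2; clearbody x y; clear -h1 h2.
have L1 : (1 : rat) <= b.+1%:R by rewrite ler1n.
have bE : (b%:R : rat) = b.+1%:R - 1 by rewrite -natr1 addrK.
have b0 : (0 : rat) <= b%:R by [].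
rewrite exprMn in h1; rewrite exprMn in h2; rewrite bE.
move: L1 h1 h2; move: (b.+1%:R) (x ^+ 2) (y ^+ 2) => L X Y L1 h1 h2.
have Lp : 0 < L ^+ 2 by rewrite exprn_gt0 //; lra.
(* With L = b + 1 both coordinates are below 1/L in absolute value, so the norm is below (1 + b)/L^2
   = 1/L <= 1. *)
rewrite -(ltr_pM2l Lp) mulrDr mulr1 mulrCA.
have h3 : (L - 1) * (L ^+ 2 * Y) <= (L - 1) * 1 by apply: ler_wpM2l; lra.
apply: lt_le_trans (_ : 1 + (L - 1) <= _); first by rewrite mulr1 in h3; rewrite ltr_leD.
by rewrite expr2; nra.
Qed.

Lemma norm_nat z : O z -> exists n : nat, z * z^* = n%:R.
Proof.
move=> /(O_struct b_gt0) [x [y [u [N [-> _ hN]]]]]; rewrite norm_qelt // hN ratr_int.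
have N0 : 0 <= N by rewrite -(ler0z rat) -hN addr_ge0 ?sqr_ge0 // mulr_ge0 ?sqr_ge0.
by exists `|N|%N; rewrite natr_absz ger0_norm.
Qed.

Lemma min_norm_elt I : I `<=` O -> (exists2 x, I x & x != 0) ->
  exists z, [/\ I z, z != 0 & forall a, I a -> a * a^* < z * z^* -> a = 0].
Proof.
move=> IO [x0 Ix0 x0n].
pose P (n : nat) := `[< exists z, [/\ I z, z != 0 & z * z^* = n%:R] >].
have exP : exists n, P n.
  by have [n hn] := norm_nat (IO _ Ix0); exists n; apply/asboolP; exists x0.
case: (ex_minnP exP) => n /asboolP[z [Iz z0 zn]] hmin.
exists z; split => // a Ia; have [m am] := norm_nat (IO _ Ia).
rewrite zn am ltr_nat => mn; apply/eqP; apply: contraLR mn => a0; rewrite -leqNgt.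
by apply: hmin; apply/asboolP; exists a.
Qed.

(** Divisible by every multiplier t that [hurwitz] can produce. *)
Definition hurwitz_const := (b.+1 * b.+1)`!.
Local Notation W := hurwitz_const.

(** Apply [hurwitz] to a/z: the remainder t a - w z lies in I and has smaller norm than z, so it
    vanishes. Thus t a/z is integral, and t divides [W]. *)
Lemma hurwitz_divides I z : omod K I -> I `<=` O -> I z -> z != 0 ->
  (forall a, I a -> a * a^* < z * z^* -> a = 0) ->
  forall a, I a -> O (W%:R / z * a).
Proof.
move=> [I0 ID IM] IO Iz z0 hmin a Ia.
have [Kz _] := IO _ Iz; have [Ka _] := IO _ Ia.
have [t [u [v [x [y [/andP[t0 tL] e hn]]]]]] := hurwitz (KM KF Ka (KV KF Kz)).
have Ow := O_zelt b_gt0 u v; set w := q u%:~R v%:~R in Ow e.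
have dE : q x y * z = t%:R * a - w * z.
  have -> : q x y = t%:R * (a / z) - w by rewrite e addrC addKr.
  by rewrite mulrBl -mulrA divfK.
have Id : I (q x y * z).
  rewrite dE; apply: ID; first by apply: IM => //; exact: (O_int b t%:Z).
  by rewrite -mulNr; apply: IM => //; exact: (ON KF).
have d0 : q x y * z = 0.
  apply: hmin => //; rewrite rmorphM /= mulrACA norm_qelt //.
  have zz : 0 < z * z^* by rewrite -normCK exprn_gt0 // normr_gt0.
  by rewrite gtr_pMl // -(rmorph1 (ratr : {rmorphism rat -> algC})) ltr_rat.
have tE : t%:R * (a / z) = w.
  by move/eqP: d0; rewrite mulf_eq0 (negbTE z0) orbF => /eqP d0; rewrite e d0 addr0.
have tW : (t %| W)%N by rewrite dvdn_fact // t0.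
have -> : W%:R / z * a = (W %/ t)%N%:R * w.
  by rewrite -tE mulrA -natrM divnK // mulrAC mulrA.
by apply: (OM KF) => //; exact: (O_int b (W %/ t)%N%:Z).
Qed.

(** Coordinates of integers have denominator 2b and matter modulo W, so their numerators matter
    modulo 2bW. *)
Definition period := (2 * b * W)%N.

Definition fingerprint (J : set algC) : {set 'I_period * 'I_period} :=
  finset (fun p : 'I_period * 'I_period =>
    `[< J (q ((p.1 : nat)%:R / (2 * b%:R)) ((p.2 : nat)%:R / (2 * b%:R))) >]).

(** An element of J1 differs from its reduced representative by a multiple of W, which lies in both
    ideals. *)
Lemma fingerprint_sub J1 J2 : omod K J1 -> omod K J2 -> J1 `<=` O -> J1 W%:R -> J2 W%:R ->
  fingerprint J1 = fingerprint J2 -> J1 `<=` J2.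
Proof.
move=> [_ D1 M1] [_ D2 M2] J1O W1 W2 e z Jz.
have [u [v zE]] := O_denominator b_gt0 (J1O _ Jz).
have W0 : (0 < W)%N by rewrite fact_gt0.
have p0 : (0 < period)%N by rewrite /period muln_gt0 W0 muln_gt0 b_gt0.
have p0' : period%:Z != 0 by rewrite eqz_nat -lt0n.
pose w := q (u %/ period%:Z)%Z%:~R (v %/ period%:Z)%Z%:~R.
have Ow : O w := O_zelt b_gt0 _ _.
have ub (m : int) : (`|(m %% period%:Z)%Z| < period)%N.
  by rewrite -ltz_nat gez0_abs ?modz_ge0 // ltz_pmod.
pose p := (Ordinal (ub u), Ordinal (ub v)).
have zw : z = w * W%:R + q ((p.1 : nat)%:R / (2 * b%:R)) ((p.2 : nat)%:R / (2 * b%:R)).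
  have -> : (W%:R : algC) = q W%:R 0 by rewrite /qelt rmorph0 mul0r addr0 rmorph_nat.
  rewrite /w qeltM qeltD zE /=.
  by rewrite !(split_period _ b_gt0 W0); congr qelt; ring.
have hp : p \in fingerprint J1.
  rewrite inE; apply/asboolP; have -> : q ((p.1 : nat)%:R / (2 * b%:R)) ((p.2 : nat)%:R / (2 * b%:R)) = z + (- w) * W%:R.
    by rewrite zw; ring.
  by apply: D1 => //; apply: M1 => //; exact: (ON KF).
rewrite e inE in hp; move/asboolP: hp => hp; rewrite zw.
by apply: D2 => //; exact: M2.
Qed.

(* Each power of I is equivalent to an integral ideal containing W, and such an
   ideal is determined by its elements modulo W, of which there are finitely many. *)
Lemma exp_class_coincide I : fractional_ideal K I -> I `<=` O ->
  exists k l c, [/\ (k < l)%N, K c, c != 0 & I ^^ l = scale c (I ^^ k)].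
Proof.
move=> fI IO; have fIk k := fractional_exp KF k fI.
have oI := fractional_omod fI.
have IkO k : I ^^ k `<=` O.
  elim: k => [|k IH] //; apply: ideal_mul_min; [exact: O0|exact: OD|].
  by move=> x y /IO Ox /IH Oy; exact: OM.
have /choice[z hz] : forall k, exists z, [/\ (I ^^ k) z, z != 0 &
    forall a, (I ^^ k) a -> a * a^* < z * z^* -> a = 0].
  by move=> k; apply: min_norm_elt => //; case: (fIk k).
pose J k := scale (W%:R / z k) (I ^^ k).
have W0 : (W%:R : algC) != 0 by rewrite pnatr_eq0 -lt0n fact_gt0.
have oJ k : omod K (J k) by apply: omod_scale; exact: fractional_omod.
have JO k : J k `<=` O.
  have [h1 h2 h3] := hz k; move=> _ [a Ia <-].
  by apply: (hurwitz_divides (fractional_omod (fIk k)) (IkO k) h1 h2 h3).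
have JW k : J k W%:R.
  by have [h1 h2 _] := hz k; exists (z k); rewrite // divfK.
pose T : finType := {set 'I_period * 'I_period}.
pose f (k : 'I_(#|T|.+1)) : T := fingerprint (J k).
have [k [l [kl e]]] : exists k l : 'I_(#|T|.+1), (k < l)%N /\ f k = f l.
  apply: contrapT => H; have : injective f.
    move=> t1 t2 e; apply/val_inj => /=; apply: contrapT => ne; apply: H.
    by case: (ltngtP t1 t2) => // h; [exists t1, t2|exists t2, t1].
  by move/leq_card; rewrite card_ord ltnn.
have JE : J k = J l by apply/seteqP; split; apply: fingerprint_sub.
have [hk zk _] := hz k; have [hl zl _] := hz l.
have [Kk _] := IkO _ _ hk; have [Kl _] := IkO _ _ hl.
exists k, l, (z l / z k); split => //.
- by apply: (KM KF) => //; exact: (KV KF).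
- by rewrite mulf_neq0 // invr_eq0.
apply: (@scale_inj (W%:R / z l)); first by rewrite mulf_neq0 // invr_eq0.
rewrite -/(J l) -JE /J scaleA; congr scale.
by field; rewrite zk.
Qed.

End FiniteOrder.

(** * The ideal (C, r + sqrt(-b)) and primitive solutions *)

Section SplitIdeal.
Context (b : nat) (b_gt0 : (0 < b)%N) (b_sqf : squarefree b).
Context (C : nat) (r : int) (C_odd : odd C) (C_cop : coprime C b)
  (C_dvd : (C%:Z %| r ^+ 2 + b%:Z)%Z).
Local Notation K := (quadratic_field (-1 * b%:Z)).
Local Notation O := (ring_of_integers K).
Local Notation s := (sqrtC ((-1 * b%:Z)%:~R : algC)).
Local Notation "I ** J" := (ideal_mul I J) (at level 40, left associativity).
Local Notation "I ^^ m" := (ideal_exp K I m) (at level 30).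
Local Notation q := (qelt b).
Let KF : subfield_set K := K_subfield b_gt0.
Let C_gt0 : (0 < C)%N := odd_gt0 C_odd.
Let C_neq0 : (C%:R : algC) != 0. Proof. by rewrite pnatr_eq0 -lt0n. Qed.

(** The values e = 1 and e = -1 give the ideal and its conjugate. *)
Definition split_ideal (e : int) : set algC :=
  [set x | exists u v, [/\ O u, O v & x = C%:R * u + (r%:~R + e%:~R * s) * v]].
Local Notation cc := (split_ideal 1).
Local Notation cc' := (split_ideal (-1)).

Lemma O_nat m : O m%:R. Proof. exact: (O_int b m%:Z). Qed.

Lemma O_root (e : int) : O (r%:~R + e%:~R * s).
Proof.
apply: (OD KF); first exact: O_int.
by apply: (OM KF); [exact: O_int|exact: O_s].
Qed.

Lemma split_ideal_sub e : split_ideal e `<=` O.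
Proof.
move=> _ [u [v [Ou Ov ->]]]; apply: (OD KF); first by apply: (OM KF) => //; exact: O_nat.
by apply: (OM KF) => //; exact: O_root.
Qed.

Lemma split_ideal_C e : split_ideal e C%:R.
Proof. by exists 1, 0; rewrite mulr0 addr0 mulr1; split => //; [exact: O1|exact: O0]. Qed.

Lemma split_ideal_root e : split_ideal e (r%:~R + e%:~R * s).
Proof. by exists 0, 1; rewrite mulr0 add0r mulr1; split => //; [exact: O0|exact: O1]. Qed.

Lemma split_ideal_fractional e : fractional_ideal K (split_ideal e).
Proof.
split.
- by move=> x /split_ideal_sub[].
- by exists C%:R => //; exact: split_ideal_C.
- move=> _ _ [u [v [Ou Ov ->]]] [u' [v' [Ou' Ov' ->]]].
  exists (u - u'), (v - v'); split; [exact: OB|exact: OB|by ring].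
- move=> a _ Oa [u [v [Ou Ov ->]]]; exists (a * u), (a * v); split; [exact: OM|exact: OM|by ring].
- exists 1; rewrite oner_neq0; split => //; first exact: O1.
  by move=> x; rewrite mul1r; exact: split_ideal_sub.
Qed.

Lemma split_ideal_omod e : omod K (split_ideal e).
Proof. exact: fractional_omod (split_ideal_fractional e). Qed.

Lemma norm_root : (r%:~R + 1%:~R * s) * (r%:~R + (-1)%:~R * s) = (r ^+ 2 + b%:Z)%:~R.
Proof.
move: (s) (sqr_s b) => z hz; rewrite rmorphD rmorphXn /= rmorphN1 rmorph1.
have -> : (b%:Z%:~R : algC) = - (z * z) by rewrite hz opprK.
by ring.
Qed.

(** A prime of C dividing r would divide b as well. Thus 2r is invertible modulo C. *)
Lemma dvd_prime_root p : prime p -> (p %| C)%N -> ~~ (p%:Z %| 2 * r)%Z /\ (2 < p)%N.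
Proof.
move=> pp pC; have op : odd p by apply: dvdn_odd pC C_odd.
have p2 : (2 < p)%N by have := prime_gt1 pp; case: p pp pC op => [|[|[|]]].
split => //; rewrite Euclid_dvdzM // negb_or; apply/andP; split.
  by rewrite dvdzE /=; apply/negP => /dvdn_leq; lia.
apply/negP => pr; have : (p%:Z %| b%:Z)%Z.
  have -> : b%:Z = (r ^+ 2 + b%:Z) - r * r by ring.
  apply: rpredB; last exact: dvdz_mull.
  by apply: (dvdz_trans _ C_dvd); rewrite dvdzE.
rewrite dvdzE /= => pb; have : (p %| gcdn C b)%N by rewrite dvdn_gcd pC pb.
by rewrite (eqP C_cop) dvdn1 => /eqP p1; rewrite p1 in pp.
Qed.

(** The products of generators C^2, C (r - s), C (r + s) and r^2 + b are all multiples of C.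
    Conversely C^2 and the sum 2rC of the middle two yield C, because C and 2r are coprime. *)
Lemma split_ideal_mul : cc ** cc' = scale C%:R O.
Proof.
have [k kE] := dvdzP C_dvd.
apply/seteqP; split.
  have [h0 hD _] := omod_scale C%:R (omod_O KF).
  apply: ideal_mul_min => // _ _ [u [v [Ou Ov ->]]] [u' [v' [Ou' Ov' ->]]].
  exists (C%:R * (u * u') + (r%:~R + (-1)%:~R * s) * (u * v') +
    (r%:~R + 1%:~R * s) * (v * u') + k%:~R * (v * v')).
    do ![apply: (OD KF)]; apply: (OM KF); try exact: (OM KF); try exact: O_root; try exact: O_int.
    exact: O_nat.
  rewrite [RHS]mulrDl [in RHS]mulrDr [in RHS]mulrDr.
  have -> : (r%:~R + 1%:~R * s) * v * ((r%:~R + (-1)%:~R * s) * v') = C%:R * (k%:~R * (v * v')).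
    by rewrite mulrACA norm_root kE rmorphM /= -pmulrn; ring.
  by ring.
have cop : coprimez C%:Z (2 * r).
  rewrite coprimezE /coprime; apply: contraT => g1.
  set g := gcdn _ _ in g1; have g0 : (0 < g)%N by rewrite gcdn_gt0 /= C_gt0.
  have g2 : (1 < g)%N by clear -g0 g1; lia.
  have pg := pdiv_dvd g; have pp := pdiv_prime g2.
  have pC : (pdiv g %| C)%N by apply: dvdn_trans pg _; exact: dvdn_gcdl.
  have [/negP h _] := dvd_prime_root pp pC; exfalso; apply: h.
  by rewrite dvdzE; apply: dvdn_trans pg _; exact: dvdn_gcdr.
have /coprimezP[[al be] /= ab] := cop.
have [h0 hD hM] := omod_mul cc' (split_ideal_omod 1).
move=> _ [x Ox <-].
have mem e f : split_ideal 1 e -> split_ideal (-1) f -> (cc ** cc') (e * f).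
  exact: ideal_mul_mem.
have -> : C%:R * x = (al%:~R * x) * (C%:R * C%:R) +
    (be%:~R * x) * (C%:R * (r%:~R + (-1)%:~R * s) + (r%:~R + 1%:~R * s) * C%:R).
  have h : al%:~R * C%:R + be%:~R * (2 * r%:~R) = 1 :> algC.
    by have := congr1 (fun m : int => m%:~R : algC) ab; rewrite rmorphD !rmorphM.
  transitivity (C%:R * x * (al%:~R * C%:R + be%:~R * (2 * r%:~R))).
    by rewrite h mulr1.
  by rewrite rmorphN1 rmorph1; move: (s) => z; ring.
apply: (hD); apply: hM; try by apply: (OM KF) => //; exact: O_int.
  by apply: mem; exact: split_ideal_C.
by apply: hD; apply: mem; [exact: split_ideal_C|exact: split_ideal_root|exact: split_ideal_root|exact: split_ideal_C].
Qed.

Lemma split_ideal_exp_mul m : cc ^^ m ** cc' ^^ m = scale (C%:R ^+ m) O.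
Proof.
rewrite -ideal_mul_exp //; try exact: split_ideal_omod.
by rewrite split_ideal_mul scale_exp ?exp_O //; exact: omod_O.
Qed.

(** Two powers of the ideal are proportional; the conjugate ideal, an inverse up to the factor C,
    cancels the smaller power. *)
Lemma split_ideal_order : exists m a, [/\ (0 < m)%N, K a, a != 0 & cc ^^ m = scale a O].
Proof.
have [k [l [c [kl Kc c0 E]]]] := exp_class_coincide b_gt0 (split_ideal_fractional 1) (@split_ideal_sub 1).
exists (l - k)%N, c; rewrite subn_gt0; split => //.
have oI := split_ideal_omod 1.
have Cn0 : C%:R ^+ k != 0 :> algC by rewrite expf_neq0.
apply: (@scale_inj (C%:R ^+ k)) => //.
have <- : cc' ^^ k ** (cc ^^ k ** cc ^^ (l - k)) = scale (C%:R ^+ k) (cc ^^ (l - k)).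
  rewrite ideal_mulA [cc' ^^ k ** _]ideal_mulC split_ideal_exp_mul scale_mull ideal_mulO //.
  exact: omod_exp.
rewrite -ideal_expD // subnKC ?E; last exact: ltnW.
by rewrite scale_mulr ideal_mulC split_ideal_exp_mul !scaleA mulrC.
Qed.

Lemma conj_split_ideal e x m : (split_ideal e ^^ m) x -> (split_ideal (- e) ^^ m) x^*.
Proof.
elim: m x => [|m IH] x; first exact: O_conj.
have [h0 hD _] := omod_exp KF m.+1 (split_ideal_omod (- e)).
move: x; apply: (@ideal_mul_min _ _ (fun x : algC => (split_ideal (- e) ^^ m.+1) x^*)).
- by rewrite rmorph0.
- by move=> x y hx hy; rewrite rmorphD; exact: hD.
- move=> x y [u [v [Ou Ov ->]]] /IH hy; rewrite rmorphM; apply: ideal_mul_mem => //.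
  exists u^*, v^*; split; try exact: O_conj.
  move: (s) (conj_s b_gt0) => z hz.
  rewrite rmorphD (rmorphM _ C%:R) (rmorphM _ (_ + _)) rmorphD (rmorphM _ e%:~R).
  by rewrite rmorph_nat !rmorph_int /= hz rmorphN mulrN mulNr.
Qed.

Lemma split_ideal_exp_sub e m : split_ideal e ^^ m `<=` O.
Proof.
elim: m => [|m IH] //; apply: ideal_mul_min; [exact: O0|exact: OD|].
by move=> x y /split_ideal_sub Ox /IH Oy; exact: OM.
Qed.

(** Multiplying the identity by its conjugate shows that the norm of a and C^m generate the same
    ideal; being positive integers, they divide each other. *)
Lemma generator_norm m a : K a -> a != 0 -> cc ^^ m = scale a O -> a * a^* = (C ^ m)%:R.
Proof.
move=> Ka a0 E.
have Ia : (cc ^^ m) a by rewrite E; exists 1; rewrite ?mulr1 //; exact: O1.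
have E' : cc' ^^ m = scale a^* O.
  apply/seteqP; split => x.
    move/conj_split_ideal; rewrite opprK E => -[y Oy e]; exists y^*; first exact: O_conj.
    by rewrite -[x]conjCK -e rmorphM.
  move=> [y Oy <-]; have [_ _ hM] := omod_exp KF m (split_ideal_omod (-1)).
  rewrite (mulrC a^*); apply: hM; first exact: Oy.
  exact: (conj_split_ideal Ia).
have := split_ideal_exp_mul m; rewrite E E' scale_mull scale_mulr (ideal_mulO KF) ?scaleA; last exact: omod_O.
have Oa := split_ideal_exp_sub Ia.
have [n nE] := norm_nat b_gt0 Oa; rewrite nE => EE.
have int_quot (x y : nat) : (0 < y)%N -> scale (y%:R : algC) O x%:R -> (y %| x)%N.
  move=> y0 [u [_ Au] yu]; have y0' : (y%:R : rat) != 0 by rewrite pnatr_eq0 -lt0n.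
  have uE : u = ratr (x%:R / y%:R).
    apply: (@mulfI _ (y%:R : algC)); first by rewrite pnatr_eq0 -lt0n.
    by rewrite yu -[y%:R in RHS](rmorph_nat (ratr : {rmorphism rat -> algC})) -rmorphM /= mulrC divfK // rmorph_nat.
  rewrite uE in Au; have [w wE] := Aint_ratr Au.
  have : x%:Z = w * y%:Z.
    apply: (@intr_inj rat); rewrite rmorphM /= -!pmulrn -wE divfK //.
  by move=> xw; have : (y%:Z %| x%:Z)%Z by rewrite xw dvdz_mull.
have n0 : (0 < n)%N.
  by rewrite -(ltr0n algC) -nE -normCK exprn_gt0 // normr_gt0.
have Cm0 : (0 < C ^ m)%N by rewrite expn_gt0 C_gt0.
congr (_%:R); apply/eqP; rewrite eqn_dvd; apply/andP; split; apply: int_quot => //.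
  by rewrite EE natrX; exists 1; [exact: O1|rewrite mulr1].
by rewrite natrX -EE; exists 1; [exact: O1|rewrite mulr1].
Qed.

(* (O / 2O)^* has order 1 or 3, so cubes of elements of odd norm lie in Z[s]. *)
Lemma cube_integral a n : O a -> a * a^* = n%:R -> odd n ->
  exists x y : int, a ^+ 3 = q x%:~R y%:~R.
Proof.
move=> Oa; have [x [y [u [N [-> hx hN]]]]] := O_struct b_gt0 Oa.
rewrite norm_qelt // hN ratr_int => nE on.
have {nE} NE : N = n%:Z by apply: (@intr_inj algC); rewrite nE.
(* b (2y)^2 is an integer and b is squarefree, so the denominator of 2y is 1. *)
have [v hv] : exists v : int, 2 * y = v%:~R.
  have e : b%:R * (2 * y) ^+ 2 = (4 * N - u ^+ 2)%:~R :> rat.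
    by rewrite rmorphB rmorphM rmorphXn /= -hN -hx; ring.
  have dd : (denq (2 * y) ^+ 2 %| b%:Z * numq (2 * y) ^+ 2)%Z.
    apply/dvdzP; exists (4 * N - u ^+ 2); apply: (@intr_inj rat).
    rewrite [RHS]intrM -e intrM !rmorphXn /= -[X in _ = b%:R * X ^+ 2 * _](divq_num_den (2 * y)).
    rewrite -[b%:Z%:~R]/(b%:R).
    by field; rewrite intq_eq0 denq_neq0.
  have d2 : (denq (2 * y) ^+ 2 %| b%:Z)%Z.
    move: dd; rewrite Gauss_dvdzl // coprimezE !abszX coprimeXl // coprimeXr // coprime_sym.
    exact: coprime_num_den.
  have d1 : denq (2 * y) = 1.
    have dn : denq (2 * y) = `|denq (2 * y)|%N%:Z by rewrite gez0_abs // denq_ge0.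
    rewrite dn; congr Posz; apply/eqP; apply: contraT => d1.
    set d := `|denq (2 * y)|%N in d1 dn.
    have d0 : (0 < d)%N by rewrite absz_gt0 denq_neq0.
    have dd1 : (1 < d)%N by clear -d1 d0; lia.
    have /squarefreeP h := b_sqf; have /negP := h b_gt0 _ (pdiv_prime dd1); case.
    move: d2; rewrite dvdzE abszX => d2.
    by apply: dvdn_trans d2; rewrite dvdn_exp2r // pdiv_dvd.
  by exists (numq (2 * y)); rewrite -[LHS]divq_num_den d1 divr1.
have key : u ^+ 2 + b%:Z * v ^+ 2 = 4 * n%:Z.
  apply: (@intr_inj rat); rewrite intrD rmorphXn /= (intrM _ b%:Z) rmorphXn (intrM _ 4) /= -hx -hv.
  have <- : (N%:~R : rat) = (n%:Z)%:~R by rewrite NE.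
  by rewrite -hN; ring.
have b_not4 : ~~ (4 %| b)%N by have /squarefreeP h := b_sqf; exact: (h b_gt0 2%N isT).
have par (m : int) : exists k, m = 2 * k \/ m = 2 * k + 1.
  by exists (m %/ 2)%Z; lia.
have [n' nE] : exists k : int, n%:Z = 2 * k + 1.
  by exists n./2%:Z; lia.
have [u' uE] := par u; have [v' vE] := par v.
(* With a = (u + vs)/2 and u^2 + b v^2 = 4n, the coordinates of the cube are u (n - b v^2)/2 and v
   (u^2 - n)/2; it remains to see that both numerators are even. *)
have [A hA] : exists A : int, u * (n%:Z - b%:Z * v ^+ 2) = 2 * A.
  case: uE => uE; first by exists (u' * (n%:Z - b%:Z * v ^+ 2)); rewrite [in LHS]uE; ring.
  exists (u * (n' - 2 * (n%:Z - u' ^+ 2 - u') + 1)).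
  have -> : b%:Z * v ^+ 2 = 4 * n%:Z - u ^+ 2 by rewrite -key; ring.
  by rewrite uE nE; ring.
have [B hB] : exists B : int, v * (u ^+ 2 - n%:Z) = 2 * B.
  case: vE => vE; first by exists (v' * (u ^+ 2 - n%:Z)); rewrite [in LHS]vE; ring.
  (* For v odd, an even u would give 4 | b. *)
  case: uE => uE.
    have : (4%:Z %| b%:Z)%Z.
      apply/dvdzP; exists (n%:Z - u' ^+ 2 - b%:Z * (v' ^+ 2 + v')).
      transitivity (4 * n%:Z - u ^+ 2 - b%:Z * (v ^+ 2 - 1)); first by rewrite -key; ring.
      rewrite -[4%:Z]/(4 : int).
      by rewrite uE vE; ring.
    by rewrite dvdzE /= (negbTE b_not4).
  by exists (v * (2 * (u' ^+ 2 + u') - n')); rewrite uE nE; ring.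
exists A, B.
have two : (2 : rat) != 0 by [].
have xE : x = u%:~R / 2 by rewrite -hx mulrC mulKf.
have yE : y = v%:~R / 2 by rewrite -hv mulrC mulKf.
have hk : (b%:R : rat) * v%:~R ^+ 2 = 4 * n%:R - u%:~R ^+ 2.
  have := congr1 (fun m : int => m%:~R : rat) key.
  by rewrite intrD rmorphXn /= (intrM _ b%:Z) rmorphXn (intrM _ 4) /= => h; rewrite -[4 * n%:R]h; ring.
have AE : (A%:~R : rat) = u%:~R * (n%:R - b%:R * v%:~R ^+ 2) / 2.
  have := congr1 (fun m : int => m%:~R : rat) hA.
  by rewrite (intrM _ u) intrB (intrM _ b%:Z) rmorphXn (intrM _ 2) /= => ->; rewrite mulrC mulKf.
have BE : (B%:~R : rat) = v%:~R * (u%:~R ^+ 2 - n%:R) / 2.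
  have := congr1 (fun m : int => m%:~R : rat) hB.
  by rewrite (intrM _ v) intrB rmorphXn (intrM _ 2) /= => ->; rewrite mulrC mulKf.
rewrite exprS expr2 !qeltM AE BE xE yE; move: hk; move: (u%:~R : rat) (v%:~R : rat) (b%:R : rat) (n%:R : rat) => U V c m hk.
have hm : m = (c * V ^+ 2 + U ^+ 2) / 4 by rewrite hk; field.
by rewrite hm; congr qelt; field.
Qed.

(** (r + s)^2 = 2r (r + s) - (r^2 + b), so modulo r^2 + b each further power multiplies r + s by
    2r. *)
Lemma root_power k : exists w, O w /\
  (r%:~R + 1%:~R * s) ^+ k.+1 = ((2 * r) ^+ k)%:~R * (r%:~R + 1%:~R * s) + (r ^+ 2 + b%:Z)%:~R * w.
Proof.
elim: k => [|k [w [Ow IH]]].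
  by exists 0; split; [exact: O0|rewrite expr1 expr0 !mulr1z !mul1r mulr0 addr0].
exists ((r%:~R + 1%:~R * s) * w - ((2 * r) ^+ k)%:~R); split.
  by apply: (OB KF); [apply: (OM KF) => //; exact: O_root|exact: O_int].
rewrite exprS IH; move: (s) (sqr_s b) => z hz.
have bE : (b%:Z%:~R : algC) = - (z * z) by rewrite hz opprK.
have DE : (r ^+ 2 + b%:Z)%:~R = r%:~R ^+ 2 - z * z :> algC.
  by rewrite intrD bE rmorphXn.
have PE : ((2 * r) ^+ k.+1)%:~R = 2 * r%:~R * ((2 * r) ^+ k)%:~R :> algC.
  by rewrite exprS intrM (intrM _ 2 r).
rewrite PE DE mulr1z; move: (_%:~R : algC) (r%:~R : algC) => P R'.
by ring.
Qed.

(** Modulo p the coordinate of s in this power is (2r)^k, which is prime to p, and so is the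
    denominator 2b of integral elements. *)
Lemma not_dvd_root_power p k : prime p -> (p %| C)%N ->
  ~ exists2 w, O w & (r%:~R + 1%:~R * s) ^+ k.+1 = p%:R * w.
Proof.
move=> pp pC [w Ow e]; have [np p2] := dvd_prime_root pp pC.
have p0 : (p%:R : rat) != 0 by rewrite pnatr_eq0 -lt0n prime_gt0.
have p0' : (p%:R : algC) != 0 by rewrite pnatr_eq0 -lt0n prime_gt0.
have [w1 [Ow1 e1]] := root_power k.
have /dvdzP[c cE] : (p%:Z %| r ^+ 2 + b%:Z)%Z by apply: (dvdz_trans _ C_dvd); rewrite dvdzE.
have Ow2 : O (w - c%:~R * w1) by apply: (OB KF) => //; apply: (OM KF) => //; exact: O_int.
have [u [v E]] := O_denominator b_gt0 Ow2.
have qE : ((2 * r) ^+ k)%:~R * (r%:~R + 1%:~R * s) = q (((2 * r) ^+ k)%:~R * r%:~R) ((2 * r) ^+ k)%:~R.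
  by rewrite /qelt [ratr (_ * _)]rmorphM /= !ratr_int mulrDr mul1r.
have pE : p%:R * (w - c%:~R * w1) = q (((2 * r) ^+ k)%:~R * r%:~R) ((2 * r) ^+ k)%:~R.
  rewrite -qE mulrBr -e e1 cE intrM -[p%:Z%:~R]/(p%:R).
  by ring.
have pq : (p%:R : algC) = q p%:R 0 by rewrite /qelt rmorph0 mul0r addr0 rmorph_nat.
move: pE; rewrite E pq qeltM => /(qelt_inj b_gt0)[_]; rewrite mul0r addr0 => e3.
have : (p%:Z %| (2 * r) ^+ k * (2 * b%:Z))%Z.
  apply/dvdzP; exists v; apply: (@intr_inj rat); rewrite !intrM -e3 -[p%:Z%:~R]/(p%:R).
  rewrite -[2%:~R]/(2%:R) -[b%:Z%:~R]/(b%:R).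
  by field; rewrite pnatr_eq0 -lt0n.
have nb : ~~ (p%:Z %| 2 * b%:Z)%Z.
  rewrite Euclid_dvdzM // negb_or !dvdzE /=; apply/andP; split.
    by apply/negP => /dvdn_leq; lia.
  apply/negP => pb; have : (p %| gcdn C b)%N by rewrite dvdn_gcd pC pb.
  by rewrite (eqP C_cop) dvdn1 => /eqP p1; rewrite p1 in pp.
rewrite Euclid_dvdzM // (negbTE nb) orbF.
elim: (k) => [|j IH]; first by rewrite expr0 dvdzE /= dvdn1; case: (p) pp => [|[|]].
by rewrite exprS Euclid_dvdzM // (negbTE np).
Qed.

Theorem primitive_solution n : prime n -> (3 < n)%N -> trivial_torsion K n ->
  has_primitive_int_sol n b%:Z C%:Z.
Proof.
move=> pn n3 triv; have oI := split_ideal_omod 1.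
pose P m := `[< (0 < m)%N /\ exists a, [/\ K a, a != 0 & cc ^^ m = scale a O] >].
have exP : exists m, P m.
  by have [m [a [m0 h1 h2 h3]]] := split_ideal_order; exists m; apply/asboolP; split => //; exists a.
case: (ex_minnP exP) => m /asboolP[m0 [a [Ka a0 E]]] hmin.
(* If n divided m, the power m/n of the ideal would have an n-torsion class, hence be principal,
   against the minimality of m. *)
have nm : ~~ (n %| m)%N.
  apply/negP => /dvdnP[m' mE].
  have m'0 : (0 < m')%N by move: m0; rewrite mE muln_gt0 => /andP[].
  have fm := fractional_exp KF m' (split_ideal_fractional 1).
  have e : ideal_class K ((cc ^^ m') ^^ n) = ideal_class K O.
    rewrite -ideal_expM // -mE E; apply/esym/(ideal_class_eqP KF); by exists a.
  have /esym/(ideal_class_eqP KF)[c [Kc c0 Ec]] := triv _ fm e.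
  have : P m' by apply/asboolP; split => //; exists c.
  move/hmin; rewrite mE leqNgt ltn_Pmulr //; exact: leq_ltn_trans n3.
have cop : coprime (3 * m) n.
  rewrite coprime_sym prime_coprime // Euclid_dvdM // negb_or nm andbT.
  by rewrite dvdn_prime2 //; lia.
have m30 : (0 < 3 * m)%N by rewrite muln_gt0.
case: (egcdnP n m30) => e j; rewrite (eqP cop) addn1 => ej _.
have aN := generator_norm Ka a0 E.
have Oa : O a.
  by apply: (@split_ideal_exp_sub 1 m); rewrite E; exists 1; [exact: O1|rewrite mulr1].
have [x3 [y3 a3]] : exists x y : int, a ^+ 3 = q x%:~R y%:~R.
  by apply: cube_integral Oa aN _; rewrite oddX C_odd orbT.
have [x [y gE]] : exists x y : int, (a ^+ 3) ^+ e = q x%:~R y%:~R.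
  rewrite a3; elim: (e) => [|k [x [y IH]]].
    by exists 1, 0; rewrite expr0 /qelt rmorph0 mul0r addr0 rmorph1.
  exists (x3 * x - b%:Z * (y3 * y)), (x3 * y + y3 * x).
  by rewrite exprS IH qeltM intrB intrD !(intrM _ b%:Z) !(intrM _ x3) !(intrM _ y3).
have e0 : (0 < e)%N by case: (e) ej => //; lia.
have norm_xy : x ^+ 2 + b%:Z * y ^+ 2 = (C ^ (j * n + 1))%N%:Z.
  apply: (@intr_inj algC); rewrite -[RHS]/((C ^ (j * n + 1))%N%:R).
  have : q x%:~R y%:~R * (q x%:~R y%:~R)^* = (C ^ (j * n + 1))%N%:R.
    have -> : q x%:~R y%:~R = a ^+ (3 * e) by rewrite -gE exprM.
    have -> : (a ^+ (3 * e))^* = a^* ^+ (3 * e) by rewrite rmorphXn.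
    rewrite -exprMn aN -natrX -expnM addn1 -ej; congr (_ ^ _)%N%:R; ring.
  rewrite norm_qelt // => <-; rewrite -[LHS](ratr_int algC); congr ratr.
  by rewrite intrD rmorphXn /= (intrM _ b%:Z) rmorphXn.
exists x, y, (C ^ j)%N%:Z; split; last first.
  rewrite norm_xy addn1 expnS PoszM; congr (_ * _).
  by rewrite -!natz -natrX expnM.
have powE : cc ^^ (m * (3 * e)) = scale (q x%:~R y%:~R) O.
  by rewrite ideal_expM // E scale_exp ?exp_O -?gE -?exprM //; exact: omod_O.
apply/eqP; apply: contraT => g1.
set g := gcdz _ _ in g1.
have g0 : (0 < `|g|)%N.
  rewrite absz_gt0 gcdz_eq0 negb_and; apply/orP; right.
  by rewrite eqz_nat -lt0n expn_gt0 C_gt0.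
have g2 : (1 < `|g|)%N.
  by move: g1 g0; rewrite /g /gcdz /=; lia.
set p := pdiv `|g|; have pp : prime p := pdiv_prime g2.
have pg : (p%:Z %| g)%Z by rewrite dvdzE pdiv_dvd.
have /andP[/andP[px py] pz] : [&& (p%:Z %| x)%Z && (p%:Z %| y)%Z & (p%:Z %| (C ^ j)%N%:Z)%Z].
  by move: pg; rewrite !dvdz_gcd.
have pC : (p %| C)%N by move: pz; rewrite dvdzE /= Euclid_dvdX // => /andP[].
have [k kE] : exists k, (m * (3 * e) = k.+1)%N.
  by exists (m * (3 * e)).-1; rewrite prednK // !muln_gt0 m0.
exfalso; apply: (@not_dvd_root_power p k pp pC).
(* Primitivity: this power of r + s is a multiple of x + ys, so a prime dividing x, y and C would
   divide it, which [not_dvd_root_power] excludes. *)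
have : (cc ^^ (m * (3 * e))) ((r%:~R + 1%:~R * s) ^+ k.+1).
  rewrite kE; elim: (k.+1) => [|i IH]; first exact: O1.
  by rewrite exprS; apply: ideal_mul_mem => //; exact: split_ideal_root.
rewrite powE => -[w Ow <-].
have /dvdzP[x' xE] := px; have /dvdzP[y' yE] := py.
exists (q x'%:~R y'%:~R * w); first by apply: (OM KF) => //; exact: O_zelt.
have pq : (p%:R : algC) = q p%:R 0 by rewrite /qelt rmorph0 mul0r addr0 rmorph_nat.
rewrite mulrA; congr (_ * _); rewrite pq qeltM xE yE !intrM -[p%:Z%:~R]/(p%:R); congr qelt; ring.
Qed.

End SplitIdeal.

(** * The global count *)

(** The proportion of integers that are not squarefree is at most the sum of 1/p^2 over primes,
    bounded by 1/4 for p = 2 plus the sum over all odd d >= 3, which telescopes to at most 1/4. *)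
Lemma sqfree_half (R : realType) N :
  (N%:R : R) <= 2 * (size (rng squarefree N))%:R.
Proof.
pose ns := rng (fun x => ~~ squarefree x) N.
have tot : (size (rng squarefree N) + size ns = N)%N.
  rewrite /ns !size_filter -[RHS](size_iota 1) -(count_predC squarefree).
  by rewrite /index_iota subn1.
suff h : (size ns)%:R <= (N%:R : R) / 2.
  have <- : ((size (rng squarefree N) + size ns)%N%:R : R) = N%:R by rewrite tot.
  by move: h; rewrite -{1}tot natrD; lra.
pose D := 2%N :: [seq k.*2.+1 | k <- rng predT N].
have cnt : ((size ns)%:R : R) <= \sum_(d <- D) \sum_(y <- rng predT (N %/ d ^ 2)) 1.
  have -> : ((size ns)%:R : R) = \sum_(x <- ns) 1 by rewrite big_const_seq count_predT iter_addr_0.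
  apply: (@ler_sum_pairs R _ _ _ D (fun d => rng predT (N %/ d ^ 2)%N) ns (fun d y => y * d ^ 2)%N (fun=> 1)) => //.
    exact: rng_uniq.
  move=> x; rewrite mem_rng => /and3P[nx x0 xN].
  have [p pp px] : exists2 p, prime p & (p ^ 2 %| x)%N.
    apply: contrapT => H; move/negP: nx; apply; apply/squarefreeP => // p pp.
    by apply/negP => px; apply: H; exists p.
  have p0 : (0 < p ^ 2)%N by rewrite expn_gt0 prime_gt0.
  exists p, (x %/ p ^ 2)%N; rewrite divnK // mem_rng /= divn_gt0 // dvdn_leq //= leq_div2r //.
  split => //; rewrite inE; case/even_prime: (pp) => [->//|op]; apply/orP; right.
  apply/mapP; exists p./2; last by lia.
  have pN : (p <= N)%N.
    by apply: leq_trans xN; apply: leq_trans (dvdn_leq x0 px); rewrite -mulnn leq_pmulr // prime_gt0.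
  by have p1 := prime_gt1 pp; rewrite mem_rng /=; clear -op p1 pN; lia.
apply: le_trans cnt _.
apply: le_trans (_ : \sum_(d <- D) N%:R * (d%:R ^+ 2)^-1 <= _).
  rewrite big_seq [leRHS]big_seq; apply: ler_sum => d dD.
  have d0 : (0 < d)%N by move: dD; rewrite inE => /orP[/eqP->//|/mapP[k _ ->]].
  rewrite big_const_seq count_predT iter_addr_0 /rng filter_predT size_iota subn1 /=.
  by rewrite ler_pdivlMr ?exprn_gt0 ?ltr0n // -natrX -natrM ler_nat leq_divM.
rewrite -mulr_sumr ler_wpM2l // /D big_cons big_map -sum_rng.
have h K : \sum_(1 <= k < K.+1) (k.*2.+1%:R ^+ 2)^-1 <= 4^-1 - (4 * K.+1%:R)^-1 :> R.
  elim: K => [|K IH]; first by rewrite big_nil mulr1 subrr.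
  rewrite big_nat_recr //=; apply: le_trans (lerD IH (lexx _)) _.
  have -> : ((K.+1).*2.+1%:R : R) = 2 * K.+1%:R + 1 by rewrite -natr1 -mul2n natrM.
  rewrite -(natr1 K.+1); have : (0 : R) < K.+1%:R by rewrite ltr0n.
  move: (K.+1%:R) => y y0.
  suff : ((2 * y + 1) ^+ 2)^-1 <= (4 * y)^-1 - (4 * (y + 1))^-1 by lra.
  have -> : (4 * y)^-1 - (4 * (y + 1))^-1 = (4 * y * (y + 1))^-1.
    by field; rewrite !gt_eqF //; lra.
  have y1 : 0 < 4 * y * (y + 1) by rewrite !mulr_gt0 //; lra.
  rewrite lef_pV2 ?posrE ?exprn_gt0 //; last lra.
  by rewrite -subr_ge0; have -> : (2 * y + 1) ^+ 2 - 4 * y * (y + 1) = 1 by ring.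
apply: le_trans (lerD (lexx _) (h N)) _.
have : 0 <= (4 * N.+1%:R)^-1 :> R by rewrite invr_ge0 mulr_ge0.
move: (_^-1) => z z0; have -> : (2%:R ^+ 2)^-1 = 4^-1 :> R by congr (_^-1); ring.
lra.
Qed.

(** Four terms suffice: 1 + 1/4 + 1/9 + 1/16 > 7/5. *)
Lemma zeta2_ge (R : realType) : 7 / 5 <= zeta2 R.
Proof.
pose u (k : nat) : R := (k.+1%:R ^+ 2)^-1.
have u0 k : 0 <= u k by rewrite invr_ge0 exprn_ge0.
have mono : {homo series u : n m / (n <= m)%N >-> n <= m}.
  by apply: nondecreasing_series => *; exact: u0.
have cv : cvgn (series u).
  apply: nondecreasing_is_cvgn => //; exists 2 => _ [n _ <-].
  rewrite /series /=; apply: le_trans (sum_inv_sq_le2 R n).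
  by rewrite big_add1.
have := nondecreasing_cvgn_le mono cv 4%N; apply: le_trans.
rewrite /series /= !big_nat_recr //= big_geq // /u add0r.
have -> : (1%:R ^+ 2)^-1 = 1 :> R by rewrite expr1n invr1.
lra.
Qed.

(** Split primes do not divide b, since [rho] is 1 at primes that do. Square roots of -b modulo the
    primes of c are glued by the Chinese remainder theorem. *)
Lemma crt_root b c : oddsqf_all (splits b) c ->
  coprime c b /\ exists r : int, (c%:Z %| r ^+ 2 + b%:Z)%Z.
Proof.
case/oddsqf_allP => oc hc.
have nb p : prime p -> (p %| c)%N -> ~~ (p %| b)%N.
  move=> pp /(hc _ pp) /eqP e; apply/negP => pb.
  by move: e; rewrite rho0.
split.
  apply: contraT => ncop; have g0 : (0 < gcdn c b)%N by rewrite gcdn_gt0 (oddsqf_gt0 oc).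
  have g1 : (1 < gcdn c b)%N by move: ncop; rewrite /coprime; clear -g0; lia.
  have pg := pdiv_dvd (gcdn c b); have pp := pdiv_prime g1.
  by have := nb _ pp (dvdn_trans pg (dvdn_gcdl _ _)); rewrite (dvdn_trans pg (dvdn_gcdr _ _)).
move: c oc hc {nb}; apply: oddsqf_ind => [_|p m pp op pm om IH hc].
  by exists 0; exact: dvd1z.
have [r2 h2] : exists r : int, (m%:Z %| r ^+ 2 + b%:Z)%Z.
  by apply: IH => l pl lm; apply: hc => //; rewrite dvdn_mull.
have [y hy] : exists y : int, (p%:Z %| y ^+ 2 + b%:Z)%Z.
  have /eqP e : splits b p by apply: hc => //; rewrite dvdn_mulr.
  have : (0 < rho p b%:Z)%N by rewrite e.
  by rewrite -has_count => /hasP[y _ hy]; exists y%:Z.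
have cop : coprimez p%:Z m%:Z by rewrite coprimezE /= prime_coprime.
exists (zchinese p m y r2); rewrite PoszM Gauss_dvdz //.
have key (d : nat) (w : int) : (zchinese p m y r2 = w %[mod d])%Z -> (d%:Z %| w ^+ 2 + b%:Z)%Z ->
    (d%:Z %| zchinese p m y r2 ^+ 2 + b%:Z)%Z.
  move=> e h; have -> : zchinese p m y r2 ^+ 2 + b%:Z = (w ^+ 2 + b%:Z) + (zchinese p m y r2 ^+ 2 - w ^+ 2) by ring.
  by rewrite rpredD // -eqz_mod_dvd -modzXm e modzXm.
by rewrite (key p y) ?zchinese_modl // (key m r2) ?zchinese_modr.
Qed.

Lemma counting_ge (T : choiceType) (R : realType) (A : set T) (l : seq T) :
  uniq l -> (forall x, x \in l -> A x) -> ((size l)%:R%:E <= @counting T R A)%E.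
Proof.
move=> ul hl; rewrite /counting; case: asboolP => [fA|_]; last exact: leey.
rewrite lee_fin ler_nat; apply: uniq_leq_size => // x xl.
by rewrite in_fset_set // inE; exact: hl.
Qed.

Definition torsion_free_at (n B : nat) : bool :=
  `[< trivial_torsion (quadratic_field (-1 * B%:Z)) n >].

(** The trivial class contributes 1 for every B, and a nontrivial class brings at least 2 more
    elements. *)
Lemma torsion_sum_ge (R : realType) n (T : R) (N := Num.truncn T) : odd n -> (1 < n)%N ->
  (((size (rng squarefree N))%:R +
    2 * (size (rng (fun B => squarefree B && ~~ torsion_free_at n B) N))%:R)%:E <=
   torsion_sum n (-1) T)%E.
Proof.
move=> on n1; pose bad B : R := if torsion_free_at n B then 0 else 1.
have -> : (size (rng squarefree N))%:R +
    2 * (size (rng (fun B => squarefree B && ~~ torsion_free_at n B) N))%:R =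
    \sum_(B <- rng squarefree N) (1 + 2 * bad B).
  rewrite big_split /= big_const_seq count_predT iter_addr_0 -mulr_sumr; congr (_ + 2 * _).
  rewrite -!sum1_size !natr_sum !big_filter big_mkcondr /=.
  by apply: eq_bigr => B _; rewrite /bad; case: (torsion_free_at n B).
rewrite /torsion_sum -[leRHS]big_filter -/(rng squarefree N) -sumEFin.
rewrite big_seq [leRHS]big_seq; apply: lee_sum => B; rewrite mem_rng => /and3P[_ B0 _].
pose K := quadratic_field (-1 * B%:Z); have KF : subfield_set K := K_subfield B0.
pose c0 := ideal_class K (ring_of_integers K).
have c0in : class_group_torsion K n c0.
  exists (ring_of_integers K) => //; split; first exact: fractional_O.
  by rewrite exp_O.
rewrite /bad /torsion_free_at; case: asboolP => [_|ntriv].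
  rewrite mulr0 addr0; apply: (@counting_ge _ R _ [:: c0]) => // x.
  by rewrite inE => /eqP ->.
have [c1 [c2 [h1 h2 n1' n2 n3]]] := nontrivial_torsion KF on n1 ntriv.
have -> : 1 + 2 * 1 = (size [:: c0; c1; c2])%:R :> R by rewrite /=; ring.
apply: counting_ge; last by move=> x; rewrite !inE => /or3P[] /eqP ->.
rewrite !cons_uniq !in_cons !in_nil !orbF negb_or; do ![apply/andP; split] => //.
- by apply/eqP => e; apply: n1'; rewrite -e.
- by apply/eqP => e; apply: n2; rewrite -e.
- by apply/eqP.
Qed.

(** With Q squarefree B, of which g are torsion-free, the average gives 3Q - 2g <= 1.01 *
    2T/zeta(2). As Q >= N/2 and 2/zeta(2) <= 10/7, the margin between 3/2 and 1.443 leaves g >=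
    N/40; N >= 250 absorbs the difference between T and N. *)
Lemma torsion_free_density (R : realType) n : odd n -> (1 < n)%N ->
  asymptotically (torsion_sum n (-1)) (fun T : R => 2 * T / zeta2 R) ->
  exists T0 : R, forall T, T0 < T ->
    (Num.truncn T)%:R <= 40 *
      (size (rng (fun B => squarefree B && torsion_free_at n B) (Num.truncn T)))%:R :> R.
Proof.
move=> on n1 avg.
have nb : nbhs (1%:E : \bar R) [set y | (y < (101 / 100)%:E)%E].
  by apply: open_nbhs_nbhs; split; [exact: open_ereal_lt_ereal|rewrite /= lte_fin; lra].
have [T1 [_ hT1]] := avg _ nb.
exists (Num.max T1 250%:R) => T; rewrite gt_max => /andP[TT1 T250].
have T0 : 0 < T by apply: lt_trans T250; rewrite ltr0n.
set N := Num.truncn T.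
have /andP[_ TN] := truncn_itv (ltW T0); rewrite -/N in TN.
have z0 := zeta2_ge R; have zp : 0 < zeta2 R by lra.
have gp : 0 < 2 * T / zeta2 R by rewrite divr_gt0 // mulr_gt0.
have := ltW (hT1 _ TT1); rewrite /= lee_pdivrMr // => h.
have {h} := le_trans (torsion_sum_ge T on n1) h; rewrite -EFinM lee_fin -/N.
set Q := (size (rng squarefree N))%:R.
set bad := (size (rng (fun B => _ && ~~ _) N))%:R.
set good := (size (rng (fun B => _ && torsion_free_at n B) N))%:R => h.
have QE : Q = good + bad.
  rewrite /Q /good /bad -natrD -!sum1_size !big_filter [in LHS](bigID (torsion_free_at n)) /=.
  by [].
have hN := sqfree_half R N; rewrite -/Q in hN.
have N251 : 250%:R <= (N%:R : R).
  by rewrite ler_nat -ltnS -(ltr_nat R); apply: lt_trans T250 TN.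
have h2 : 2 * T / zeta2 R <= 10 / 7 * T.
  rewrite ler_pdivrMr //; apply: le_trans (_ : (10 / 7 * T) * (7 / 5) <= _).
    by lra.
  by rewrite ler_pM2l // mulr_gt0.
move: h h2 hN QE TN N251; rewrite -(natr1 N).
move: (2 * T / zeta2 R) Q good bad (N%:R : R) => w q g bd m h h2 hN QE TN N251.
lra.
Qed.

(** The product count is at least of order 16^(30 k) / k times the split sum, which is itself at
    least of order sqrt(k). *)
Lemma split_products_lower (R : realType) : exists2 c : R, 0 < c &
  forall b k, (0 < k)%N -> split_ok k b ->
    recip_sum R (oddsqf_all (predC (splits b))) (16 ^ k).-1 <= 1200 * Num.sqrt k%:R ->
    c * (16 ^ (30 * k))%:R <=
      (size (rng (oddsqf_all (splits b)) (16 ^ (30 * k)).-1))%:R * Num.sqrt k%:R.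
Proof.
pose A : R := (16 ^ 4)%:R; pose E : R := (16 * 15)%:R; pose F : R := 1800.
pose B : R := (256 * 8%:R)^-1 * (256 * 10%:R)^-1.
have A0 : 0 < A by rewrite ltr0n expn_gt0.
have E0 : 0 < E by rewrite ltr0n.
have F0 : 0 < F by rewrite ltr0n.
have B0 : 0 < B by rewrite /B -invfM invr_gt0 -!natrM ltr0n.
exists (B / (A * E * F)); first by rewrite divr_gt0 // !mulr_gt0.
move=> b k k0 ok hG.
have k0' : (0 : R) < k%:R by rewrite ltr0n.
have hH := split_sum_ge k0 hG.
have := @split_products_count R b k k0 (fun j hj => split_okP ok hj).
rewrite mulnA natrM -/A -/E -/B.
move: hH; rewrite -/F; move: (recip_sum _ _ _) => H hH.
move: ((size _)%:R) => S; move: ((16 ^ (30 * k))%N%:R : R) (ler0n R (16 ^ (30 * k))) => M M0 hS.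
have sq : Num.sqrt k%:R * Num.sqrt k%:R = k%:R :> R by rewrite -expr2 sqr_sqrtr // ltW.
have sq0 : 0 < Num.sqrt (k%:R : R) by rewrite sqrtr_gt0.
apply: le_trans (ler_wpM2r (ltW sq0) hS).
move: hH sq sq0; move: (Num.sqrt _) => x hH sq sq0; rewrite -sq.
clearbody A E F B; clear -A0 E0 F0 B0 M0 hH sq0.
have hH' : x / F <= H by rewrite ler_pdivrMr // mulrC.
apply: le_trans (_ : M / (A * (E * (x * x))) * (x / F * B) * x <= _).
  by rewrite le_eqVlt; apply/orP; left; apply/eqP; field; rewrite !gt_eqF.
apply: ler_wpM2r; first exact: ltW.
apply: ler_wpM2l; first by rewrite divr_ge0 // !mulr_ge0 // ltW.
by apply: ler_wpM2r => //; exact: ltW.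
Qed.

(** Serves to certify that the counted sets of pairs are finite. *)
Definition int_box (N : nat) : seq int :=
  [seq s * i%:Z | s <- [:: 1; -1 : int], i <- iota 0 N.+1].

Lemma mem_int_box N (x : int) : (`|x| <= N)%N -> x \in int_box N.
Proof.
move=> xN; suff [s si xE] : exists2 s : int, s \in [:: 1; -1] & x = s * `|x|%N%:Z.
  rewrite xE; apply: (@allpairs_f_dep _ _ _ (fun (s : int) (i : nat) => s * i%:Z)) => //.
  by rewrite mem_iota add0n ltnS.
case: (lerP 0 x) => x0; first by exists 1; rewrite ?mul1r ?gez0_abs ?inE.
by exists (-1); rewrite ?inE ?eqxx ?orbT // mulN1r ltz0_abs // opprK.
Qed.

Lemma count_pairs_ge (R : realType) (P : int -> int -> Prop) (T : R) (l : seq (int * int)) :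
  uniq l -> (forall z, z \in l -> [/\ z.1 != 0, z.2 != 0, `|z.1|%:~R < T,
    `|z.2|%:~R < T & P z.1 z.2]) -> (size l <= count_pairs P T)%N.
Proof.
move=> ul hl; apply: (@card_fset_set_ge _ _ l
  [seq (x, y) | x <- int_box (Num.truncn T), y <- int_box (Num.truncn T)]) => //.
move=> -[x y] [_ _ xT yT _]; apply/allpairsPdep; exists x, y.
by split => //; apply: mem_int_box; exact: abs_lt_truncn.
Qed.

(** The pair B = C = 1 has the solution (1, 0, 1), whose primitivity is read off modulo p. *)
Lemma N_loc_gt0 (R : realType) n (T : R) : 1 < T -> (0 < N_loc n T)%N.
Proof.
move=> T1; apply: (@count_pairs_ge _ _ T [:: (1, 1)]) => // z.
rewrite inE => /eqP -> /=; split => // p pp.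
exists 1, 0, 1; split; last by rewrite !expr1n mulr1 expr0n mulr0 addr0.
move=> [x' [y' [z' [e _ _]]]].
have := congr1 (fun u : padic_int p => u 1%N) e.
rewrite padic_oneE padic_mulE padic_natE modzMml expr1 modzMr modz_small //.
by rewrite /= ltz_nat prime_gt1.
Qed.

Definition typical (R : realType) n k b := [&& (0 < b)%N, squarefree b, torsion_free_at n b,
  split_ok k b & recip_sum R (oddsqf_all (predC (splits b))) (16 ^ k).-1 <= 1200 * Num.sqrt k%:R].

(** A proportion 1/40 - 2/100 = 1/200 remains, up to one integer, and N >= 400 lets half of it
    absorb that integer. *)
Lemma typical_count (R : realType) n k N : (9 <= k)%N ->
  (16 ^ (30 * k) <= N < 16 ^ (30 * k.+1))%N -> (400 <= N)%N ->
  (N%:R : R) <= 40 * (size (rng (fun B => squarefree B && torsion_free_at n B) N))%:R ->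
  (N%:R : R) <= 400 * (size [seq b <- iota 0 N | typical R n k b])%:R.
Proof.
move=> k9 hN N400 hgood.
have kN : (16 ^ k <= N)%N.
  by case/andP: hN => hN _; apply: leq_trans hN; rewrite leq_exp2l //; clear -k9; lia.
have k0 : (0 < k)%N by clear -k9; lia.
have h1 := split_fail_rare R k9 hN; have h2 := nonsplit_sum_large_rare R k0 kN.
move: h1 h2; set bad1 := fun x => _; set bad2 := fun x => _ => h1 h2.
(* The summand 1 accounts for b = N, which [iota 0 N] omits. *)
have sub : (size (rng (fun B => squarefree B && torsion_free_at n B) N) <=
   size [seq b <- iota 0 N | typical R n k b] + (1 + (count bad1 (iota 0 N) + count bad2 (iota 0 N))))%N.
  rewrite -!size_filter -(size_nseq 1 N) -!size_cat.
  apply: uniq_leq_size; first exact: rng_uniq.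
  move=> b; rewrite mem_rng => /and3P[/andP[sb tb] b0 bN].
  rewrite !mem_cat !mem_filter !mem_iota !add0n.
  move: bN; rewrite leq_eqVlt => /orP[/eqP->|bN]; first by rewrite mem_nseq eqxx !orbT.
  rewrite bN /= !andbT /typical b0 sb tb /= /bad1 /bad2 b0 /= ltNge.
  by case: (split_ok k b); case: (_ <= _); rewrite ?orbT.
have h1R : (count bad1 (iota 0 N))%:R * 100 <= N%:R :> R by rewrite -natrM ler_nat.
have N400R : 400 <= N%:R :> R by rewrite ler_nat.
rewrite -(ler_nat R) !natrD in sub.
move: sub hgood h1R h2 N400R.
move: (size _)%:R (size _)%:R (count _ _)%:R (count _ _)%:R (N%:R) => c2 c1 a g m.
lra.
Qed.

(** Each typical b is paired with the products C < 16^(30 k) <= N of its split primes;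
    [primitive_solution] represents every such C. *)
Lemma N_glob_lower (R : realType) n k (T : R) (c : R) (N := Num.truncn T) :
  prime n -> (3 < n)%N -> (0 < k)%N -> (16 ^ (30 * k) <= N)%N -> 0 < T ->
  (forall b k, (0 < k)%N -> split_ok k b ->
    recip_sum R (oddsqf_all (predC (splits b))) (16 ^ k).-1 <= 1200 * Num.sqrt k%:R ->
    c * (16 ^ (30 * k))%:R <=
      (size (rng (oddsqf_all (splits b)) (16 ^ (30 * k)).-1))%:R * Num.sqrt k%:R) ->
  (size [seq b <- iota 0 N | typical R n k b])%:R * (c * (16 ^ (30 * k))%:R) <=
    (N_glob n T)%:R * Num.sqrt k%:R.
Proof.
move=> pn n3 k0 MN T0 hc; set M := (16 ^ (30 * k))%N in MN hc *.
set bs := [seq b <- _ | _].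
pose cs b := rng (oddsqf_all (splits b)) M.-1.
pose l := [seq ((b%:Z, C%:Z) : int * int) | b <- bs, C <- cs b].
have /andP[NT _] := truncn_itv (ltW T0); rewrite -/N in NT.
have hl : (size l <= N_glob n T)%N.
  apply: count_pairs_ge.
    apply: allpairs_uniq_dep; first by rewrite filter_uniq // iota_uniq.
      by move=> b _; exact: rng_uniq.
    by move=> [b C] [b' C'] _ _ /= [-> ->].
  move=> z /allpairsPdep[b [C [+ + ->]]]; rewrite mem_filter mem_iota add0n mem_rng /=.
  case/andP=> /and5P[b0 sb /asboolP tb _ _] bN /and3P[hC C0 CM].
  have CN : (C < N)%N by apply: leq_trans MN; rewrite -(prednK (expn_gt0 16 (30 * k) : 0 < M)%N) ltnS.
  have lt m : (m < N)%N -> (`|m%:Z|%:~R : R) < T.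
    by move=> mN; apply: lt_le_trans NT; rewrite ger0_norm // -pmulrn ltr_nat.
  rewrite !eqz_nat -!lt0n !lt //; split => //.
  have [cop [r hr]] := crt_root hC.
  have oC : odd C by case/andP: hC => /and3P[].
  exact: (primitive_solution b0 sb oC cop hr pn n3 tb).
have -> : (size bs)%:R * (c * M%:R) = \sum_(b <- bs) c * M%:R.
  by rewrite big_const_seq count_predT iter_addr_0 mulr_natl.
apply: le_trans (_ : \sum_(b <- bs) (size (cs b))%:R * Num.sqrt k%:R <= _).
  rewrite big_seq [leRHS]big_seq; apply: ler_sum => b.
  by rewrite mem_filter => /andP[/and5P[_ _ _ ok hG] _]; exact: hc.
rewrite -mulr_suml ler_wpM2r ?sqrtr_ge0 //.
apply: le_trans (_ : (size l)%:R <= _); last by rewrite ler_nat.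
by rewrite -sum1_size big_allpairs_dep natr_sum; apply: ler_sum => b _; rewrite sum1_size.
Qed.

(** In use X and Y are the global and the local count, l = ln N and M = 16^(30 k). One bound carries
    sqrt(l), the other sqrt(k) <= sqrt(l), and the roots cancel: this is where the two orders of
    growth match. *)
Lemma ratio_bound (R : realType) (X Y N l k c M P A D : R) : 0 < N -> 0 < k -> k <= l ->
  0 < c -> 0 < P -> 0 < M -> 0 < A -> 0 < D -> N <= P * M ->
  Y * l <= A * N ^+ 2 * Num.sqrt l -> N * (c * M) <= D * (X * Num.sqrt k) ->
  Y * c <= X * (A * (D * P)).
Proof.
move=> N0 k0 kl c0 P0 M0 A0 D0 NPM hY hX.
have l0 : 0 < l by apply: lt_le_trans kl.
have sl0 : 0 < Num.sqrt l by rewrite sqrtr_gt0.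
have sk0 : 0 < Num.sqrt k by rewrite sqrtr_gt0.
have skl : Num.sqrt k <= Num.sqrt l by rewrite ler_wsqrtr.
have hY2 : Y * Num.sqrt l <= A * N ^+ 2.
  rewrite -(ler_pM2r sl0); have -> : Y * Num.sqrt l * Num.sqrt l = Y * l.
    by rewrite -mulrA -[X in _ * X = _]expr2 sqr_sqrtr // ltW.
  exact: hY.
have X0 : 0 <= X.
  have : 0 <= D * (X * Num.sqrt k) by apply: le_trans hX; rewrite !mulr_ge0 // ltW.
  by rewrite pmulr_rge0 // pmulr_lge0.
have h1 : N ^+ 2 * c <= D * P * X * Num.sqrt l.
  apply: le_trans (_ : P * (N * (c * M)) <= _).
    have -> : P * (N * (c * M)) = N * c * (P * M) by ring.
    have -> : N ^+ 2 * c = N * c * N by ring.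
    by rewrite ler_wpM2l // mulr_ge0 // ltW.
  apply: le_trans (ler_wpM2l (ltW P0) hX) _.
  have -> : P * (D * (X * Num.sqrt k)) = D * P * X * Num.sqrt k by ring.
  by rewrite ler_wpM2l // !mulr_ge0 // ltW.
rewrite -(ler_pM2r sl0).
have -> : Y * c * Num.sqrt l = c * (Y * Num.sqrt l) by ring.
apply: le_trans (ler_wpM2l (ltW c0) hY2) _.
have -> : X * (A * (D * P)) * Num.sqrt l = A * (D * P * X * Num.sqrt l) by ring.
have -> : c * (A * N ^+ 2) = A * (N ^+ 2 * c) by ring.
by apply: ler_wpM2l => //; exact: ltW.
Qed.

Lemma ln_pow16_ge (R : realType) k : k%:R <= ln (16 ^ (30 * k))%:R :> R.
Proof.
have -> : (16 ^ (30 * k) = 2 ^ (k * 120))%N by rewrite -[16%N]/(2 ^ 4)%N -expnM; congr expn; ring.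
rewrite natrX lnXn // -[leRHS]mulr_natl natrM -mulrA ler_peMr //.
have h2 := ln2_ge R; lra.
Qed.

(** [limf_einf] unfolds to minus an infimum of suprema over neighbourhoods of infinity, and the
    neighbourhood T > T0 already bounds it. *)
Lemma limf_einf_gt0 (R : realType) (f : R -> R) (T0 d : R) : 0 < d ->
  (forall T, T0 < T -> d <= f T) -> (0 < limf_einf (fun T => (f T)%:E) (@pinfty_nbhs R))%E.
Proof.
move=> d0 h; rewrite /limf_einf oppe_gt0.
apply: le_lt_trans (_ : (- d)%:E < 0)%E; last by rewrite lte_fin oppr_lt0.
apply: le_trans (ereal_inf_lbound _) _.
  by exists [set T | T0 < T]; first by exists T0; split => //; exact: num_real.
apply: ge_ereal_sup => _ [T /= TT0 <-]; rewrite lee_fin lerN2.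
exact: h.
Qed.

Theorem theorem7p4 (R : realType) (n : nat)
  (n_prime : prime n) (n_odd : odd n) (n_gt3 : (3 < n)%N)
  (imaginary_avg :
     asymptotically (torsion_sum n (-1)) (fun T : R => 2 * T / zeta2 R))
  (real_avg :
     asymptotically (torsion_sum n 1)
       (fun T : R => n.+1%:R / n%:R * (T / zeta2 R))) :
  (0 < limf_einf (fun T : R => ((N_glob n T)%:R / (N_loc n T)%:R : R)%:E)
         (@pinfty_nbhs R))%E.
Proof.
have n1 : (1 < n)%N by apply: prime_gt1.
have [T1 hT1] := torsion_free_density n_odd n1 imaginary_avg.
have [c c0 hc] := split_products_lower R.
have [P [P0 hP]] : exists P : R, 0 < P /\ (16 ^ 30)%:R = P.
  by eexists; split; [|reflexivity]; rewrite ltr0n expn_gt0.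
have [T2 hT2] : exists T2, (16 ^ (30 * 9) <= T2)%N by eexists; exact: leqnn.
have [T3 hT3] : exists T3, (400 <= T3)%N by eexists; exact: leqnn.
have [A [A0 hA]] : exists A : R, 0 < A /\ 8 * 224 = A.
  by exists (8 * 224); split; first by rewrite -natrM ltr0n.
have [D [D0 hD]] : exists D : R, 0 < D /\ 400 = D.
  by exists 400; split; first by rewrite ltr0n.
have ADP : 0 < A * (D * P) by rewrite !mulr_gt0.
apply: (@limf_einf_gt0 R _ (Num.max (Num.max T1 1) (Num.max T3%:R T2%:R)) (c / (A * (D * P)))).
  by rewrite divr_gt0.
move=> T; rewrite !gt_max => /andP[/andP[TT1 T1'] /andP[TT3 TT2]].
have T0 : 0 < T by apply: lt_trans T1'.
set N := Num.truncn T.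
have N400 : (400 <= N)%N by apply: leq_trans hT3 _; rewrite truncn_ge_nat ltW.
have NT2 : (T2 <= N)%N by rewrite truncn_ge_nat ltW.
have N0 : (0 < N)%N by apply: leq_trans N400.
(* This k satisfies 16^(30 k) <= N < 16^(30 (k + 1)), so N is within the factor P = 16^30 of 16^(30
   k). *)
pose k := (trunc_log 16 N %/ 30)%N.
have lgN := trunc_logP (isT : 1 < 16)%N N0.
have k9 : (9 <= k)%N.
  rewrite leq_divRL // mulnC; apply: trunc_log_max => //; exact: leq_trans hT2 NT2.
have k0 : (0 < k)%N by apply: leq_trans k9.
have hN : (16 ^ (30 * k) <= N < 16 ^ (30 * k.+1))%N.
  apply/andP; split.
    by apply: leq_trans lgN; rewrite leq_exp2l // mulnC leq_divM.
  apply: leq_trans (trunc_log_ltn N (isT : 1 < 16)%N) _.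
  by rewrite leq_exp2l // mulnC ltn_ceil.
have hgood := typical_count k9 hN N400 (hT1 _ TT1); rewrite hD in hgood.
have /andP[MN NM] := hN.
have hglob := N_glob_lower n_prime n_gt3 k0 MN T0 hc.
have n0 : (0 < n)%N by apply: ltnW.
have N16 : (16 <= N)%N by apply: leq_trans N400.
have hloc := N_loc_upper n0 N16; rewrite [8 * (_ * _)]mulrA hA in hloc.
have Y0 := N_loc_gt0 n T1'.
have Y0' : (0 : R) < (N_loc n T)%:R by rewrite ltr0n.
rewrite ler_pdivlMr // mulrAC ler_pdivrMr // mulrC.
have M0 : (0 : R) < (16 ^ (30 * k))%:R by rewrite ltr0n expn_gt0.
apply: (@ratio_bound R _ _ N%:R (ln N%:R) k%:R c (16 ^ (30 * k))%:R P A D) => //.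
- by rewrite ltr0n.
- by rewrite ltr0n.
- apply: le_trans (ln_nat_le R _ MN); last by rewrite expn_gt0.
  exact: ln_pow16_ge.
- rewrite -hP -natrM ler_nat; apply: leq_trans (ltnW NM) _.
  by rewrite mulnS expnD.
apply: le_trans (ler_wpM2r (mulr_ge0 (ltW c0) (ltW M0)) hgood) _.
by rewrite -[leLHS]mulrA ler_wpM2l // ltW.
Qed.
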